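(* Let $m\ge1$, $n\ge3$. For each $k\ge0$: (a) $\mathrm H^0(\mathcal{LD}^*_k)=\ker(\delta:\mathcal{LD}^0_k\to\mathcal{LD}^1_k)$ consists of all linear combinations $\alpha=\sum a_i\Gamma_i$ of trivalent diagrams $\Gamma_i$ (i.e. elements of $\mathcal{LD}^0_k$) which satisfy - the STU relation: $(S^*+T^*+U^* )(\alpha)=\langle S+T+U,\alpha\rangle=0$ for all STU triples $(S,T,U)$; - the IHX relation: $(I^*+H^*+X^* )(\alpha)=\langle I+H+X,\alpha\rangle=0$ for all IHX triples $(I,H,X)$; and - the 1T relation: $(1T)^*(\alpha)=\langle 1T,\alpha\rangle=0$ for all 1T diagrams. (b) $\mathrm H^0(\mathcal{HD}^*_k)=\ker(\delta:\mathcal{HD}^0_k\to\mathcal{HD}^1_k)$ consists of all linear combinations $\alpha=\sum a_i\Gamma_i$ of trivalent diagrams $\Gamma_i$ in $\mathcal{HD}^0_k$ which satisfy - the STU relation, - the IHX relation, and - the H1T relation: $\Gamma^*(\alpha)=\langle\Gamma,\alpha\rangle=0$ for any $\Gamma$ containing a closed path of edges.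
   Context: **Link diagrams.** A diagram is $\Gamma=(V,E,b)$ with $V$ a finite ordered set (vertices), $E$ a finite set (edges), $b$ a map from $E$ to the nonempty subsets of $V$ of cardinality at most $2$; $e$ joins $v$ and $w$ if $b(e)=\{v,w\}$. A path between $v,w$ is a sequence of edges $e_1,\dots,e_r$ with $v\in b(e_1)$, $w\in b(e_r)$, $b(e_i)\cap b(e_{i+1})\ne\emptyset$. Let $I_1,\dots,I_m$ be copies of $[0,1]$ (segments), with $\sqcup I_i$ ordered first by index, then by the order of $[0,1]$. A link diagram is a diagram with: a decomposition $V=V_{seg}\sqcup V_{free}$ (segment vertices preceding free ones); an injection $V_{seg}\to\sqcup_i\mathrm{int}(I_i)$, considered only up to the induced distribution of segment vertices among segments and their order there, and inducing the order of $V_{seg}$; each edge is a chord (joins distinct segment vertices), mixed edge (free and segment vertex), free edge (distinct free vertices) or loop (segment vertex with itself); each free vertex has a path to a segment vertex; each vertex has valence $\ge3$, where the valence of a free vertex is the number of edges joining it to other vertices and that of a segment vertex is the number of edges to other vertices plus twice the number of loops plus $2$. If $n$ is even, $E$ is ordered; if $n$ is odd, each edge is oriented (a loop also has two possible orientations). An arc is a pair $(v_1,v_2)$, $v_1<v_2$, of consecutive segment vertices on one segment, with $b=\{v_1,v_2\}$, oriented from $v_1$ to $v_2$; arcs are not edges. The defect is $2|E|-3|V_{free}|-|V_{seg}|$ and the order is $|E|-|V_{free}|$; defect $0$ means that every vertex is trivalent. $\mathcal{LD}^d_k$ is the real vector space generated by isomorphism classes of link diagrams of defect $d$ and order $k$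 modulo: $\Gamma=0$ if some two vertices are joined by more than one edge; for $n$ odd, $\Gamma=(-1)^\sigma\Gamma'$ if $\Gamma,\Gamma'$ differ by relabeling, $\sigma$ = parity of the vertex permutation plus number of edges with different orientation; for $n$ even, the same with $\sigma$ = parity of the permutation of segment vertices plus parity of the permutation of edges. $\mathcal{HD}^d_k\subset\mathcal{LD}^d_k$ is the subspace generated by diagrams which contain no loops and such that any path between distinct vertices on a given segment passes through a vertex on another segment. **Differential.** For a free edge, mixed edge or arc $e$ with $b(e)=\{v,w\}$, $v<w$, $\Gamma/e$ is obtained by deleting $w$ (and $e$, if it is an edge) and replacing $w$ by $v$ in all values of $b$. $\delta(\Gamma)=\sum_e\epsilon(e)\Gamma/e$ over free edges, mixed edges and arcs, $\delta:\mathcal{LD}^d_k\to\mathcal{LD}^{d+1}_k$; it preserves $\mathcal{HD}$. For $n$ odd and $e$ oriented from $v$ to $w$, $\epsilon(e)=(-1)^{\mathrm{pos}(w:V)}$ if $v<w$ and $-(-1)^{\mathrm{pos}(v:V)}$ if $w<v$. For $n$ even, $\epsilon(e)=(-1)^{\mathrm{pos}(e:E)+|V_{free}|+1}$ if $e$ is an edge and $(-1)^{\mathrm{pos}(\max\{v,w\})}$ if $e$ is an arc. Here $\mathrm{pos}(x:S)$ is the position of $x$ in the ordered set $S$. **Pairing.** $\langle\Gamma_1,\Gamma_2\rangle=\delta_{\Gamma_1,\Gamma_2}|\mathrm{Aut}(\Gamma_1)|$ (Kronecker delta), extended bilinearly; $\Gamma^*=\langle\Gamma,-\rangle$. $\mathrm{Aut}(\Gamma)$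 is the group of automorphisms of $\Gamma$ (pairs of bijections of $V$ and $E$ compatible with $b$), ignoring labels and edge orientations but fixing every segment vertex. **Relations.** A diagram of defect $1$ has exactly one $4$-valent vertex, all others being trivalent. In (a) the relations below come from nonzero diagrams in $\mathcal{LD}^1_k$, in (b) from nonzero diagrams in $\mathcal{HD}^1_k$; diagrams among $S,T,U,I,H,X$ not belonging to the complex in question are counted as $0$. - STU triple: if the $4$-valent vertex $i$ is a segment vertex with edges $e,e'$ to other vertices, $S$ is obtained by moving the ends of $e,e'$ from $i$ to a new free vertex $j$ and joining $j$ to $i$ by a mixed edge; $T$ (resp. $U$) is obtained by replacing $i$ by two consecutive segment vertices $i,i+1$ with $e$ attached to $i$ and $e'$ to $i+1$ (resp. the opposite). - IHX triple: if the $4$-valent vertex is free, $I,H,X$ are obtained by replacing it by two free vertices joined by a new free edge and distributing the four edges $2+2$ in the three possible ways. - 1T diagram: a trivalent diagram with a chord joining two consecutive segment vertices on the same segment. The members of a triple are signed so that contracting the new edge or arc, including the sign $\epsilon$, gives $+1$ times the original defect-$1$ diagram. A closed path of edges means a cycle formed by edges (arcs are not used). *)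

(* Defs.v *)
From HB Require Import structures.
From mathcomp Require Import all_boot all_order all_algebra all_fingroup.
From mathcomp Require Import boolp reals zify.

Set Implicit Arguments.
Unset Strict Implicit.
Unset Printing Implicit Defensive.

Import Order.TTheory GRing.Theory Num.Theory.
Local Open Scope ring_scope.

(* A labelled diagram with [N] vertices and [e] edges on [m] segments.
   - Vertices are 'I_N, in their given order.  The first component sends a
     segment vertex to the segment it lies on and a free vertex to [None]; as
     the order of the segment vertices is the one induced by the segments,
     nothing else has to be recorded about their position.
   - Edges are 'I_e.  Edge [i] is [(x, y, c)], with [b i = {x, y}], oriented
     from [x] to [y]; the bit [c] tells apart the two orientations of a loop.
   The order of the edges is part of the structure only for [n] even, their
   orientation only for [n] odd, and [c] only for loops: [rel_sign] below
   gives sign [+1] to any change of the other data. *)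
Definition graph (m N e : nat) : Type :=
  ({ffun 'I_N -> option 'I_m} * {ffun 'I_e -> 'I_N * 'I_N * bool})%type.

Section Diagrams.
Variable m : nat.
Implicit Types N e : nat.

Definition loc N e (G : graph m N e) (v : 'I_N) : option 'I_m := G.1 v.
Definition src N e (G : graph m N e) (i : 'I_e) : 'I_N := (G.2 i).1.1.
Definition tgt N e (G : graph m N e) (i : 'I_e) : 'I_N := (G.2 i).1.2.
Definition loop_or N e (G : graph m N e) (i : 'I_e) : bool := (G.2 i).2.

Definition ends N e (G : graph m N e) (i : 'I_e) : {set 'I_N} :=
  [set src G i; tgt G i].

Definition seg N e (G : graph m N e) (v : 'I_N) : bool := loc G v != None.

Definition nseg N e (G : graph m N e) : nat := #|[set v | seg G v]|.
Definition nfree N e (G : graph m N e) : nat := #|[set v | ~~ seg G v]|.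

Definition is_chord N e (G : graph m N e) (i : 'I_e) : bool :=
  [&& src G i != tgt G i, seg G (src G i) & seg G (tgt G i)].
Definition is_mixed N e (G : graph m N e) (i : 'I_e) : bool :=
  seg G (src G i) (+) seg G (tgt G i).
Definition is_free_edge N e (G : graph m N e) (i : 'I_e) : bool :=
  [&& src G i != tgt G i, ~~ seg G (src G i) & ~~ seg G (tgt G i)].
Definition is_loop N e (G : graph m N e) (i : 'I_e) : bool :=
  (src G i == tgt G i) && seg G (src G i).

Definition valence N e (G : graph m N e) (v : 'I_N) : nat :=
  (#|[set i | (v \in ends G i) && (ends G i != [set v])]|
   + (if seg G v then 2 * #|[set i | ends G i == [set v]]| + 2 else 0))%N.

Definition touch N e (G : graph m N e) : rel 'I_e :=
  fun i j => ends G i :&: ends G j != set0.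

(* The edges [i :: p] form a path between [v] and [w]. *)
Definition edge_path N e (G : graph m N e) (v w : 'I_N) (i : 'I_e)
    (p : seq 'I_e) : bool :=
  [&& path (touch G) i p, v \in ends G i & w \in ends G (last i p)].

Definition well_ordered N e (G : graph m N e) : bool :=
  [forall v : 'I_N, forall w : 'I_N, (v < w)%N ==>
    match loc G v, loc G w with
    | Some s, Some t => (s <= t)%N
    | None, Some _ => false
    | _, None => true
    end].

Definition link_diagram N e (G : graph m N e) : bool :=
  [&& well_ordered G,
      [forall i, [|| is_chord G i, is_mixed G i, is_free_edge G i
                   | is_loop G i]],
      `[< forall v, ~~ seg G v ->
            exists w i p, seg G w /\ edge_path G v w i p >]
    & [forall v, (3 <= valence G v)%N]].

Definition defect N e (G : graph m N e) : int :=
  (2 * e)%:Z - (3 * nfree G)%:Z - (nseg G)%:Z.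
Definition diag_order N e (G : graph m N e) : int := e%:Z - (nfree G)%:Z.

Definition in_LD (d k : nat) N e (G : graph m N e) : bool :=
  [&& link_diagram G, defect G == d%:Z & diag_order G == k%:Z].

Definition multi_edge N e (G : graph m N e) : bool :=
  [exists i, exists j,
    [&& i != j, src G i != tgt G i & ends G i == ends G j]].

Definition is_HD N e (G : graph m N e) : bool :=
  [forall i, ~~ is_loop G i] &&
  `[< forall (v w : 'I_N) (s : 'I_m),
        v != w -> loc G v = Some s -> loc G w = Some s ->
      forall (i : 'I_e) (p : seq 'I_e), edge_path G v w i p ->
      exists (j : 'I_e) (x : 'I_N) (t : 'I_m),
        [/\ j \in i :: p, x \in ends G j, loc G x = Some t & t != s] >].

(* An isomorphism from [G] to [H], labels and orientations aside.  A segment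
   vertex is determined by its segment and its rank there, so it is fixed; in
   particular the permutation of the segment vertices that enters the sign for
   [n] even is always trivial. *)
Definition relabeling N e (G H : graph m N e) (p : 'S_N) (t : 'S_e) : bool :=
  [&& [forall v, loc H (p v) == loc G v],
      [forall v, seg G v ==> (p v == v)]
    & [forall i, ends H (t i) == p @: ends G i]].

Definition same_orientation N e (G H : graph m N e) (p : 'S_N) (t : 'S_e)
    (i : 'I_e) : bool :=
  if src G i == tgt G i then loop_or H (t i) == loop_or G i
  else src H (t i) == p (src G i).

Definition rel_sign (n : nat) N e (G H : graph m N e) (p : 'S_N) (t : 'S_e)
    : nat :=
  if odd n then (odd_perm p + #|[set i | ~~ same_orientation G H p t i]|)%N
  else odd_perm t.

Definition Aut_diag N e (G : graph m N e) : {set 'S_N * 'S_e} :=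
  [set q | relabeling G G q.1 q.2].

Definition del_edge N e (G : graph m N e) (i : 'I_e) : graph m N e.-1 :=
  (G.1, [ffun j => G.2 (lift i j)]).

Definition merge_vertex N (w : 'I_N) (v : 'I_N.-1) (x : 'I_N) : 'I_N.-1 :=
  odflt v (unlift w x).

(* Deletes [w] and replaces it by the vertex [lift w v] in all edges.  The
   edges keep their orientation; a chord which becomes a loop gets one of the
   two loop orientations according to whether it was oriented upwards. *)
Definition contract N e (G : graph m N e) (w : 'I_N) (v : 'I_N.-1)
    : graph m N.-1 e :=
  ([ffun y => loc G (lift w y)],
   [ffun i => (merge_vertex w v (src G i), merge_vertex w v (tgt G i),
               if src G i == tgt G i then loop_or G i
               else (tgt G i < src G i)%N)]).

Definition is_arc N e (G : graph m N e) (v w : 'I_N) : bool :=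
  [&& seg G v, loc G v == loc G w & w == v.+1 :> nat].

(* A cycle through distinct vertices [x i] and distinct edges [c i]. *)
Definition has_cycle N e (G : graph m N e) : Prop :=
  exists (r : nat) (x : 'I_r.+1 -> 'I_N) (c : 'I_r.+1 -> 'I_e),
    [/\ injective x, injective c &
        forall i, ends G (c i) = [set x i; x (ordS i)]].

(* Creates a new vertex, with label [h] and location [l], and moves to it the
   ends at [i] of the edges in [A]. *)
Definition split_vertex N e (G : graph m N e) (i : 'I_N) (h : 'I_N.+1)
    (l : option 'I_m) (A : {set 'I_e}) : graph m N.+1 e :=
  let mv j x := if (j \in A) && (x == i) then h else lift h x in
  ([ffun y => if unlift h y is Some x then loc G x else l],
   [ffun j => (mv j (src G j), mv j (tgt G j), loop_or G j)]).

Definition add_edge N e (G : graph m N e) (x y : 'I_N) : graph m N e.+1 :=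
  (G.1, [ffun j => if unlift ord_max j is Some j' then G.2 j'
                   else (x, y, false)]).

(* The ends at [i] of the edges in [A] move to a new free vertex, which is
   joined to [i] by a new edge; both are last in their order. *)
Definition blow_up N e (G : graph m N e) (i : 'I_N) (A : {set 'I_e})
    : graph m N.+1 e.+1 :=
  add_edge (split_vertex G i ord_max None A) (lift ord_max i) ord_max.

(* The segment vertex [i] is replaced by two consecutive ones, [i] and
   [i + 1], and the ends at [i] of the edges in [A] move to [i + 1]. *)
Definition double_vertex N e (G : graph m N e) (i : 'I_N) (A : {set 'I_e})
    : graph m N.+1 e :=
  split_vertex G i (lift ord0 i) (loc G i) A.

End Diagrams.

Section Complex.
Variables (R : realType) (m n : nat).
Implicit Types d k N e : nat.

Definition eps_edge N e (G : graph m N e) (i : 'I_e) : R :=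
  if odd n then
    if (src G i < tgt G i)%N then (-1) ^+ (tgt G i).+1
    else - (-1) ^+ (src G i).+1
  else (-1) ^+ (i.+1 + nfree G + 1).

(* The sign of an arc from [v] to [w], for [v < w]. *)
Definition eps_arc N (w : 'I_N) : R := (-1) ^+ w.+1.

(* All diagrams of order [k] and nonnegative defect have at most [2k] vertices
   and [3k] edges, since 2|E| - 3|V_free| - |V_seg| = 2(|E| - |V_free|) - |V|. *)
Definition sizes k : finType := ('I_(2 * k).+1 * 'I_(3 * k).+1)%type.

Definition gens d k : finType :=
  {x : {u : sizes k & graph m u.1 u.2} | in_LD d k (tagged x)}.

Definition gen_graph d k (g : gens d k) :
  graph m (tag (val g)).1 (tag (val g)).2 := tagged (val g).

Definition diagram : eqType := {u : nat * nat & graph m u.1 u.2}.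
Definition diag N e (G : graph m N e) : diagram :=
  Tagged (fun u : nat * nat => graph m u.1 u.2) (i := (N, e)) G.

Definition chains d k : vectType R := {ffun gens d k -> R^o}.

(* The basis vector of [G], or 0 if [G] is not a diagram of defect [d] and
   order [k]. *)
Definition basis d k N e (G : graph m N e) : chains d k :=
  [ffun g : gens d k => (diag (gen_graph g) == diag G)%:R].

Definition Rel d k : {vspace chains d k} :=
  (\sum_(u : sizes k) \sum_(G : graph m u.1 u.2 | in_LD d k G && multi_edge G)
     <[basis d k G]>
   + \sum_(u : sizes k) \sum_(G : graph m u.1 u.2) \sum_(H : graph m u.1 u.2)
     \sum_(p : 'S_u.1) \sum_(t : 'S_u.2 | [&& in_LD d k G, in_LD d k H
                                            & relabeling G H p t])
     <[basis d k G - (-1) ^+ rel_sign n G H p t *: basis d k H]>)%VS.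

(* The quotient of [chains d k] by [Rel d k], realised on a complement of
   [Rel d k]; see [lker_quo] and [limg_quo] below. *)
Definition LD d k : vectType R := subvs_of (Rel d k)^C%VS.

Definition quo_fun d k (x : chains d k) : LD d k :=
  vsproj (Rel d k)^C (daddv_pi (Rel d k)^C (Rel d k) x).

Fact quo_fun_is_linear d k : linear (@quo_fun d k).
Proof.
move=> a x y; rewrite /quo_fun (linearP (daddv_pi _ _)).
exact: (linearP (vsproj _)).
Qed.
HB.instance Definition _ d k :=
  GRing.isLinear.Build R (chains d k) (LD d k) _ (@quo_fun d k)
    (@quo_fun_is_linear d k).

Definition quo d k : 'Hom(chains d k, LD d k) := linfun (@quo_fun d k).

Definition cls d k N e (G : graph m N e) : LD d k := quo d k (basis d k G).

(* The linear map sending the class of a diagram [g] to [f g], for any [f]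
   compatible with the relations; see [lin_extE] below. *)
Definition lin_ext d k (W : vectType R) (f : gens d k -> W) (x : LD d k) : W :=
  \sum_(g : gens d k) (vsval x g : R) *: f g.

Fact lin_ext_is_linear d k (W : vectType R) (f : gens d k -> W) :
  linear (lin_ext f).
Proof.
move=> a x y; rewrite /lin_ext scaler_sumr -big_split /=; apply: eq_bigr => g _.
rewrite scalerA -scalerDl; congr (_ *: _).
have E : vsval (a *: x + y) = a *: vsval x + vsval y by [].
by rewrite [LHS](congr1 (fun z : chains d k => z g) E) !ffunE.
Qed.
HB.instance Definition _ d k (W : vectType R) (f : gens d k -> W) :=
  GRing.isLinear.Build R (LD d k) W _ (@lin_ext d k W f)
    (@lin_ext_is_linear d k W f).

(* The differential of a diagram.  For each edge or arc, [w] is its larger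
   vertex and [lift w v] its smaller one. *)
Definition delta_diag d k N e (G : graph m N e) : LD d.+1 k :=
  if multi_edge G then 0 else
    \sum_(i : 'I_e | is_free_edge G i || is_mixed G i)
      \sum_(w : 'I_N) \sum_(v : 'I_N.-1 | (v < w)%N &&
                               (ends G i == [set lift w v; w]))
        eps_edge G i *: cls d.+1 k (contract (del_edge G i) w v)
  + \sum_(w : 'I_N) \sum_(v : 'I_N.-1 | (v < w)%N && is_arc G (lift w v) w)
        eps_arc w *: cls d.+1 k (contract G w v).

(* By [delta_cls] below, [delta] sends the class of a diagram [G] to
   [delta_diag G]. *)
Definition delta d k : 'Hom(LD d k, LD d.+1 k) :=
  linfun (lin_ext (fun g : gens d k => delta_diag d k (gen_graph g))).

Definition HD d k : {vspace LD d k} :=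
  (\sum_(g : gens d k | is_HD (gen_graph g)) <[cls d k (gen_graph g)]>)%VS.

(* The complexes vanish in negative degrees, as all valences are at least 3. *)
Definition H0_LD k : {vspace LD 0 k} := lker (delta 0 k).
Definition H0_HD k : {vspace LD 0 k} := (HD 0 k :&: lker (delta 0 k))%VS.

(* The Kronecker delta of the classes of two diagrams, up to sign. *)
Definition kronecker d k (x y : LD d k) : R :=
  if x == 0 then 0 else if x == y then 1 else if x == - y then -1 else 0.

(* By [pairing_cls] below, this is the bilinear extension of
   (G, H) |-> kronecker G H * |Aut G|. *)
Definition pairing d k (x y : LD d k) : R :=
  \sum_(g : gens d k) \sum_(h : gens d k)
     (vsval x g : R) * (vsval y h : R) *
     (kronecker (cls d k (gen_graph g)) (cls d k (gen_graph h))
        * #|Aut_diag (gen_graph g)|%:R).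

(* In the relations below, [P] selects the diagrams of the complex in
   question. *)
Definition subcomplex := forall N e, graph m N e -> bool.
Definition in_whole_LD : subcomplex := fun _ _ _ => true.
Definition in_HD : subcomplex := fun _ _ G => is_HD G.

(* The diagram [K] with the sign for which [x], the class of the contraction
   of its new edge or arc multiplied by the sign [eps], becomes [+1] times [y],
   the class of the diagram [K] comes from; [x] is always [y] or [- y] by
   [cls_contract_blow_up] and [cls_contract_double] below. *)
Definition signed_member (P : subcomplex) k (x y : LD 1 k) N e
    (K : graph m N e) : LD 0 k :=
  if P N e K then (if x == y then 1 else -1) *: cls 0 k K else 0.

Definition edge_member (P : subcomplex) k N e (G : graph m N e) (i : 'I_N)
    (A : {set 'I_e}) : LD 0 k :=
  let K := blow_up G i A in
  signed_member P
    (eps_edge K ord_max *: cls 1 k (contract (del_edge K ord_max) ord_max i))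
    (cls 1 k G) K.

Definition arc_member (P : subcomplex) k N e (G : graph m N e) (i : 'I_N)
    (A : {set 'I_e}) : LD 0 k :=
  let K := double_vertex G i A in
  signed_member P
    (eps_arc (lift ord0 i) *: cls 1 k (contract K (lift ord0 i) i))
    (cls 1 k G) K.

Definition nonzero_diagram (P : subcomplex) k N e (G : graph m N e) : Prop :=
  [/\ in_LD 1 k G, P N e G & cls 1 k G != 0].

Definition STU_triple (P : subcomplex) k (S T U : LD 0 k) : Prop :=
  exists (N e : nat) (G : graph m N e) (i : 'I_N) (a b : 'I_e),
    [/\ nonzero_diagram P k G,
        seg G i /\ valence G i = 4,
        [/\ a != b, i \in ends G a, i \in ends G b, ~~ is_loop G a
          & ~~ is_loop G b]
      & [/\ S = edge_member P k G i [set a; b],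
            T = arc_member P k G i [set b]
          & U = arc_member P k G i [set a]]].

Definition IHX_triple (P : subcomplex) k (I H X : LD 0 k) : Prop :=
  exists (N e : nat) (G : graph m N e) (i : 'I_N) (a b c d : 'I_e),
    [/\ nonzero_diagram P k G,
        ~~ seg G i /\ valence G i = 4,
        uniq [:: a; b; c; d] /\ [set j | i \in ends G j] = [set a; b; c; d]
      & [/\ I = edge_member P k G i [set a; b],
            H = edge_member P k G i [set a; c]
          & X = edge_member P k G i [set a; d]]].

Definition STU_relation (P : subcomplex) k (alpha : LD 0 k) : Prop :=
  forall S T U, STU_triple P S T U -> pairing (S + T + U) alpha = 0.

Definition IHX_relation (P : subcomplex) k (alpha : LD 0 k) : Prop :=
  forall I H X, IHX_triple P I H X -> pairing (I + H + X) alpha = 0.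

Definition is_1T N e (G : graph m N e) : Prop :=
  exists (i : 'I_e) (v w : 'I_N),
    [/\ is_chord G i, is_arc G v w & ends G i = [set v; w]].

Definition oneT_relation k (alpha : LD 0 k) : Prop :=
  forall N e (G : graph m N e), in_LD 0 k G -> is_1T G ->
  pairing (cls 0 k G) alpha = 0.

Definition H1T_relation k (alpha : LD 0 k) : Prop :=
  forall N e (G : graph m N e), in_LD 0 k G -> has_cycle G ->
  pairing (cls 0 k G) alpha = 0.

End Complex.

Section Quotient.
Variables (R : realType) (m n : nat).
Implicit Types d k N e : nat.

Let disjoint_Rel d k : ((Rel R m n d k)^C :&: Rel R m n d k = 0)%VS.
Proof. by rewrite capvC capv_compl. Qed.

Lemma val_quo d k (x : chains R m d k) :
  vsval (quo R m n d k x) = daddv_pi (Rel R m n d k)^C (Rel R m n d k) x.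
Proof. by rewrite lfunE /= /quo_fun vsprojK // memv_pi. Qed.

Lemma val_quo_sub d k (x : chains R m d k) :
  x - vsval (quo R m n d k x) \in Rel R m n d k.
Proof.
rewrite val_quo -{1}[x](daddv_pi_add (disjoint_Rel d k)); last first.
  by rewrite addvC addv_complf memvf.
by rewrite addrC addKr memv_pi.
Qed.

Lemma quo_val d k (y : LD R m n d k) : quo R m n d k (vsval y) = y.
Proof.
apply: val_inj; rewrite /= val_quo daddv_pi_id //; exact: subvsP.
Qed.

Lemma lker_quo d k : lker (quo R m n d k) = Rel R m n d k.
Proof.
apply/vspaceP => x; rewrite memv_ker; apply/eqP/idP => [qx0|xR].
  by have := val_quo_sub x; rewrite qx0 subr0.
apply: val_inj; rewrite /=; apply/eqP; rewrite -memv0 -(disjoint_Rel d k).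
rewrite memv_cap subvsP -[vsval _](subKr x) rpredB ?val_quo_sub //.
Qed.

Lemma limg_quo d k : limg (quo R m n d k) = fullv.
Proof.
apply/vspaceP => y; rewrite memvf -[y]quo_val memv_img ?memvf //.
Qed.

End Quotient.

Section Classes.
Variables (R : realType) (m n : nat).
Implicit Types d k N e : nat.

Lemma nseg_nfree N e (G : graph m N e) : (nseg G + nfree G)%N = N.
Proof.
rewrite /nseg /nfree -[RHS]card_ord -(cardsC [set v | seg G v]).
by congr (_ + #|pred_of_set _|)%N; apply/setP => v; rewrite !inE.
Qed.

Lemma gens_diag_inj d k : injective (fun g : gens m d k => diag (gen_graph g)).
Proof.
case=> [[[[N hN] [e he]] G] hG] [[[[N' hN'] [e' he']] H] hH].
rewrite /gen_graph /= in G H hG hH *.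
move=> E; have [EN Ee] : N = N' /\ e = e' by have := congr1 tag E; case.
case: N' / EN hN' H hH E; case: e' / Ee he' => he' hN' H hH E.
apply: val_inj => /=.
have EG : G = H by apply: eq_from_Tagged E.
by rewrite (bool_irrelevance hN' hN) (bool_irrelevance he' he) EG.
Qed.

Lemma gens_diag_ex d k N e (G : graph m N e) :
  in_LD d k G -> exists g : gens m d k, diag (gen_graph g) = diag G.
Proof.
move=> hG; have := nseg_nfree G => hN.
have [_ /eqP hd /eqP ho] := and3P hG; rewrite /defect /diag_order in hd ho.
have lN : (N < (2 * k).+1)%N by lia.
have le : (e < (3 * k).+1)%N by lia.
pose u : sizes k := (Ordinal lN, Ordinal le).
by exists (exist _ (Tagged (fun u : sizes k => graph m u.1 u.2)
                      (i := u) (G : graph m u.1 u.2)) hG).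
Qed.

Lemma in_LD_gen d k (g : gens m d k) : in_LD d k (gen_graph g).
Proof. exact: (valP g). Qed.

Section LinExt.
Variables (d k : nat) (W : vectType R) (F : forall N e, graph m N e -> W).
Hypothesis F_multi : forall N e (G : graph m N e),
  in_LD d k G -> multi_edge G -> F G = 0.
Hypothesis F_relab : forall N e (G H : graph m N e) p t,
  in_LD d k G -> in_LD d k H -> relabeling G H p t ->
  F G = (-1) ^+ rel_sign n G H p t *: F H.

Let L (x : chains R m d k) : W :=
  \sum_(g : gens m d k) (x g : R) *: F (gen_graph g).

Let L_is_linear : linear L.
Proof.
move=> a x y; rewrite /L scaler_sumr -big_split /=; apply: eq_bigr => g _.
by rewrite !ffunE scalerDl scalerA.
Qed.
HB.instance Definition _ :=
  GRing.isLinear.Build R (chains R m d k) W _ L L_is_linear.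

Let L_basis N e (G : graph m N e) : in_LD d k G -> L (basis R d k G) = F G.
Proof.
move=> hG; have [g Eg] := gens_diag_ex hG.
rewrite /L (bigD1 g) //= big1 ?addr0 => [|h ne_hg].
  rewrite ffunE Eg eqxx scale1r.
  exact: (congr1 (fun D : diagram m => F (tagged D)) Eg).
rewrite ffunE (_ : _ == _ = false) ?scale0r //.
by apply/negbTE; apply: contra ne_hg => /eqP; rewrite -Eg => /gens_diag_inj ->.
Qed.

Let L_Rel x : x \in Rel R m n d k -> L x = 0.
Proof.
move=> xR; suff /subvP/(_ x xR) : (Rel R m n d k <= lker (linfun L))%VS.
  by rewrite memv_ker lfunE => /eqP.
rewrite subv_add; apply/andP; split.
  apply/subv_sumP => u _; apply/subv_sumP => G /andP[hG mG].
  by rewrite -memvE memv_ker lfunE /= L_basis // F_multi.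
apply/subv_sumP => u _; apply/subv_sumP => G _; apply/subv_sumP => H _.
apply/subv_sumP => p _; apply/subv_sumP => t /and3P[hG hH r].
rewrite -memvE memv_ker lfunE /= linearB linearZ /= !L_basis //.
by rewrite (F_relab hG hH r) subrr.
Qed.

Lemma lin_extE N e (G : graph m N e) : in_LD d k G ->
  lin_ext (fun g : gens m d k => F (gen_graph g)) (cls R n d k G) = F G.
Proof.
move=> hG; rewrite -(L_basis hG); apply/esym/subr0_eq.
rewrite -[lin_ext _ _]/(L (vsval (cls R n d k G))) -linearB.
exact/L_Rel/val_quo_sub.
Qed.

End LinExt.

Lemma cls_notin d k N e (G : graph m N e) :
  ~~ in_LD d k G -> cls R n d k G = 0.
Proof.
move=> hG; rewrite /cls (_ : basis R d k G = 0) ?linear0 //.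
apply/ffunP => g; rewrite !ffunE; case: eqP => //= E.
case/negP: hG; have := in_LD_gen g.
by rewrite (congr1 (fun D : diagram m => in_LD d k (tagged D)) E).
Qed.

Lemma Rel_gen_size d k N e (G : graph m N e) : in_LD d k G ->
  exists u : sizes k, (N, e) = (u.1 : nat, u.2 : nat).
Proof.
move=> /gens_diag_ex[g Eg]; exists (tag (val g)).
by have := congr1 tag Eg; rewrite /= => ->.
Qed.

Lemma cls_multi d k N e (G : graph m N e) : multi_edge G -> cls R n d k G = 0.
Proof.
move=> mG; have [hG|/cls_notin//] := boolP (in_LD d k G).
apply/eqP; rewrite -memv_ker lker_quo.
have [u [EN Ee]] := Rel_gen_size hG; subst N e.
apply: (subvP (addvSl _ _)).
apply: (subvP (sumv_sup u _ (subvv _))) => //.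
by apply: (subvP (sumv_sup G _ (subvv _))); rewrite ?hG // memv_line.
Qed.

Lemma cls_relab_in d k N e (G H : graph m N e) p t :
  in_LD d k G -> in_LD d k H -> relabeling G H p t ->
  cls R n d k G = (-1) ^+ rel_sign n G H p t *: cls R n d k H.
Proof.
move=> hG hH r; apply/eqP; rewrite -subr_eq0 -linearZ -linearB -memv_ker.
rewrite lker_quo; have [u [EN Ee]] := Rel_gen_size hG; subst N e.
apply: (subvP (addvSr _ _)).
apply: (subvP (sumv_sup u _ (subvv _))) => //.
apply: (subvP (sumv_sup G _ (subvv _))) => //.
apply: (subvP (sumv_sup H _ (subvv _))) => //.
apply: (subvP (sumv_sup p _ (subvv _))) => //.
by apply: (subvP (sumv_sup t _ (subvv _))); rewrite ?hG ?hH ?r // memv_line.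
Qed.

End Classes.

Section Relabeling.
Variables (m N e : nat).
Implicit Types (G H K : graph m N e) (p : 'S_N) (t : 'S_e).

Lemma relab_loc G H p t v : relabeling G H p t -> loc H (p v) = loc G v.
Proof. by case/and3P => /forallP/(_ v)/eqP. Qed.

Lemma relab_seg G H p t v : relabeling G H p t -> seg H (p v) = seg G v.
Proof. by move=> r; rewrite /seg (relab_loc v r). Qed.

Lemma relab_fix G H p t v : relabeling G H p t -> seg G v -> p v = v.
Proof. by case/and3P => _ /forallP/(_ v)/implyP h _ /h/eqP. Qed.

Lemma relab_ends G H p t i :
  relabeling G H p t -> ends H (t i) = p @: ends G i.
Proof. by case/and3P => _ _ /forallP/(_ i)/eqP. Qed.

Lemma relab_locE G H p t v : relabeling G H p t -> loc H v = loc G v.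
Proof.
move=> r; case E: (loc G v) => [s|].
  by have pv := relab_fix r (_ : seg G v); rewrite -{1}pv ?(relab_loc v r) /seg E.
rewrite -[v](permKV p) (relab_loc _ r).
case E': (loc G _) => [s|] //; have := relab_fix r (_ : seg G ((p^-1)%g v)).
by rewrite /seg E' permKV => /(_ isT) Ev; move: E'; rewrite -Ev E.
Qed.

Lemma relab_segE G H p t v : relabeling G H p t -> seg H v = seg G v.
Proof. by move=> r; rewrite /seg (relab_locE v r). Qed.

Lemma relab_inv G H p t : relabeling G H p t -> relabeling H G p^-1 t^-1.
Proof.
move=> r; apply/and3P; split; apply/forallP => v.
- by rewrite -[in X in _ == X](permKV p v) (relab_loc _ r).
- apply/implyP; rewrite (relab_segE v r) => sv.
  by rewrite -{1}(relab_fix r sv) permK.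
rewrite -[in X in _ == X](permKV t v) (relab_ends _ r) -imset_comp.
by rewrite (eq_imset (g := id)) ?imset_id // => x /=; rewrite permK.
Qed.

Lemma relab_comp G H K p t q s :
  relabeling G H p t -> relabeling H K q s -> relabeling G K (p * q) (t * s).
Proof.
move=> r r'; apply/and3P; split; apply/forallP => v.
- by rewrite permM (relab_loc _ r') (relab_loc _ r).
- apply/implyP => sv; rewrite permM (relab_fix r sv).
  by rewrite (relab_fix r') // (relab_segE _ r).
rewrite permM (relab_ends _ r') (relab_ends _ r) -imset_comp.
by apply/eqP/eq_imset => x /=; rewrite permM.
Qed.

Lemma mem_ends G i : src G i \in ends G i /\ tgt G i \in ends G i.
Proof. by rewrite !inE !eqxx orbT. Qed.

Lemma eq_src_tgt G i : (src G i == tgt G i) = (#|ends G i| == 1)%N.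
Proof. by rewrite cards2; case: eqP. Qed.

Lemma relab_src_tgt G H p t i : relabeling G H p t ->
  (src H (t i) == tgt H (t i)) = (src G i == tgt G i).
Proof. by move=> r; rewrite !eq_src_tgt (relab_ends _ r) card_imset //; apply: perm_inj. Qed.

Lemma relab_srcV G H p t i : relabeling G H p t ->
  src H (t i) = p (src G i) /\ tgt H (t i) = p (tgt G i) \/
  src H (t i) = p (tgt G i) /\ tgt H (t i) = p (src G i).
Proof.
move=> r; have := relab_ends i r; have := relab_src_tgt i r.
rewrite /ends imsetU1 imset_set1.
set x := src H _; set y := tgt H _; set a := src G i; set b := tgt G i.
move=> exy E.
have : x \in [set p a; p b] by rewrite -E !inE eqxx.
have : y \in [set p a; p b] by rewrite -E !inE eqxx orbT.
have : p a \in [set x; y] by rewrite E !inE eqxx.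
have : p b \in [set x; y] by rewrite E !inE eqxx orbT.
rewrite !inE => /orP[]/eqP h1 /orP[]/eqP h2 /orP[]/eqP h3 /orP[]/eqP h4;
  rewrite ?h1 ?h2 ?h3 ?h4; by [left; split; congruence|right; split; congruence].
Qed.

Lemma kindE G : 
  [forall i, [|| is_chord G i, is_mixed G i, is_free_edge G i | is_loop G i]] =
  [forall i, (#|ends G i| == 1)%N ==> [forall v in ends G i, seg G v]].
Proof.
apply: eq_forallb => i; rewrite -eq_src_tgt /is_chord /is_mixed /is_free_edge.
rewrite /is_loop; have [st|st] /= := eqVneq (src G i) (tgt G i).
  rewrite st; apply/idP/forall_inP => [|/(_ (tgt G i))]; last first.
    by rewrite !inE eqxx orbT => ->; rewrite ?orbT.
  by case sg: seg => //= _ v; rewrite !inE st orbb => /eqP ->.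
by case: (seg G (src G i)); case: seg.
Qed.

Lemma relab_link G H p t :
  relabeling G H p t -> link_diagram G -> link_diagram H.
Proof.
move=> r /and4P[wG]; rewrite /link_diagram !kindE => kG cG vG.
apply/and4P; split.
- apply/forallP => v; apply/forallP => w.
  by rewrite !(relab_locE _ r); have /forallP/(_ v)/forallP := wG.
- apply/forallP => i; rewrite -[i](permKV t) (relab_ends _ r).
  rewrite card_imset; last exact: perm_inj.
  apply/implyP => c1; have /forallP/(_ (t^-1 i)%g)/implyP/(_ c1)/forall_inP h := kG.
  apply/forall_inP => _ /imsetP[v /h sv ->].
  by rewrite (relab_fix r) // (relab_segE _ r).
- move/asboolP: cG => cG; apply/asboolP => v.
  rewrite (relab_segE v r) => nv.
  have nv' : ~~ seg G ((p^-1)%g v).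
    by rewrite -(relab_seg _ r) permKV (relab_segE _ r).
  have [w [i [q [sw /and3P[h1 h2 h3]]]]] := cG _ nv'.
  exists (p w), (t i), (map t q); split; first by rewrite (relab_seg _ r).
  apply/and3P; split.
  + rewrite path_map; apply: sub_path h1 => x y; rewrite /touch /relpre /=.
    rewrite !(relab_ends _ r) -imsetI; last by move=> a b _ _; apply: perm_inj.
    by rewrite imset_eq0.
  + rewrite (relab_ends _ r) -{1}[v](permKV p) mem_imset //; exact: perm_inj.
  + by rewrite last_map (relab_ends _ r) mem_imset //; exact: perm_inj.
apply/forallP => v; have /forallP/(_ ((p^-1)%g v)) := vG.
rewrite -[X in (_ <= valence H X)%N](permKV p); move: ((p^-1)%g v) => {}v.
rewrite /valence (relab_seg _ r); congr (_ <= _ + _)%N.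
  rewrite -[RHS](card_imset _ (@perm_inj _ (t^-1)%g)); apply/eq_card => i.
  rewrite inE; apply/idP/imsetP => [h|[j hj ->]].
    exists (t i); rewrite ?permK // inE (relab_ends _ r).
    rewrite mem_imset; last exact: perm_inj.
    by rewrite -imset_set1 (inj_eq (imset_inj (@perm_inj _ p))).
  move: hj; rewrite inE -{1 2}[j](permKV t) (relab_ends _ r).
  rewrite mem_imset; last exact: perm_inj.
  by rewrite -imset_set1 (inj_eq (imset_inj (@perm_inj _ p))).
case: seg => //; congr (2 * _ + 2)%N.
rewrite -[RHS](card_imset _ (@perm_inj _ (t^-1)%g)); apply/eq_card => i.
rewrite inE; apply/idP/imsetP => [h|[j hj ->]].
  exists (t i); rewrite ?permK // inE (relab_ends _ r).
  by rewrite -imset_set1 (inj_eq (imset_inj (@perm_inj _ p))).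
move: hj; rewrite inE -{1}[j](permKV t) (relab_ends _ r).
by rewrite -imset_set1 (inj_eq (imset_inj (@perm_inj _ p))).
Qed.

Lemma relab_nseg G H p t : relabeling G H p t -> nseg H = nseg G.
Proof. by move=> r; apply: eq_card => v; rewrite !inE (relab_segE _ r). Qed.

Lemma relab_nfree G H p t : relabeling G H p t -> nfree H = nfree G.
Proof. by move=> r; apply: eq_card => v; rewrite !inE (relab_segE _ r). Qed.

Lemma relab_in_LD d k G H p t :
  relabeling G H p t -> in_LD d k H = in_LD d k G.
Proof.
move=> r; rewrite /in_LD /defect /diag_order (relab_nseg r) (relab_nfree r).
by congr andb; apply/idP/idP; [apply: relab_link (relab_inv r)|apply: relab_link r].
Qed.

Lemma relab_multi G H p t :
  relabeling G H p t -> multi_edge G -> multi_edge H.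
Proof.
move=> r /existsP[i /existsP[j /and3P[h1 h2 h3]]].
apply/existsP; exists (t i); apply/existsP; exists (t j).
by rewrite (inj_eq perm_inj) h1 (relab_src_tgt _ r) h2 !(relab_ends _ r) (eqP h3) /=.
Qed.

Lemma relab_multiE G H p t :
  relabeling G H p t -> multi_edge H = multi_edge G.
Proof.
by move=> r; apply/idP/idP; [apply: relab_multi (relab_inv r)|apply: relab_multi r].
Qed.

Lemma relab_Aut G H p t : relabeling G H p t -> #|Aut_diag H| = #|Aut_diag G|.
Proof.
move=> r; have r' := relab_inv r.
pose f (q : 'S_N * 'S_e) := ((p^-1 * (q.1 * p))%g, (t^-1 * (q.2 * t))%g).
have fI : injective f.
  by case=> a b [a' b'] [/mulgI/mulIg -> /mulgI/mulIg ->].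
rewrite -[RHS](card_imset _ fI); apply: eq_card => -[a b]; rewrite inE /=.
apply/idP/imsetP => [h|[[a' b'] hab [-> ->]]].
  exists ((p * (a * p^-1))%g, (t * (b * t^-1))%g).
    by rewrite inE /=; apply: relab_comp r (relab_comp h r').
  by rewrite /f /= !mulgA !mulVg !mul1g !mulgKV.
by move: hab; rewrite inE /= => h; apply: relab_comp r' (relab_comp h r).
Qed.

End Relabeling.

Section Pairing.
Variables (R : realType) (m n : nat).
Implicit Types d k N e : nat.

Lemma cls_relab d k N e (G H : graph m N e) p t : relabeling G H p t ->
  cls R n d k G = (-1) ^+ rel_sign n G H p t *: cls R n d k H.
Proof.
move=> r; have [hG|hG] := boolP (in_LD d k G).
  by apply: cls_relab_in; rewrite ?(relab_in_LD _ _ r).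
by rewrite !cls_notin ?scaler0 ?(relab_in_LD _ _ r).
Qed.

Lemma kronecker0r d k (x : LD R m n d k) : kronecker x 0 = 0.
Proof. by rewrite /kronecker oppr0; case: eqP. Qed.

Lemma kronecker0l d k (x : LD R m n d k) : kronecker 0 x = 0.
Proof. by rewrite /kronecker eqxx. Qed.

Lemma eqr_opp0 (V : lmodType R) (x : V) : (x == - x) = (x == 0).
Proof.
rewrite -subr_eq0 opprK -mulr2n -scaler_nat scaler_eq0.
by rewrite pnatr_eq0.
Qed.

Lemma kroneckerNr d k (x y : LD R m n d k) : kronecker x (- y) = - kronecker x y.
Proof.
rewrite /kronecker opprK; have [|x0] := eqVneq x 0; first by rewrite oppr0.
have [xNy|_] := eqVneq x (- y); last by case: eqP; rewrite ?oppr0.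
by rewrite {1}xNy eq_sym eqr_opp0 -oppr_eq0 -xNy (negPf x0) opprK.
Qed.

Lemma kroneckerC d k (x y : LD R m n d k) : kronecker x y = kronecker y x.
Proof.
have [->|x0] := eqVneq x 0; first by rewrite kronecker0l kronecker0r.
have [->|y0] := eqVneq y 0; first by rewrite kronecker0l kronecker0r.
by rewrite /kronecker (negPf x0) (negPf y0) (eq_sym y) (eq_sym y) eqr_oppLR.
Qed.

Lemma kronecker_signr d k (x y : LD R m n d k) s :
  kronecker x ((-1) ^+ s *: y) = (-1) ^+ s * kronecker x y.
Proof.
rewrite -signr_odd; case: odd; rewrite ?expr1 ?expr0 ?scaleN1r ?mulN1r.
  exact: kroneckerNr.
by rewrite scale1r mul1r.
Qed.

Lemma pairing_cls d k N e (G : graph m N e) N' e' (H : graph m N' e') :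
  in_LD d k G -> in_LD d k H ->
  pairing (cls R n d k G) (cls R n d k H) =
  kronecker (cls R n d k G) (cls R n d k H) * #|Aut_diag G|%:R.
Proof.
move=> hG hH; pose K (x y : LD R m n d k) a : R^o := kronecker x y * a%:R.
have inner N1 e1 (G1 : graph m N1 e1) :
    lin_ext (fun h : gens m d k =>
        K (cls R n d k G1) (cls R n d k (gen_graph h)) #|Aut_diag G1|)
      (cls R n d k H)
    = K (cls R n d k G1) (cls R n d k H) #|Aut_diag G1|.
  rewrite (lin_extE (F := fun _ _ H1 =>
    K (cls R n d k G1) (cls R n d k H1) #|Aut_diag G1|)) //.
    by move=> N2 e2 H2 _ mH; rewrite /K (cls_multi R n d k mH) kronecker0r mul0r.
  move=> N2 e2 H1 H2 p t _ _ r.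
  by rewrite /K (cls_relab d k r) kronecker_signr -mulrA.
rewrite -[RHS]/(K (cls R n d k G) (cls R n d k H) #|Aut_diag G|).
rewrite -(lin_extE (d := d) (k := k) (R := R) (n := n) (F := fun _ _ G1 =>
  K (cls R n d k G1) (cls R n d k H) #|Aut_diag G1|)) //; last first.
- move=> N2 e2 G1 G2 p t _ _ r; rewrite /K (relab_Aut r).
  by rewrite (cls_relab d k r) kroneckerC kronecker_signr kroneckerC -mulrA.
- by move=> N2 e2 G2 _ mG; rewrite /K (cls_multi R n d k mG) kronecker0l mul0r.
apply: eq_bigr => g _; rewrite -inner /lin_ext scaler_sumr.
by apply: eq_bigr => h _; rewrite -mulrA.
Qed.

End Pairing.

Lemma merge_id N (w : 'I_N) v : merge_vertex w v w = v.
Proof. by rewrite /merge_vertex unlift_none. Qed.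

Lemma merge_lift N (w : 'I_N) v y : merge_vertex w v (lift w y) = y.
Proof. by rewrite /merge_vertex liftK. Qed.

Lemma lift_below N (w : 'I_N) (v : 'I_N.-1) :
  (v < w)%N -> lift w v = v :> nat.
Proof. by move=> h; rewrite /= /bump leqNgt h. Qed.

Lemma lift_lt N (w : 'I_N) (v : 'I_N.-1) : (lift w v < w)%N = (v < w)%N.
Proof. by rewrite /= /bump; case: leqP; lia. Qed.

Lemma lift_permE N (q : 'S_N) (w w' : 'I_N) : q w = w' ->
  exists s : 'S_N.-1, (forall y, q (lift w y) = lift w' (s y)) /\
    odd_perm q = odd w (+) odd w' (+) odd_perm s.
Proof.
case: N q w w' => [|N] q w w' qw; first by case: w {qw}.
pose f y := odflt y (unlift w' (q (lift w y))).
have fE y : lift w' (f y) = q (lift w y).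
  rewrite /f; case: unliftP => [z ->|] //= E.
  by have /eqP := neq_lift w y; case; apply: (@perm_inj _ q); rewrite qw E.
have f_inj : injective f.
  by move=> y z /(congr1 (lift w')); rewrite !fE => /perm_inj/lift_inj.
exists (perm f_inj); split=> [y|]; first by rewrite permE fE.
rewrite -odd_lift_perm; congr odd_perm; apply/permP => x.
case: (unliftP w x) => [y|] ->; last by rewrite lift_perm_id.
by rewrite lift_perm_lift permE fE.
Qed.

Lemma card_lift e (i : 'I_e) (P : pred 'I_e) :
  #|[set j | P j]| = (P i + #|[set j | P (lift i j)]|)%N.
Proof.
rewrite (cardsD1 i) inE; congr (_ + _)%N.
rewrite -[RHS](card_imset _ (@lift_inj _ i)); apply: eq_card => x.
rewrite !inE; case: (unliftP i x) => [y|] ->.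
  by rewrite mem_imset ?inE 1?eq_sym ?neq_lift //; apply: lift_inj.
rewrite eqxx /=; apply/esym/imsetP => -[y _ /eqP].
by rewrite (negPf (neq_lift _ _)).
Qed.

Section Contraction.
Variables (m N e : nat).
Implicit Types (G H : graph m N e) (p q : 'S_N) (t : 'S_e).

Lemma ends_contract G w v i :
  ends (contract G w v) i = merge_vertex w v @: ends G i.
Proof. by rewrite /ends /src /tgt ffunE /= imsetU1 imset_set1. Qed.

Lemma ends_del_edge G i j : ends (del_edge G i) j = ends G (lift i j).
Proof. by rewrite /ends /src /tgt ffunE. Qed.

Lemma merge_perm p q w v w' v' (s : 'S_N.-1) :
  q w = w' -> q (lift w v) = lift w' v' ->
  (forall y, q (lift w y) = lift w' (s y)) ->
  (forall x, x != w -> x != lift w v -> p x = q x) ->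
  (p w = q w /\ p (lift w v) = q (lift w v) \/
   p w = q (lift w v) /\ p (lift w v) = q w) ->
  forall x, merge_vertex w' v' (p x) = s (merge_vertex w v x).
Proof.
move=> qw qv qs pq pwv x.
have sv : s v = v' by apply: (@lift_inj _ w'); rewrite -qs.
have [->|xw] := eqVneq x w.
  rewrite merge_id sv.
  by case: pwv => -[-> _]; rewrite ?qw ?qv ?merge_id ?merge_lift.
have [->|xv] := eqVneq x (lift w v).
  rewrite merge_lift sv.
  by case: pwv => -[_ ->]; rewrite ?qw ?qv ?merge_id ?merge_lift.
rewrite pq //; case: (unliftP w x) xw => [y ->|->] //; rewrite ?eqxx // => _.
by rewrite qs !merge_lift.
Qed.

Lemma relab_contract G H p t w v w' v' (s : 'S_N.-1) :
  relabeling G H p t ->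
  (forall x, merge_vertex w' v' (p x) = s (merge_vertex w v x)) ->
  (forall y, loc H (lift w' (s y)) = loc G (lift w y)) ->
  (forall y, seg G (lift w y) -> s y = y) ->
  relabeling (contract G w v) (contract H w' v') s t.
Proof.
move=> r sm sl sf; apply/and3P; split; apply/forallP => y.
- by rewrite /loc !ffunE sl.
- by apply/implyP; rewrite /seg /loc ffunE => /sf ->.
rewrite !ends_contract (relab_ends _ r) -!imset_comp; apply/eqP.
by apply: eq_imset => x /=; rewrite sm.
Qed.

Lemma same_or_contract G H p t w v w' v' (s : 'S_N.-1) i :
  relabeling G H p t ->
  (forall x, merge_vertex w' v' (p x) = s (merge_vertex w v x)) ->
  (src G i != tgt G i -> merge_vertex w v (src G i) = merge_vertex w v (tgt G i) ->
   p (src G i) = src G i /\ p (tgt G i) = tgt G i) ->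
  same_orientation (contract G w v) (contract H w' v') s t i =
  same_orientation G H p t i.
Proof.
move=> r sm fx; have eqH := relab_src_tgt i r; have srcH := relab_srcV i r.
rewrite /same_orientation.
have srcE : src (contract G w v) i = merge_vertex w v (src G i) by rewrite /src ffunE.
have tgtE : tgt (contract G w v) i = merge_vertex w v (tgt G i) by rewrite /tgt ffunE.
have srcE' : src (contract H w' v') (t i) = merge_vertex w' v' (src H (t i)).
  by rewrite /src ffunE.
have orE : loop_or (contract G w v) i =
   (if src G i == tgt G i then loop_or G i else (tgt G i < src G i)%N).
  by rewrite /loop_or ffunE.
have orE' : loop_or (contract H w' v') (t i) =
   (if src G i == tgt G i then loop_or H (t i)
    else (tgt H (t i) < src H (t i))%N).
  by rewrite -eqH /loop_or ffunE.
rewrite srcE tgtE srcE' orE orE' -sm.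
have [st|st] := eqVneq (src G i) (tgt G i); first by rewrite st eqxx.
have [mm|mm] := eqVneq (merge_vertex w v (src G i)) (merge_vertex w v (tgt G i)).
  have [fs ft] := fx st mm; rewrite fs ft in srcH *.
  have nn : (src G i != tgt G i :> nat) by [].
  by case: srcH => -[-> ->]; rewrite ?eqxx //; case: ltngtP nn => //=;
     rewrite (eq_sym (tgt G i)) (negPf st).
case: srcH => -[-> _]; first by rewrite !eqxx.
rewrite (inj_eq perm_inj) [RHS]eq_sym (negPf st) !sm (inj_eq perm_inj) eq_sym.
exact: negPf.
Qed.

Lemma relab_del_edge G H p t i (t' : 'S_e.-1) :
  relabeling G H p t -> (forall j, t (lift i j) = lift (t i) (t' j)) ->
  relabeling (del_edge G i) (del_edge H (t i)) p t'.
Proof.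
move=> r tE; have [h1 h2 _] := and3P r; apply/and3P; split => //.
by apply/forallP => j; rewrite !ends_del_edge -tE (relab_ends _ r).
Qed.

Lemma same_or_del_edge G H p t i (t' : 'S_e.-1) j :
  (forall j, t (lift i j) = lift (t i) (t' j)) ->
  same_orientation (del_edge G i) (del_edge H (t i)) p t' j =
  same_orientation G H p t (lift i j).
Proof.
by move=> tE; rewrite /same_orientation /src /tgt /loop_or !ffunE -tE.
Qed.

End Contraction.

Section Differential.
Variables (R : realType) (m n : nat).
Implicit Types d k N e : nat.

Lemma free_below N e (G : graph m N e) v w :
  link_diagram G -> ~~ seg G v -> seg G w -> (w < v)%N.
Proof.
case/and4P => /forallP/(_ v)/forallP/(_ w)/implyP h _ _ _.
rewrite /seg negbK => /eqP Ev; case Ew: (loc G w) => [s|] // _.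
have /negP : ~~ (v < w)%N by apply/negP => /h; rewrite Ev Ew.
have : v != w by apply/eqP => E; rewrite -E Ev in Ew.
by rewrite -val_eqE /=; lia.
Qed.

Lemma eq_sign (a b : nat) : odd a = odd b -> (-1) ^+ a = (-1) ^+ b :> R.
Proof. by move=> ab; rewrite -signr_odd ab signr_odd. Qed.

Lemma eps_edge_odd N e (G : graph m N e) i (w : 'I_N) (v : 'I_N.-1) :
  odd n -> (v < w)%N -> ends G i = [set lift w v; w] ->
  eps_edge R n G i = (-1) ^+ (w.+1 + (src G i == w)).
Proof.
move=> on vw Ei; rewrite /eps_edge on.
have lw : (lift w v < w)%N by rewrite lift_lt.
have nw : lift w v != w by rewrite eq_sym neq_lift.
have [sE tE] := mem_ends G i; rewrite Ei in sE tE.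
have /eqP := congr1 (fun A : {set _} => #|A|) Ei.
rewrite !cards2 nw eqSS; move: sE tE; rewrite !inE.
move=> /orP[]/eqP -> /orP[]/eqP ->; rewrite ?eqxx //= ?(negPf nw) ?lw ?addn0 //.
by rewrite ltnNge ltnW //= addn1 [in RHS]exprS mulN1r.
Qed.

Lemma edge_term d k N e (G H : graph m N e) p t i (w : 'I_N) (v : 'I_N.-1) :
  relabeling G H p t -> link_diagram G -> ~~ multi_edge G ->
  is_free_edge G i || is_mixed G i ->
  (v < w)%N -> ends G i = [set lift w v; w] ->
  exists (w' : 'I_N) (v' : 'I_N.-1), [/\ (v' < w')%N, ends H (t i) = [set lift w' v'; w'] &
    eps_edge R n G i *: cls R n d k (contract (del_edge G i) w v) =
    (-1) ^+ rel_sign n G H p t *: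
     (eps_edge R n H (t i) *: cls R n d k (contract (del_edge H (t i)) w' v'))].
Proof.
move=> r lG mG ki vw Ei; have lH := relab_link r lG.
have lvw : (lift w v < w)%N by rewrite lift_lt.
have nvw : lift w v != w by rewrite eq_sym neq_lift.
have wfree : ~~ seg G w.
  apply/negP => sw; have sv : seg G (lift w v).
    by apply: contraT => nv; have := free_below lG nv sw; rewrite ltnNge ltnW.
  have [h1 h2] := mem_ends G i; rewrite Ei in h1 h2.
  have ss : seg G (src G i) by move: h1; rewrite !inE => /orP[]/eqP ->.
  have st : seg G (tgt G i) by move: h2; rewrite !inE => /orP[]/eqP ->.
  by move: ki; rewrite /is_free_edge /is_mixed ss st /= andbF.
pose q := if (p (lift w v) < p w)%N then p else (tperm (lift w v) w * p)%g.
have npvw : p (lift w v) != p w by rewrite (inj_eq perm_inj).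
have qlt : (q (lift w v) < q w)%N.
  rewrite /q; case: ifP => // /negbT; rewrite -leqNgt !permM tpermL tpermR.
  by rewrite leq_eqVlt eq_sym val_eqE (negPf npvw).
have qE x : x != w -> x != lift w v -> p x = q x.
  by move=> h1 h2; rewrite /q; case: ifP => // _; rewrite permM tpermD // eq_sym.
have qvw : p w = q w /\ p (lift w v) = q (lift w v) \/
   p w = q (lift w v) /\ p (lift w v) = q w.
  by rewrite /q; case: ifP => _; [left|right; rewrite !permM tpermL tpermR].
have pwf : ~~ seg H (p w) by rewrite (relab_seg _ r).
have vfree : ~~ (p (lift w v) < p w)%N -> ~~ seg G (lift w v).
  move=> h; apply/negP => sv; have pv := relab_fix r sv.
  have := free_below lH pwf; move/(_ (p (lift w v))).
  by rewrite (relab_seg _ r) sv (negPf h) => /(_ isT).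
have qloc x : loc H (q x) = loc G x.
  rewrite /q; case: ifPn => [_|/vfree vf]; first exact: relab_loc r.
  rewrite permM (relab_loc _ r); case: tpermP => // ->;
    by move: vf wfree; rewrite /seg !negbK => /eqP -> /eqP ->.
have qfix x : seg G x -> q x = x.
  rewrite /q; case: ifPn => [_|/vfree vf]; first exact: relab_fix r.
  move=> sx; rewrite permM tpermD ?(relab_fix r sx) //.
    by apply: contra vf => /eqP ->.
  by apply: contra wfree => /eqP ->.
have [s [sE os]] := lift_permE (erefl (q w)).
have [t' [tE ot]] := lift_permE (erefl (t i)).
have [v' v'E] : exists v', q (lift w v) = lift (q w) v'.
  case: (unliftP (q w) (q (lift w v))) qlt => [v' ->|->].
    by move=> _; exists v'.
  by rewrite ltnn.
exists (q w), v'.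
have vw' : (v' < q w)%N by rewrite -(lift_lt (q w)) -v'E.
have Ei' : ends H (t i) = [set lift (q w) v'; q w].
  rewrite (relab_ends _ r) Ei imsetU1 imset_set1 -v'E.
  by case: qvw => -[-> ->] //; rewrite setUC.
split=> //.
have sm := merge_perm (erefl (q w)) v'E sE qE qvw.
have rd := relab_del_edge r tE.
have rc : relabeling (contract (del_edge G i) w v)
                     (contract (del_edge H (t i)) (q w) v') s t'.
  apply: relab_contract rd sm _ _ => y.
    by rewrite -sE -[RHS]qloc.
  move=> sy; have {}sy : seg G (lift w y) by [].
  have E := sE y; rewrite (qfix _ sy) in E.
  have l1 : (lift w y < w)%N := free_below lG wfree sy.
  have l2 : (lift (q w) (s y) < q w)%N.
    rewrite -E; apply: (free_below lH); last by rewrite (relab_segE _ r).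
    by rewrite /seg qloc.
  rewrite !lift_lt in l1 l2.
  by apply: ord_inj; rewrite -(lift_below l2) -E; apply: lift_below.
rewrite (cls_relab R n d k rc) !scalerA; congr (_ *: _).
rewrite /rel_sign; case: ifP => on; last first.
  rewrite /eps_edge on -!exprD (relab_nfree r); apply: eq_sign.
  rewrite !oddD !oddb ot /=; case: (odd i); case: (odd (t i));
    by case: (odd (nfree G)); case: (odd_perm t').
rewrite (eps_edge_odd on vw Ei) (eps_edge_odd on vw' Ei') -!exprD.
apply: eq_sign; rewrite (card_lift i).
have -> : [set j | ~~ same_orientation (contract (del_edge G i) w v)
     (contract (del_edge H (t i)) (q w) v') s t' j] =
   [set j | ~~ same_orientation G H p t (lift i j)].
  apply/setP => j; rewrite !inE (same_or_contract rd sm); last first.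
    move=> st mm; case/negP: mG; apply/existsP; exists i; apply/existsP.
    exists (lift i j); rewrite neq_lift /=.
    rewrite /src /tgt !ffunE -/(src G (lift i j)) -/(tgt G (lift i j)) in st mm.
    have mergeP x y : x != y -> merge_vertex w v x = merge_vertex w v y ->
        [set x; y] = [set lift w v; w].
      case: (unliftP w x) => [x' ->|->]; case: (unliftP w y) => [y' ->|->];
        rewrite ?merge_id ?merge_lift ?eqxx // => + E; rewrite -?E ?eqxx //.
      by rewrite setUC.
    rewrite Ei -(mergeP _ _ st mm) eqxx andbT.
    by rewrite eq_src_tgt Ei cards2 nvw.
  by rewrite (same_or_del_edge _ _ _ _ tE).
rewrite !oddD !oddb /=; set D := odd #|_|.
have op : odd_perm p = (p w != q w) (+) odd_perm q.
  rewrite /q; case: ifP => _; first by rewrite eqxx.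
  rewrite permM tpermR (eq_sym (p w)) npvw odd_permM odd_tperm nvw /=.
  by case: (odd_perm p).
rewrite op os.
have so : same_orientation G H p t i = (src H (t i) == p (src G i)).
  by rewrite /same_orientation eq_src_tgt Ei cards2 nvw.
have [h1 _] := mem_ends G i; rewrite Ei !inE in h1.
have [h2 _] := mem_ends H (t i); rewrite (relab_ends _ r) Ei imsetU1 imset_set1 !inE in h2.
have X : (p w != q w) (+) (src G i == w) (+) (src H (t i) == q w)
         (+) ~~ same_orientation G H p t i = false.
  have pww : (p w == p (lift w v)) = false by rewrite eq_sym (negPf npvw).
  have nwv : (w == lift w v) = false by rewrite eq_sym (negPf nvw).
  rewrite so; case: qvw => -[E1 E2].
    rewrite -E1; case/orP: h1 => /eqP ->; case/orP: h2 => /eqP ->;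
      by rewrite ?eqxx ?(negPf nvw) ?(negPf npvw) ?pww ?nwv ?eqxx.
  rewrite -E2; case/orP: h1 => /eqP ->; case/orP: h2 => /eqP ->;
    by rewrite ?eqxx ?(negPf nvw) ?(negPf npvw) ?pww ?nwv ?eqxx.
move: X; case: (p w != q w); case: (src G i == w); case: (src H (t i) == q w);
  by case: same_orientation => //= _; case: (odd w); case: (odd (q w));
     case: (odd_perm s); case: D.
Qed.


Lemma merge_eq N (w : 'I_N) v x y : x != y ->
  merge_vertex w v x = merge_vertex w v y -> [set x; y] = [set lift w v; w].
Proof.
case: (unliftP w x) => [x' ->|->]; case: (unliftP w y) => [y' ->|->];
  rewrite ?merge_id ?merge_lift ?eqxx // => + E; rewrite -?E ?eqxx //.
by rewrite setUC.
Qed.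

Lemma arc_term d k N e (G H : graph m N e) p t (w : 'I_N) (v : 'I_N.-1) :
  relabeling G H p t -> is_arc G (lift w v) w ->
  eps_arc R w *: cls R n d k (contract G w v) =
  (-1) ^+ rel_sign n G H p t *:
    (eps_arc R w *: cls R n d k (contract H w v)).
Proof.
move=> r /and3P[sv /eqP Evw _].
have sw : seg G w by rewrite /seg -Evw.
have pv := relab_fix r sv; have pw := relab_fix r sw.
have [s [sE os]] := lift_permE pw.
have sm : forall x, merge_vertex w v (p x) = s (merge_vertex w v x).
  by apply: (merge_perm pw pv sE) => //; left.
have rc : relabeling (contract G w v) (contract H w v) s t.
  apply: (relab_contract r sm) => y; first by rewrite -sE (relab_loc _ r).
  by move=> sy; apply: (@lift_inj _ w); rewrite -sE (relab_fix r).
rewrite (cls_relab R n d k rc) !scalerA mulrC; congr (_ * _ *: _).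
apply: eq_sign; rewrite /rel_sign; case: ifP => // _.
rewrite !oddD !oddb os addbb /=; congr (_ (+) odd #|pred_of_set _|).
apply/setP => i; rewrite !inE (same_or_contract r sm) // => st mm.
have E := merge_eq st mm.
have h1 : src G i \in [set lift w v; w] by rewrite -E !inE eqxx.
have h2 : tgt G i \in [set lift w v; w] by rewrite -E !inE eqxx orbT.
move: h1 h2; rewrite !inE.
by move=> /orP[]/eqP -> /orP[]/eqP ->; rewrite ?pv ?pw.
Qed.

Lemma ends_ordered N e (G : graph m N e) i : src G i != tgt G i ->
  exists (w : 'I_N) (v : 'I_N.-1), (v < w)%N /\ ends G i = [set lift w v; w].
Proof.
have H (x y : 'I_N) : (x < y)%N -> exists (w : 'I_N) (v : 'I_N.-1),
    (v < w)%N /\ [set x; y] = [set lift w v; w].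
  case: (unliftP y x) => [v ->|->]; last by rewrite ltnn.
  by rewrite lift_lt => vy; exists y, v.
rewrite -val_eqE /= neq_ltn => /orP[]/H // [w [v [vw E]]].
by exists w, v; rewrite /ends setUC.
Qed.

Lemma edge_sum N e (G : graph m N e) i (V : lmodType R)
    (F : 'I_N -> 'I_N.-1 -> V) (w : 'I_N) (v : 'I_N.-1) :
  (v < w)%N -> ends G i = [set lift w v; w] ->
  \sum_(w1 : 'I_N) \sum_(v1 : 'I_N.-1 | (v1 < w1)%N &&
       (ends G i == [set lift w1 v1; w1])) F w1 v1 = F w v.
Proof.
move=> vw E; have uniq (w1 : 'I_N) (v1 : 'I_N.-1) : (v1 < w1)%N ->
    [set lift w v; w] = [set lift w1 v1; w1] -> w1 = w /\ v1 = v.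
  move=> vw1 E1; have ww : w1 = w.
    have : w1 \in [set lift w v; w] by rewrite E1 !inE eqxx orbT.
    rewrite !inE => /orP[]/eqP // E2.
    have : w \in [set lift w1 v1; w1] by rewrite -E1 !inE eqxx orbT.
    rewrite !inE => /orP[]/eqP E3; last by rewrite -E3.
    have h1 : (w < w1)%N by rewrite {1}E3 lift_lt.
    have h2 : (w1 < w)%N by rewrite {1}E2 lift_lt.
    by move: (ltn_trans h1 h2); rewrite ltnn.
  split=> //; subst w1; apply: (@lift_inj _ w).
  have : lift w v1 \in [set lift w v; w] by rewrite E1 !inE eqxx.
  rewrite !inE => /orP[]/eqP // E2.
  by have := neq_lift w v1; rewrite E2 eqxx.
rewrite (bigD1 w) //= [X in _ + X]big1 ?addr0 => [|w1 nw]; last first.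
  apply: big1 => v1 /andP[vw1 /eqP]; rewrite E => /(uniq _ _ vw1)[E1 _].
  by rewrite E1 eqxx in nw.
rewrite (bigD1 v) ?E ?vw ?eqxx //= big1 ?addr0 // => v1 /andP[/andP[vw1 /eqP]].
by move=> /(uniq _ _ vw1)[_ ->]; rewrite eqxx.
Qed.

Lemma kind_src_tgt N e (G : graph m N e) i :
  is_free_edge G i || is_mixed G i -> src G i != tgt G i.
Proof.
case/orP => [/and3P[]//|]; rewrite /is_mixed.
by apply: contraL => /eqP ->; rewrite addbb.
Qed.

Lemma relab_kind N e (G H : graph m N e) p t i : relabeling G H p t ->
  is_free_edge H (t i) || is_mixed H (t i) = is_free_edge G i || is_mixed G i.
Proof.
move=> r; rewrite /is_free_edge /is_mixed (relab_src_tgt _ r).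
case: (relab_srcV i r) => -[-> ->]; rewrite !(relab_seg _ r) //.
by rewrite addbC; congr (_ || _); congr (_ && _); rewrite andbC.
Qed.

Lemma delta_relab d k N e (G H : graph m N e) p t :
  in_LD d k G -> relabeling G H p t ->
  delta_diag R n d k G = (-1) ^+ rel_sign n G H p t *: delta_diag R n d k H.
Proof.
move=> /and3P[lG _ _] r; rewrite /delta_diag (relab_multiE r).
have [_|mG] := boolP (multi_edge G).
  exact: esym (scaler0 _ _).
rewrite scalerDr.
congr (_ + _); last first.
  rewrite scaler_sumr; apply: eq_bigr => w _; rewrite scaler_sumr.
  apply: eq_big => [v|v /andP[_ av]]; last exact: arc_term r av.
  by rewrite /is_arc (relab_segE _ r) !(relab_locE _ r).
rewrite scaler_sumr [RHS](reindex_inj (@perm_inj _ t)) /=.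
apply: eq_big => [i|i ki]; first by rewrite (relab_kind i r).
have [w [v [vw Ei]]] := ends_ordered (kind_src_tgt ki).
have [w' [v' [vw' Ei' E]]] := edge_term d.+1 k r lG mG ki vw Ei.
by rewrite (edge_sum _ vw Ei) (edge_sum _ vw' Ei').
Qed.

Lemma delta_cls d k N e (G : graph m N e) : in_LD d k G ->
  delta R m n d k (cls R n d k G) = delta_diag R n d k G.
Proof.
move=> hG; rewrite lfunE /= lin_extE // => N1 e1 G1.
  by move=> _ mG; rewrite /delta_diag mG.
by move=> H1 p t hG1 _ r; apply: delta_relab r.
Qed.

End Differential.

Section Members.
Variables (R : realType) (m n : nat).
Implicit Types d k N e : nat.

Lemma del_add_edge N e (G : graph m N e) x y :
  del_edge (add_edge G x y) ord_max = G.
Proof.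
by case: G => a b; congr pair; apply/ffunP => j; rewrite !ffunE liftK.
Qed.

Lemma cls_contract_split d k N e (G : graph m N e) i (h : 'I_N.+1) l A :
  cls R n d k (contract (split_vertex G i h l A) h i) = cls R n d k G.
Proof.
pose mv j x := if (j \in A) && (x == i) then h else lift h x.
have mvK j x : merge_vertex h i (mv j x) = x.
  rewrite /mv; case: ifP => [/andP[_ /eqP ->]|_]; last exact: merge_lift.
  exact: merge_id.
set K := contract _ _ _.
have sK j : src K j = src G j by rewrite /src !ffunE /= /src !ffunE /= mvK.
have tK j : tgt K j = tgt G j by rewrite /tgt !ffunE /= /tgt !ffunE /= mvK.
have r : relabeling K G 1 1.
  apply/and3P; split; apply/forallP => v.
  - by rewrite perm1 /loc !ffunE /loc ffunE liftK.
  - by rewrite perm1 eqxx implybT.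
  rewrite perm1 (eq_imset (g := id)) ?imset_id => [|x]; last exact: perm1.
  by rewrite /ends sK tK.
rewrite (cls_relab R n d k r) /rel_sign odd_perm1 add0n.
have -> : [set j | ~~ same_orientation K G 1 1 j] = set0.
  apply/setP => j; rewrite !inE /same_orientation sK tK !perm1.
  apply: negbTE; rewrite negbK; case: ifP => [/eqP st|_] //.
  rewrite /loop_or ffunE /= /src /tgt /loop_or !ffunE /=.
  by rewrite -/(src G j) -/(tgt G j) st eqxx.
by rewrite cards0; case: ifP; rewrite ?odd_perm1 expr0 scale1r.
Qed.

Lemma cls_contract_blow_up d k N e (G : graph m N e) i A :
  cls R n d k (contract (del_edge (blow_up G i A) ord_max) ord_max i)
  = cls R n d k G.
Proof. by rewrite del_add_edge cls_contract_split. Qed.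

Lemma cls_contract_double d k N e (G : graph m N e) i A :
  cls R n d k (contract (double_vertex G i A) (lift ord0 i) i)
  = cls R n d k G.
Proof. exact: cls_contract_split. Qed.

End Members.

(* Main.v *)
Require Import Defs.
From mathcomp Require Import all_boot all_order all_algebra.
From mathcomp Require Import reals.
From mathcomp Require Import all_fingroup boolp zify.

Set Implicit Arguments.
Unset Strict Implicit.
Unset Printing Implicit Defensive.

Import Order.TTheory GRing.Theory Num.Theory.
Local Open Scope ring_scope.

(** The nonzero diagrams, taken up to isomorphism, form a basis up to signs, so
    [alpha] is a cocycle iff every nonzero diagram [G] of defect 1 has
    coefficient zero in [delta alpha].  That coefficient is computed by duality.

    Up to the order of the automorphism group, the coefficient of [G] in an
    element is its pairing with [G], and the pairing of two diagrams is the sum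
    of the signs of all relabelings from one to the other ([pairing_isum]).
    These pairings determine an element ([pairing_eq0]).  So the coefficient of
    [G] in [delta H], for [H] trivalent, is a signed count of the pairs of an
    edge or arc of [H] and a relabeling from [G] onto the contraction.  Such a
    relabeling matches the four-valent vertex [i] of [G] with the merged vertex
    of the contraction, and pulling the contracted edge or arc back along it
    resolves [i]: the pairs are in bijection with the relabelings onto [H] of
    the resolutions of [G] at [i], and the signs of the differential are such
    that the signs agree ([blow_up_sgn], [arc_sgn]).  Hence [delta] is adjoint
    to the signed sum of all resolutions ([adjunction]).

    The vertex [i] is of one of three kinds ([four_valent_cases]).  A free
    vertex has the three resolutions of an IHX triple, a segment vertex with two
    edges the three resolutions of an STU triple, and a segment vertex with a
    loop only the one where the loop becomes a chord between two consecutive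
    vertices.  This gives the first equivalence.

    For homotopy link diagrams, contraction preserves the condition that paths
    between vertices of a segment meet another segment ([contract_edge_HD],
    [contract_arc_HD]), so [delta] preserves the subcomplex, the loops drop out,
    and the same argument shows that a cochain is a cocycle iff it satisfies the
    STU and IHX relations ([HD_STU_IHX]).  The remaining relation follows from
    these two.  Let a trivalent diagram contain a cycle.  If an edge joins the
    cycle to a segment vertex, the diagram is the term S of an STU triple whose
    terms T and U contain two vertices of a segment joined by the rest of the
    cycle; these do not belong to the subcomplex, so the diagram has coefficient
    zero.  Otherwise take the first edge of a path from the cycle to a segment:
    the diagram is a term of an IHX triple, and in the two other terms the new
    edge lies on the cycle, which has come closer to the segments.  Induction on
    the length of the path concludes ([near_cycle_vanish]).  The induction
    uses the adjunction for all diagrams [G], also for those whose class is zero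
    because of an odd automorphism; this is why signs of relabelings, and not
    only classes, are compared throughout. *)

(** * Bilinearity of the pairing *)

Section PairingLinear.
Variables (R : realType) (m n d k : nat).
Implicit Types x y z : LD R m n d k.

Let bilr (I J : finType) (X : I -> R) (Y Z V : J -> R) (c : I -> J -> R) a :
  (forall h, V h = a * Y h + Z h) ->
  \sum_g \sum_h X g * V h * c g h =
  a * (\sum_g \sum_h X g * Y h * c g h) + \sum_g \sum_h X g * Z h * c g h.
Proof.
move=> VE; rewrite mulr_sumr -big_split; apply: eq_bigr => g _ /=.
rewrite mulr_sumr -big_split; apply: eq_bigr => h _ /=.
by rewrite VE mulrDr mulrDl !mulrA (mulrC a).
Qed.

Let bill (I J : finType) (Y Z V : I -> R) (X : J -> R) (c : I -> J -> R) a :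
  (forall g, V g = a * Y g + Z g) ->
  \sum_g \sum_h V g * X h * c g h =
  a * (\sum_g \sum_h Y g * X h * c g h) + \sum_g \sum_h Z g * X h * c g h.
Proof.
move=> VE; rewrite mulr_sumr -big_split; apply: eq_bigr => g _ /=.
rewrite mulr_sumr -big_split; apply: eq_bigr => h _ /=.
by rewrite VE !mulrDl !mulrA.
Qed.

Let vsval_lin a y z (h : gens m d k) :
  (vsval (a *: y + z) h : R) = a * vsval y h + vsval z h.
Proof.
have E : vsval (a *: y + z) = a *: vsval y + vsval z by [].
by rewrite (congr1 (fun u : chains R m d k => u h) E) !ffunE.
Qed.

Let pairing_linr x a y z :
  pairing x (a *: y + z) = a * pairing x y + pairing x z.
Proof. exact: bilr (vsval_lin a y z). Qed.

Let pairing_linl x a y z :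
  pairing (a *: y + z) x = a * pairing y x + pairing z x.
Proof. exact: bill (vsval_lin a y z). Qed.

Lemma pairingDr x y z : pairing x (y + z) = pairing x y + pairing x z.
Proof. by rewrite -[y in LHS]scale1r pairing_linr mul1r. Qed.

Lemma pairing0r x : pairing x 0 = 0.
Proof. by apply: (addrI (pairing x 0)); rewrite -pairingDr !addr0. Qed.

Lemma pairingZr x a y : pairing x (a *: y) = a * pairing x y.
Proof. by rewrite -[a *: y]addr0 pairing_linr pairing0r addr0. Qed.

Lemma pairing_sumr x (I : Type) (r : seq I) (P : pred I) F :
  pairing x (\sum_(i <- r | P i) F i) = \sum_(i <- r | P i) pairing x (F i).
Proof. exact: (big_morph _ (pairingDr x) (pairing0r x)). Qed.

Lemma pairingDl x y z : pairing (x + y) z = pairing x z + pairing y z.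
Proof. by rewrite -[x in LHS]scale1r pairing_linl mul1r. Qed.

Lemma pairing0l y : pairing 0 y = 0.
Proof. by apply: (addrI (pairing 0 y)); rewrite -pairingDl !addr0. Qed.

Lemma pairingZl a x y : pairing (a *: x) y = a * pairing x y.
Proof. by rewrite -[a *: x]addr0 pairing_linl pairing0l addr0. Qed.

End PairingLinear.

(** * Signed counts of relabelings *)

Section SignedIsos.
Variables (R : realType) (m n : nat).
Implicit Types d k N e : nat.

Definition sgn N e (G H : graph m N e) (q : 'S_N * 'S_e) : R :=
  (-1) ^+ rel_sign n G H q.1 q.2.

(** The sum over the [G'] equal to [G] makes sense of relabelings from [G] to [H]
    when their sizes are only known to agree up to a proof; when the sizes
    differ it is empty. *)
Definition isum N e (G : graph m N e) N' e' (H : graph m N' e') : R :=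
  \sum_(G' : graph m N' e' | diag G' == diag G)
    \sum_(q : 'S_N' * 'S_e' | relabeling G' H q.1 q.2) sgn G' H q.

Lemma diag_inj N e : injective (@diag m N e).
Proof. by move=> G H E; apply: eq_from_Tagged E. Qed.

Lemma isumE N e (G H : graph m N e) :
  isum G H = \sum_(q | relabeling G H q.1 q.2) sgn G H q.
Proof.
rewrite /isum (bigD1 G) //= [X in _ + X]big1 ?addr0 // => G'.
by case/andP=> /eqP/diag_inj ->; rewrite eqxx.
Qed.

Lemma isum_size N e (G : graph m N e) N' e' (H : graph m N' e') :
  isum G H != 0 -> N' = N /\ e' = e.
Proof.
move=> h; suff [G' /eqP E] : exists G' : graph m N' e', diag G' == diag G.
  by have := congr1 tag E; case.
apply/existsP; move: h; apply: contraNT; rewrite negb_exists => /forallP h.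
by rewrite /isum big1 // => G' hG; have := h G'; rewrite hG.
Qed.

Lemma cls_sgn d k N e (G H : graph m N e) q : relabeling G H q.1 q.2 ->
  cls R n d k G = sgn G H q *: cls R n d k H.
Proof. exact: cls_relab. Qed.

Lemma sgnK N e (G H : graph m N e) q : sgn G H q * sgn G H q = 1.
Proof. by rewrite /sgn -expr2 sqrr_sign. Qed.


(** An edge changes its orientation under a composite iff it does so under
    exactly one of the two factors. *)
Lemma sgn_comp N e (G H K : graph m N e) q r :
  relabeling G H q.1 q.2 -> relabeling H K r.1 r.2 ->
  sgn G K ((q.1 * r.1)%g, (q.2 * r.2)%g) = sgn G H q * sgn H K r.
Proof.
case: q r => [p t] [p' t'] /= r1 r2; rewrite /sgn /= -exprD; apply: eq_sign.
rewrite /rel_sign; case: ifP => on; last by rewrite oddD !oddb odd_permM.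
rewrite !oddD !oddb odd_permM.
(* The parity of a symmetric difference. *)
have cE (A B C : {set 'I_e}) : A = [set i | (i \in B) (+) (i \in C)] ->
    odd #|A| = odd #|B| (+) odd #|C|.
  move=> ->; set D := [set i | _].
  rewrite -(cardsID B D) -(cardsID C B) -(cardsID B C) !oddD (setIC C B).
  have -> : D :&: B = B :\: C.
    by apply/setP => i; rewrite !inE; case: (i \in B); case: (i \in C).
  have -> : D :\: B = C :\: B.
    by apply/setP => i; rewrite !inE; case: (i \in B); case: (i \in C).
  by case: odd; case: odd; case: odd.
rewrite (cE _ [set i | ~~ same_orientation G H p t i]
   [set i | ~~ same_orientation H K p' t' (t i)]); last first.
  apply/setP => i; rewrite !inE /same_orientation permM.
  rewrite (relab_src_tgt i r1).
  have [E|ne] := eqVneq (src G i) (tgt G i).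
    by case: loop_or; case: loop_or; case: loop_or.
  have := relab_srcV i r1; have := relab_srcV (t i) r2; rewrite permM.
  have ne' : tgt G i != src G i by rewrite eq_sym.
  by case=> -[E1 _] [] [E2 E3]; rewrite E1 E2 ?E3 ?eqxx ?(inj_eq perm_inj) ?(negPf ne) ?(negPf ne') ?eqxx.
have -> : #|[set i | ~~ same_orientation H K p' t' (t i)]| =
          #|[set i | ~~ same_orientation H K p' t' i]|.
  rewrite -[RHS](card_imset _ (@perm_inj _ (t^-1)%g)); apply: eq_card => i.
  rewrite inE; apply/idP/imsetP => [h|[j]]; first by exists (t i); rewrite ?permK ?inE.
  by rewrite inE => h ->; rewrite permKV.
by case: (odd_perm p); case: (odd_perm p'); do 2! case: odd.
Qed.

Lemma isum_relabr N e (G : graph m N e) N' e' (H K : graph m N' e') q :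
  relabeling H K q.1 q.2 -> isum G K = sgn H K q * isum G H.
Proof.
move=> r; rewrite /isum mulr_sumr; apply: eq_bigr => G' _; rewrite mulr_sumr.
pose f (u : 'S_N' * 'S_e') := ((u.1 * q.1)%g, (u.2 * q.2)%g).
have fK : bijective f.
  exists (fun u => ((u.1 * q.1^-1)%g, (u.2 * q.2^-1)%g)) => -[u v];
    by rewrite /f /= ?mulgK ?mulgKV.
rewrite (reindex f) ?/=; last exact: onW_bij.
apply: eq_big => [u|u ru] /=.
  apply/idP/idP => h; last exact: relab_comp h r.
  by have := relab_comp h (relab_inv r); rewrite !mulgK.
rewrite mulrC; apply: (sgn_comp (q := u)) => //.
by have := relab_comp ru (relab_inv r); rewrite !mulgK.
Qed.

(** For [n] odd, exchanging two parallel edges has sign [+1], so the signed count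
    alone need not vanish on a diagram with a multiple edge. *)
Definition iform N e (G : graph m N e) N' e' (H : graph m N' e') : R^o :=
  if multi_edge H then 0 else isum G H.

Lemma lin_ext_iform d k N e (G : graph m N e) N' e' (H : graph m N' e') :
  in_LD d k H ->
  lin_ext (fun h : gens m d k => iform G (gen_graph h)) (cls R n d k H)
    = iform G H.
Proof.
apply: lin_extE => [N1 e1 H1 _ mH|N1 e1 H1 H2 p t _ _ r].
  by rewrite /iform mH.
rewrite /iform (relab_multiE r); case: ifP => _; first by rewrite scaler0.
rewrite (isum_relabr G (q := (p, t)) r) -[RHS]/(_ * (_ * _)) mulrA.
by rewrite (sgnK H1 H2 (p, t)) mul1r.
Qed.

End SignedIsos.

(** * The pairing as a count of relabelings *)

Section PairingIsos.
Variables (R : realType) (m n : nat).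
Implicit Types d k N e : nat.
Local Notation isum := (isum R n).
Local Notation sgn := (sgn R n).

Lemma LD_expand d k (x : LD R m n d k) :
  x = \sum_g (vsval x g : R) *: cls R n d k (gen_graph g).
Proof.
have E : vsval x = \sum_g (vsval x g : R) *: basis R d k (gen_graph g); last first.
  transitivity (quo R m n d k (\sum_g (vsval x g : R) *: basis R d k (gen_graph g))).
    by rewrite -E quo_val.
  by rewrite linear_sum; apply: eq_bigr => g _; rewrite linearZ.
apply/ffunP => h; rewrite sum_ffunE (bigD1 h) //= big1 => [|g gh].
  by rewrite addr0 !ffunE eqxx /GRing.scale /= mulr1.
rewrite !ffunE (_ : _ == _ = false) ?scaler0 //.
by apply/negbTE; apply: contra gh => /eqP/gens_diag_inj ->.
Qed.

Lemma isum_neq0 N e (G : graph m N e) N' e' (H : graph m N' e') :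
  isum G H != 0 -> exists (G' : graph m N' e') q,
    diag G' = diag G /\ relabeling G' H q.1 q.2.
Proof.
move=> h; suff /existsP[G' /existsP[q /andP[/eqP h1 h2]]] :
    [exists G' : graph m N' e', exists q : 'S_N' * 'S_e',
      (diag G' == diag G) && relabeling G' H q.1 q.2] by exists G', q.
apply: contraNT h => h; apply/eqP; rewrite /isum big1 // => G' hG.
rewrite big1 // => q hq; case/negP: h.
by apply/existsP; exists G'; apply/existsP; exists q; rewrite hG hq.
Qed.

(** A nonzero signed count provides a relabeling, along which [P] is carried. *)
Lemma isum_invariant (P : forall N e, graph m N e -> bool) :
  (forall N e (G H : graph m N e) p t, relabeling G H p t -> P _ _ H = P _ _ G) ->
  forall N e (G : graph m N e) N' e' (H : graph m N' e'),
  isum G H != 0 -> P _ _ H = P _ _ G.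
Proof.
move=> Pr N e G N' e' H /isum_neq0[G' [q [E r]]]; rewrite (Pr _ _ _ _ _ _ r).
exact: (congr1 (fun D : diagram m => P _ _ (tagged D)) E).
Qed.

Lemma relabeling1 N e (G : graph m N e) : relabeling G G 1 1.
Proof.
apply/and3P; split; apply/forallP => v; rewrite ?perm1 ?eqxx ?implybT //.
by rewrite (eq_imset (g := id)) ?imset_id // => x; rewrite perm1.
Qed.

Lemma Aut_gt0 N e (G : graph m N e) : (0 < #|Aut_diag G|)%N.
Proof.
by apply/card_gt0P; exists (1%g, 1%g); rewrite inE relabeling1.
Qed.

Section Functional.
Variables (d k N e : nat) (G : graph m N e).
Let Phi (x : LD R m n d k) : R^o :=
  lin_ext (fun h : gens m d k => iform R n G (gen_graph h)) x.

Let PhiZ a x : Phi (a *: x) = a * Phi x.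
Proof. by rewrite /Phi linearZ. Qed.

Hypotheses (hG : in_LD d k G) (mG : ~~ multi_edge G).

Let Phi_cls N' e' (H : graph m N' e') : in_LD d k H -> ~~ multi_edge H ->
  Phi (cls R n d k H) = isum G H.
Proof. by move=> hH mH; rewrite /Phi lin_ext_iform // /iform (negPf mH). Qed.

(** A diagram with an odd automorphism is its own opposite; if there is none, all
    automorphisms count with sign [+1]. *)
Lemma isum_self : isum G G = (cls R n d k G != 0)%:R * #|Aut_diag G|%:R.
Proof.
have [E|c0] := eqVneq (cls R n d k G) 0.
  by rewrite mul0r -Phi_cls // E /Phi linear0.
rewrite mul1r isumE (eq_bigr (fun=> 1)) => [|q r].
  by rewrite sumr_const; congr (_%:R); apply: eq_card => q; rewrite !inE.
have := cls_sgn R n d k r; rewrite /sgn -signr_odd; case: odd => //.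
rewrite expr1 scaleN1r => /eqP; rewrite eqr_opp0 => /eqP E.
by rewrite E eqxx in c0.
Qed.

(** A relabeling from [G] to [H] changes both sides by its sign, which reduces
    the claim to [isum_self].  If there is none, the form [Phi] vanishes on [H]
    but not on [G] and so tells their classes apart, even up to sign. *)
Lemma isum_kronecker N' e' (H : graph m N' e') :
  in_LD d k H -> ~~ multi_edge H ->
  kronecker (cls R n d k G) (cls R n d k H) * #|Aut_diag G|%:R = isum G H.
Proof.
move=> hH mH; have [[G' [q [E r]]]|ne] :=
    pselect (exists (G' : graph m N' e') q, diag G' = diag G /\
              relabeling G' H q.1 q.2).
  have [EN Ee] : N' = N /\ e' = e by have := congr1 tag E; case.
  subst N' e'; have EG := diag_inj E; subst G'.
  rewrite (isum_relabr R n G r) isum_self.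
  have -> : cls R n d k H = sgn G H q *: cls R n d k G.
    by rewrite (cls_sgn R n d k r) scalerA sgnK scale1r.
  rewrite /sgn kronecker_signr -mulrA; congr (_ * (_ * _)).
  by rewrite /kronecker; case: eqP; rewrite ?eqxx.
have i0 : isum G H = 0.
  by apply/eqP/negPn/negP => /isum_neq0.
rewrite i0 /kronecker.
have [|c0] := eqVneq (cls R n d k G) 0; first by rewrite mul0r.
suff P s : (cls R n d k G == (-1) ^+ s *: cls R n d k H) = false.
  have := P 0%N; have := P 1%N; rewrite expr0 expr1 scale1r scaleN1r => -> ->.
  exact: mul0r.
have PH : Phi ((-1) ^+ s *: cls R n d k H) = 0.
  by rewrite PhiZ (Phi_cls hH mH) i0 mulr0.
apply/negbTE/eqP => E; move: PH; rewrite -E (Phi_cls hG mG) isum_self c0 mul1r.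
by move=> /eqP; rewrite pnatr_eq0; apply/negP; rewrite -lt0n Aut_gt0.
Qed.
End Functional.

(** It is enough that one of the diagrams is in the complex without multiple
    edges, since a relabeling would transfer this to the other one.  A
    contraction may therefore leave the complex without disturbing the counts. *)
Lemma pairing_isum d k N e (G : graph m N e) N' e' (H : graph m N' e') :
  in_LD d k G && ~~ multi_edge G || in_LD d k H && ~~ multi_edge H ->
  pairing (cls R n d k G) (cls R n d k H) = isum G H.
Proof.
move=> h; have inLDP := @isum_invariant (fun N e G => in_LD d k G)
  (fun N e G H p t => @relab_in_LD m N e d k G H p t).
have multiP := @isum_invariant (fun N e G => multi_edge G)
  (fun N e G H p t => @relab_multiE m N e G H p t).
have [hG|hG] := boolP (in_LD d k G); last first.
  rewrite cls_notin // pairing0l; apply/esym/eqP.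
  move: h; rewrite (negPf hG) /= => /andP[hH _].
  by apply: contraNT hG => /inLDP <-.
have [hH|hH] := boolP (in_LD d k H); last first.
  rewrite [cls _ _ _ _ H]cls_notin // pairing0r; apply/esym/eqP.
  by apply: contraNT hH => /inLDP ->.
have [mG|mG] := boolP (multi_edge G).
  rewrite (cls_multi _ _ _ _ mG) pairing0l; apply/esym/eqP.
  by move: h; rewrite hG hH mG /=; apply: contraNT => /multiP ->.
have [mH|mH] := boolP (multi_edge H).
  rewrite (cls_multi _ _ _ _ mH) pairing0r; apply/esym/eqP.
  by apply: contraTT mH => /multiP ->.
by rewrite pairing_cls // isum_kronecker.
Qed.

Definition icount N e (G : graph m N e) N' e' (H : graph m N' e') : R :=
  \sum_(G' : graph m N' e' | diag G' == diag G)
    \sum_(q : 'S_N' * 'S_e' | relabeling G' H q.1 q.2) 1.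

Lemma icount_relabr N e (G : graph m N e) N' e' (H K : graph m N' e') p t :
  relabeling H K p t -> icount G K = icount G H.
Proof.
move=> r; apply: eq_bigr => G' _.
pose f (u : 'S_N' * 'S_e') := ((u.1 * p)%g, (u.2 * t)%g).
have fK : bijective f.
  exists (fun u => ((u.1 * p^-1)%g, (u.2 * t^-1)%g)) => -[u v];
    by rewrite /f /= ?mulgK ?mulgKV.
rewrite (reindex f) ?/=; last exact: onW_bij.
apply: eq_bigl => u; apply/idP/idP => h; last exact: relab_comp h r.
by have := relab_comp h (relab_inv r); rewrite !mulgK.
Qed.

(** Each relabeling adds its sign times the class of [G], that is, the class of
    [H]. *)
Lemma isum_cls d k N e (G : graph m N e) N' e' (H : graph m N' e') :
  isum G H *: cls R n d k G = icount G H *: cls R n d k H.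
Proof.
rewrite /icount !scaler_suml; apply: eq_bigr => G' /eqP E.
rewrite !scaler_suml; apply: eq_bigr => q r; rewrite scale1r.
rewrite -(congr1 (fun D : diagram m => cls R n d k (tagged D)) E) /=.
by rewrite (cls_sgn R n d k r) scalerA sgnK scale1r.
Qed.

(** The vectors [c h] may coincide up to sign or vanish, so they are not a basis.
    But the weights [w] are constant along the nonzero entries of [M], hence the
    average of [f g y *: c g] with weights [1 / w g] fixes every [c h] and
    recovers each vector [y] from its values under [f]. *)
Lemma nondegenerate (V : lmodType R) (I : finType) (c : I -> V) (f : I -> V -> R)
    (M : I -> I -> R) (w : I -> R) :
  (forall g a y z, f g (a *: y + z) = a * f g y + f g z) ->
  (forall y, exists a : I -> R, y = \sum_h a h *: c h) ->
  (forall g h, f g (c h) *: c g = M g h *: c h) ->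
  (forall g h, M g h != 0 -> w g = w h) ->
  (forall h, \sum_g M g h = w h) -> (forall h, w h != 0) ->
  forall x, (forall g, c g != 0 -> f g x = 0) -> x = 0.
Proof.
move=> fL span fc wM wE w0 x x0.
have f0 g : f g 0 = 0.
  by have := fL g 1 0 0; rewrite scaler0 addr0 mul1r -{1}[f g 0]addr0 => /addrI <-.
pose F y := \sum_g ((w g)^-1 * f g y) *: c g.
have FD a y z : F (a *: y + z) = a *: F y + F z.
  rewrite /F scaler_sumr -big_split /=; apply: eq_bigr => g _.
  by rewrite fL mulrDr scalerDl scalerA mulrCA.
have Fc h : F (c h) = c h.
  transitivity (\sum_g ((w h)^-1 * M g h) *: c h).
    apply: eq_bigr => g _; rewrite -scalerA fc scalerA.
    by have [->|/wM ->//] := eqVneq (M g h) 0; rewrite !mulr0.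
  by rewrite -scaler_suml -mulr_sumr wE mulVf ?scale1r.
have FE y : F y = y.
  have [a ->] := span y; have F0 : F 0 = 0.
    by rewrite /F big1 // => g _; rewrite f0 mulr0 scale0r.
  elim/big_rec: _ => // h z _ Fz; by rewrite FD Fc Fz.
rewrite -(FE x) /F big1 // => g _.
by have [->|c0] := eqVneq (c g) 0; rewrite ?scaler0 // x0 ?mulr0 ?scale0r.
Qed.

(** The weight of a diagram is the number of relabelings into it from all
    generators, which depends only on its isomorphism class. *)
Lemma pairing_eq0 d k (x : LD R m n d k) :
  (forall N e (G : graph m N e), in_LD d k G -> ~~ multi_edge G ->
     cls R n d k G != 0 -> pairing (cls R n d k G) x = 0) -> x = 0.
Proof.
pose c (g : gens m d k) := cls R n d k (gen_graph g).
pose M (g h : gens m d k) := icount (gen_graph g) (gen_graph h).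
pose w N e (G : graph m N e) : R := \sum_(g : gens m d k) icount (gen_graph g) G.
have wE N e (G : graph m N e) N' e' (H : graph m N' e') :
    icount G H != 0 -> w _ _ G = w _ _ H.
  move=> h; have [G' [q [E r]]] : exists (G' : graph m N' e') q,
      diag G' = diag G /\ relabeling G' H q.1 q.2.
    suff /existsP[G' /existsP[q /andP[/eqP h1 h2]]] :
      [exists G' : graph m N' e', exists q : 'S_N' * 'S_e',
        (diag G' == diag G) && relabeling G' H q.1 q.2] by exists G', q.
    apply: contraNT h => h; apply/eqP; rewrite /icount big1 // => G' hG.
    rewrite big1 // => q hq; case/negP: h.
    by apply/existsP; exists G'; apply/existsP; exists q; rewrite hG hq.
  transitivity (w _ _ G').
    exact: esym (congr1 (fun D : diagram m => w _ _ (tagged D)) E).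
  by apply: eq_bigr => g _; apply/esym; apply: icount_relabr r.
have ge0 N e (G : graph m N e) N' e' (H : graph m N' e') : 0 <= icount G H.
  by apply: sumr_ge0 => G' _; apply: sumr_ge0.
have gt0 N e (G : graph m N e) : 0 < icount G G.
  apply: (@lt_le_trans _ _ (\sum_(q : 'S_N * 'S_e | relabeling G G q.1 q.2) (1 : R))).
    rewrite sumr_const ltr0n; apply/card_gt0P; exists (1%g, 1%g).
    exact: relabeling1.
  rewrite /icount (bigD1 G) //=; set u := \sum_(_ | _) _; set v := \sum_(_ | _ && _) _.
  have : 0 <= v by apply: sumr_ge0 => G' _; apply: sumr_ge0.
  by move: u v => u v; rewrite lerDl.
have w_neq0 (h : gens m d k) : w _ _ (gen_graph h) != 0.
  apply: lt0r_neq0; apply: (lt_le_trans (gt0 _ _ (gen_graph h))).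
  rewrite /w (bigD1 h) //=; set u := icount _ _; set v := \sum_(_ | _) _.
  have : 0 <= v by apply: sumr_ge0.
  by move: u v => u v; rewrite lerDl.
move=> x0; apply: (@nondegenerate _ _ c (fun g y => pairing (c g) y) M
   (fun g => w _ _ (gen_graph g))).
- by move=> g a y z; rewrite pairingDr pairingZr.
- by move=> y; exists (fun g => vsval y g : R); apply: LD_expand.
- move=> g h; have [mh|mh] := boolP (multi_edge (gen_graph h)).
    by rewrite /c (cls_multi R n d k mh) pairing0r scale0r scaler0.
  have E : pairing (c g) (c h) = isum (gen_graph g) (gen_graph h).
    by apply: pairing_isum; rewrite (in_LD_gen h) mh orbT.
  by rewrite E; apply: isum_cls.
- by move=> g h; apply: wE.
- exact: (fun=> erefl).
- exact: w_neq0.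
move=> g cg; apply: x0 => //; first exact: in_LD_gen.
by apply: contra cg => /(cls_multi R n d k); rewrite /c => ->.
Qed.

End PairingIsos.

(** * Valences and connectivity *)

Section Valence.
Local Open Scope nat_scope.
Variable m : nat.
Implicit Types d k N e : nat.

Definition star N e (G : graph m N e) (x : 'I_N) : {set 'I_e} :=
  [set j | x \in ends G j].

Lemma LD_kinds N e (G : graph m N e) : link_diagram G ->
  forall j x, ends G j = [set x] -> seg G x.
Proof.
case/and4P => _; rewrite kindE => /forallP h _ _ j x E.
by have := h j; rewrite E cards1 => /forall_inP/(_ x (set11 x)).
Qed.

(** An edge between two vertices counts once at each of them and a loop twice at
    its vertex; a segment vertex counts 2 more for the segment it lies on. *)
Lemma handshake N e (G : graph m N e) :
  (forall j x, ends G j = [set x] -> seg G x) ->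
  \sum_(v : 'I_N) valence G v = (2 * e + 2 * nseg G)%N.
Proof.
move=> kG; rewrite /valence big_split /=.
have -> : (\sum_v (if seg G v then 2 * #|[set i | ends G i == [set v]]| + 2 else 0) =
   \sum_v (if seg G v then 2 * #|[set i | ends G i == [set v]]| else 0) + 2 * nseg G)%N.
  rewrite /nseg -sum1dep_card big_distrr [X in (_ + X)%N]big_mkcond -big_split /=.
  by apply: eq_bigr => v _; case: seg => //; rewrite muln1.
apply/eqP; rewrite [X in X == _]addnA eqn_add2r; apply/eqP; rewrite -big_split /=.
have cE (P : pred 'I_e) : #|[set i | P i]| = (\sum_i P i)%N.
  by rewrite -sum1dep_card big_mkcond; apply: eq_bigr => i _; case: (P i).
rewrite (eq_bigr (fun v => \sum_(i : 'I_e) ((v \in ends G i) && (ends G i != [set v])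
     + 2 * (seg G v && (ends G i == [set v])))%N)) => [|v _]; last first.
  rewrite big_split. rewrite -big_distrr !cE; congr (_ + _)%N.
  by case sv: (seg G v) => //=; rewrite big1.
transitivity (\sum_(i < e) 2); last by rewrite sum_nat_const card_ord mulnC.
rewrite exchange_big /=; apply: eq_bigr => i _.
have [[x E]|nl] := pselect (exists x, ends G i = [set x]).
  rewrite (bigD1 x) //= big1 => [|y yx]; rewrite E inE ?eqxx /=.
    by rewrite (kG i).
  by rewrite (negPf yx) /= (inj_eq set1_inj) eq_sym (negPf yx) andbF.
have nE v : (ends G i == [set v]) = false.
  by apply/eqP => E; apply: nl; exists v.
under eq_bigr do rewrite nE andbT andbF addn0.
rewrite -[LHS]/(\sum_v (v \in ends G i))%N -big_mkcond /= sum1_card cards2.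
by case: eqP => // E; case: nl; exists (src G i); rewrite /ends -E setUid.
Qed.

Lemma in_LD_size d k N e (G : graph m N e) : in_LD d k G -> (N + d = 2 * k)%N.
Proof.
case/and3P => _ /eqP hd /eqP ho; have := nseg_nfree G.
by rewrite /defect /diag_order in hd ho; lia.
Qed.

Lemma sum_valence d k N e (G : graph m N e) : in_LD d k G ->
  \sum_(v : 'I_N) valence G v = (3 * N + d)%N.
Proof.
case/and3P => lG /eqP hd /eqP ho; rewrite handshake; last exact: LD_kinds.
have := nseg_nfree G; rewrite /defect /diag_order in hd ho; lia.
Qed.

Lemma valence_ge3 N e (G : graph m N e) v : link_diagram G -> (3 <= valence G v)%N.
Proof. by case/and4P => _ _ _ /forallP. Qed.

(** The defect is the total excess of the valences over 3. *)
Lemma excess_sum d k N e (G : graph m N e) : in_LD d k G ->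
  \sum_(v : 'I_N) (valence G v - 3) = d.
Proof.
move=> hG; have := sum_valence hG.
have -> : (\sum_v valence G v = \sum_v (valence G v - 3) + 3 * N)%N.
  transitivity (\sum_(v < N) (valence G v - 3 + 3)); last first.
    by rewrite big_split sum_nat_const card_ord mulnC.
  apply: eq_bigr => v _; rewrite subnK // valence_ge3 //.
  by case/and3P: hG.
by rewrite addnC => /eqP; rewrite eqn_add2l => /eqP.
Qed.

Lemma trivalent k N e (G : graph m N e) v : in_LD 0 k G -> valence G v = 3.
Proof.
move=> hG; have := excess_sum hG; move/eqP; rewrite sum_nat_eq0 => /forallP/(_ v).
have := @valence_ge3 _ _ G v; case/and3P: hG => lG _ _ /(_ lG) /=; lia.
Qed.

Lemma defect1_vertex k N e (G : graph m N e) : in_LD 1 k G ->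
  exists i, valence G i = 4 /\ forall x, x != i -> valence G x = 3.
Proof.
move=> hG; have := excess_sum hG => S.
have ge3 x : (3 <= valence G x)%N by apply: valence_ge3; case/and3P: hG.
have [i hi] : exists i, (valence G i - 3 != 0)%N.
  apply/existsP; move: S; apply: contraPT; rewrite negb_exists => /forallP h.
  by rewrite big1 // => i _; have := h i; rewrite negbK => /eqP.
exists i; move: S; rewrite (bigD1 i) //= => S.
have S0 : (\sum_(x | x != i) (valence G x - 3) = 0)%N.
  apply/eqP; move: S hi; case: (valence G i - 3) => // c; rewrite addSn => -[] /eqP.
  by rewrite addn_eq0 => /andP[].
rewrite S0 addn0 in S.
split=> [|x xi]; first by have := ge3 i; lia.
move/eqP: S0; rewrite sum_nat_eq0 => /forallP/(_ x); rewrite xi /=.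
by have := ge3 x; lia.
Qed.

Lemma valence_seg N e (G : graph m N e) v : seg G v ->
  valence G v = (#|star G v| + #|[set i | ends G i == [set v]]| + 2)%N.
Proof.
move=> sv; rewrite /valence sv mul2n -addnn !addnA; congr (_ + _ + _)%N.
rewrite -(cardsID [set i | ends G i == [set v]] (star G v)) addnC.
congr addn; apply: eq_card => i; rewrite !inE.
  case: eqP => [E|]; rewrite ?andbF // andbT.
  by rewrite -in_set2 -[[set _; _]]/(ends G i) E inE eqxx.
by rewrite andbC.
Qed.

Lemma valence_free N e (G : graph m N e) v : link_diagram G -> ~~ seg G v ->
  valence G v = #|star G v|.
Proof.
move=> lG sv; rewrite /valence (negPf sv) addn0; apply: eq_card => i.
rewrite in_set [in RHS]inE.
case E: (ends G i == [set v]); rewrite /= ?andbT //.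
by rewrite (LD_kinds lG (eqP E)) in sv.
Qed.

Section Trivalent.
Variables (k N e : nat) (G : graph m N e).
Hypothesis hG : in_LD 0 k G.
Let lG : link_diagram G. Proof. by case/and3P: hG. Qed.

(** A loop and the segment alone give its vertex valence 4. *)
Lemma tri_noloop j x : ends G j != [set x].
Proof.
apply/eqP => E; have sx := LD_kinds lG E; have := trivalent x hG.
rewrite valence_seg //; set L := [set i | _].
have h1 : (0 < #|star G x|)%N by apply/card_gt0P; exists j; rewrite inE E inE.
have h2 : (0 < #|L|)%N.
  by apply/card_gt0P; exists j; rewrite inE E.
by move: #|star G x| #|L| h1 h2 => a b; lia.
Qed.

Lemma tri_star x : #|star G x| = if seg G x then 1%N else 3.
Proof.
have := trivalent x hG; case: ifPn => sx; last by rewrite valence_free.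
rewrite valence_seg // (_ : [set i | _] = set0) ?cards0; first by lia.
by apply/setP => j; rewrite !inE; apply/negbTE/tri_noloop.
Qed.

Lemma tri_src_tgt j : src G j != tgt G j.
Proof.
by apply/eqP => E; have := tri_noloop j (src G j); rewrite /ends E setUid eqxx.
Qed.
End Trivalent.

(** The restriction to [P] expresses paths that avoid certain vertices. *)
Definition adj N e (G : graph m N e) (P : pred 'I_N) : rel 'I_N :=
  fun x y => [&& P x, P y & [exists j, ends G j == [set x; y]]].

Lemma adj_sym N e (G : graph m N e) P : symmetric (adj G P).
Proof.
by move=> x y; rewrite /adj andbCA; do 2 congr andb;
   apply: eq_existsb => j; rewrite setUC.
Qed.

Lemma connect_adj_sym N e (G : graph m N e) P : connect_sym (adj G P).
Proof. exact/sym_connect_sym/adj_sym. Qed.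

Lemma ends2 N e (G : graph m N e) j x y : x \in ends G j -> y \in ends G j ->
  x = y \/ ends G j = [set x; y].
Proof.
rewrite /ends !inE => /orP[]/eqP-> /orP[]/eqP->; rewrite ?setUid; auto.
by rewrite setUC; right.
Qed.

(** Sequences of touching edges and sequences of adjacent vertices connect the
    same vertices. *)
Lemma edge_path_connect N e (G : graph m N e) (P : pred 'I_N) v w i p :
  (forall j x, j \in i :: p -> x \in ends G j -> P x) ->
  edge_path G v w i p -> connect (adj G P) v w.
Proof.
move=> hP /and3P[].
have step x y j : j \in i :: p -> x \in ends G j -> y \in ends G j ->
    connect (adj G P) x y.
  move=> jp xj yj; have [->//|E] := ends2 xj yj.
  apply: connect1; rewrite /adj (hP j x) // (hP j y) //=.
  by apply/existsP; exists j; rewrite E.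
elim: p i v hP step => [|j p IH] i v hP step /=.
  by move=> _ hv hw; apply: step hv hw; rewrite inE.
case/andP => /set0Pn[z]; rewrite inE => /andP[zi zj] hp hv hw.
apply: (connect_trans (y := z)); first by apply: step hv zi; rewrite inE eqxx.
apply: (IH j) => // [l x lp|l x y lp]; [apply: hP|apply: step];
  by rewrite inE lp orbT.
Qed.

Lemma connect_edge_path N e (G : graph m N e) (P : pred 'I_N) v w :
  connect (adj G P) v w -> v != w ->
  exists i p, edge_path G v w i p /\
    forall j x, j \in i :: p -> x \in ends G j -> P x.
Proof.
case/connectP => p; elim: p v => [|y p IH] v /=; first by move=> _ ->; rewrite eqxx.
case/andP => /and3P[Pv Py /existsP[j /eqP E]] hp hw vw.
have jP x : x \in ends G j -> P x by rewrite E !inE => /orP[]/eqP->.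
have vj : v \in ends G j by rewrite E !inE eqxx.
have yj : y \in ends G j by rewrite E !inE eqxx orbT.
have [yw|yw] := eqVneq y w.
  exists j, [::]; split; first by rewrite /edge_path /= vj -yw.
  by move=> l x; rewrite inE => /eqP->; apply: jP.
have [i [q [/and3P[h1 h2 h3] hq]]] := IH y hp hw yw.
exists j, (i :: q); split.
  rewrite /edge_path /= h1 vj h3 !andbT.
  by apply/set0Pn; exists y; rewrite inE yj h2.
by move=> l x; rewrite inE => /orP[/eqP->|]; [apply: jP|apply: hq].
Qed.

Lemma LD_connected N e (G : graph m N e) : link_diagram G ->
  forall v, ~~ seg G v -> exists2 w, seg G w & connect (adj G predT) v w.
Proof.
case/and4P => _ _ /asboolP h _ v /h[w [i [p [sw hp]]]]; exists w => //.
exact: edge_path_connect hp.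
Qed.

End Valence.

(** * Contractions of trivalent diagrams *)

Section Contraction.
Variable m : nat.
Implicit Types d k N e : nat.

Lemma bump_lt h a b : (a < b)%N -> (bump h a < bump h b)%N.
Proof. by rewrite /bump; case: (leqP h a) => ?; case: (leqP h b) => ?; lia. Qed.

Lemma merge_lt N (w : 'I_N.+1) (v : 'I_N) x :
  x != w -> lift w (merge_vertex w v x : 'I_N) = x.
Proof. by case: (unliftP w x) => [y ->|->]; rewrite ?eqxx // => _; rewrite merge_lift. Qed.

Lemma mergeE N (w : 'I_N.+1) (v : 'I_N) x y :
  (merge_vertex w v x == y) = ((y == v) && (x == w) || (x == lift w y)).
Proof.
case: (unliftP w x) => [z ->|->].
  by rewrite merge_lift (inj_eq lift_inj) [lift w z == w]eq_sym (negPf (neq_lift _ _)) andbF.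
by rewrite merge_id eqxx andbT (negPf (neq_lift _ _)) orbF eq_sym.
Qed.

Lemma mem_contract N e (G : graph m N.+1 e) w (v y : 'I_N) j :
  (y \in ends (contract G w v) j) =
  ((y == v) && (w \in ends G j) || (lift w y \in ends G j)).
Proof.
rewrite ends_contract; apply/imsetP/idP => [[x xj]|].
  move/esym/eqP; rewrite mergeE => /orP[/andP[-> /eqP <-]|/eqP <-]; by rewrite xj ?orbT.
case/orP => [/andP[/eqP -> wj]|h]; first by exists w; rewrite ?merge_id.
by exists (lift w y); rewrite ?merge_lift.
Qed.

Lemma loc_contract N e (G : graph m N.+1 e) w (v y : 'I_N) :
  loc (contract G w v) y = loc G (lift w y).
Proof. by rewrite /loc ffunE. Qed.

Lemma seg_contract N e (G : graph m N.+1 e) w (v y : 'I_N) :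
  seg (contract G w v) y = seg G (lift w y).
Proof. by rewrite /seg loc_contract. Qed.

Lemma ends_contract1 N e (G : graph m N.+1 e) w (v y : 'I_N) j : y != v ->
  (ends (contract G w v) j == [set y]) = (ends G j == [set lift w y]).
Proof.
move=> yv; rewrite ends_contract; apply/eqP/eqP => [E|->]; last first.
  by rewrite imset_set1 merge_lift.
have h x : x \in ends G j -> x = lift w y.
  move=> xj; have : merge_vertex w v x \in [set y] by rewrite -E imset_f.
  by rewrite inE mergeE (negPf yv) /= => /eqP.
have [sj tj] := mem_ends G j.
by apply/setP => x; rewrite !inE (h _ sj) (h _ tj) orbb.
Qed.

Lemma valence_contract N e (G : graph m N.+1 e) w (v y : 'I_N) : y != v ->
  valence (contract G w v) y = valence G (lift w y).
Proof.
move=> yv; rewrite /valence seg_contract; congr addn.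
  by apply: eq_card => j; rewrite [LHS]in_set [RHS]in_set ends_contract1 // mem_contract (negPf yv).
case: ifP => // _; congr (2 * _ + 2)%N.
by apply: eq_card => j; rewrite [LHS]in_set [RHS]in_set ends_contract1.
Qed.

Lemma adj_contract N e (G : graph m N.+1 e) w (v : 'I_N) x y :
  adj G predT x y ->
  connect (adj (contract G w v) predT) (merge_vertex w v x) (merge_vertex w v y).
Proof.
case/existsP => j /eqP E.
have [->//|ne] := eqVneq (merge_vertex w v x) (merge_vertex w v y).
apply: connect1; apply/existsP; exists j.
by rewrite ends_contract E imsetU1 imset_set1.
Qed.

Lemma connect_mono (T T' : finType) (r : rel T) (r' : rel T') (f : T -> T') :
  (forall x y, r x y -> connect r' (f x) (f y)) ->
  forall x y, connect r x y -> connect r' (f x) (f y).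
Proof.
move=> h x y /connectP[p]; elim: p x => [|z p IH] x /=; first by move=> _ ->.
by case/andP => /h xz hp hy; apply: connect_trans xz (IH _ hp hy).
Qed.

Lemma nseg_contract N e (G : graph m N.+1 e) w (v : 'I_N) :
  nseg G = (seg G w + nseg (contract G w v))%N.
Proof.
rewrite /nseg (card_lift w); congr (_ + _)%N; apply: eq_card => y.
by rewrite !inE seg_contract.
Qed.

(** Here [G] is the trivalent diagram [H], from which the contracted edge has been
    removed if there is one.  Every condition on a link diagram is inherited
    except the valence of the merged vertex, which the handshake count forces to
    be 4. *)
Lemma contract_link k N e e' (H : graph m N.+1 e') (G : graph m N.+1 e) (w : 'I_N.+1) (v : 'I_N) :
  in_LD 0 k H -> loc G =1 loc H ->
  (forall j x, ends G j != [set x]) ->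
  (~~ seg G (lift w v) -> forall j, ends G j != [set lift w v; w]) ->
  (seg G w -> seg G (lift w v)) ->
  (forall y, y != v -> valence G (lift w y) = valence H (lift w y)) ->
  (forall x y, adj H predT x y -> [set x; y] != [set lift w v; w] -> adj G predT x y) ->
  (2 * e + 2 * nseg (contract G w v) = 3 * N + 1)%N ->
  link_diagram (contract G w v).
Proof.
move=> hH lGH nl nm sw vH aH cnt; set C := contract G w v.
have lH : link_diagram H by case/and3P: hH.
have sGH x : seg G x = seg H x by rewrite /seg lGH.
have kC j x : ends C j = [set x] -> seg C x.
  move/eqP; have [->|xv] := eqVneq x v; last by rewrite ends_contract1 // (negPf (nl _ _)).
  rewrite seg_contract => /eqP E; apply: contraT => /nm/(_ j).
  have h u : u \in ends G j -> u \in [set lift w v; w].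
    move=> uj; have : merge_vertex w v u \in [set v] by rewrite -E ends_contract imset_f.
    by rewrite inE mergeE eqxx !inE orbC.
  have [sj tj] := mem_ends G j.
  have st : src G j != tgt G j.
    by have := nl j (src G j); apply: contraNneq => E'; rewrite /ends -E' setUid.
  have := h _ sj; have := h _ tj; rewrite /ends.
  rewrite !inE => /orP[]/eqP h1 /orP[]/eqP h2; move: st; rewrite h1 h2 ?eqxx //.
  by rewrite setUC eqxx.
(* All other vertices are trivalent, so the handshake count leaves 4 for [v]. *)
have vC : (valence C v = 4)%N.
  have := handshake kC; rewrite cnt (bigD1 v) //=.
  rewrite (eq_bigr (fun=> 3)) => [|y yv]; last first.
    by rewrite valence_contract // vH // (trivalent _ hH).
  rewrite sum_nat_const; have -> : #|(fun i : 'I_N => i != v)| = N.-1.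
    by rewrite (cardC1 v) card_ord.
  by have := ltn_ord v; lia.
apply/and4P; split.
- apply/forallP => x; apply/forallP => y; apply/implyP => xy.
  rewrite !loc_contract !lGH.
  case/and4P: lH => /forallP/(_ (lift w x))/forallP/(_ (lift w y))/implyP + _ _ _.
  by apply; apply: bump_lt.
- rewrite kindE; apply/forallP => j; apply/implyP => /cards1P[x E].
  by rewrite E; apply/forall_inP => y; rewrite inE => /eqP ->; apply: kC E.
- apply/asboolP => y; rewrite seg_contract sGH => ny.
  have [z sz hz] := LD_connected lH ny.
  have hC : connect (adj C predT) y (merge_vertex w v z).
    rewrite -{1}(merge_lift w v y); move: hz; apply: connect_mono => a b ab.
    have [E|ne] := eqVneq [set a; b] [set lift w v; w]; last first.
      exact: adj_contract (aH _ _ ab ne).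
    have mv u : u \in [set a; b] -> merge_vertex w v u = v.
      by rewrite E !inE => /orP[]/eqP ->; rewrite ?merge_id ?merge_lift.
    by rewrite !mv ?connect0 // !inE eqxx ?orbT.
  have sC : seg C (merge_vertex w v z).
    case: (unliftP w z) sz => [u ->|->] => sz.
      by rewrite merge_lift seg_contract sGH.
    by rewrite merge_id seg_contract sw // sGH.
  have yz : y != merge_vertex w v z.
    by apply: contraTneq sC => <-; rewrite seg_contract sGH.
  have [i [p [hp _]]] := connect_edge_path hC yz.
  by exists (merge_vertex w v z), i, p.
apply/forallP => y; have [->|yv] := eqVneq y v; first by rewrite vC.
by rewrite valence_contract // vH // (trivalent _ hH).
Qed.

(** Segment vertices precede free ones, and an edge between two segment vertices
    is a chord. *)
Lemma contracted_free N e (H : graph m N.+1 e) i (w : 'I_N.+1) (v : 'I_N) :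
  link_diagram H -> is_free_edge H i || is_mixed H i ->
  (v < w)%N -> ends H i = [set lift w v; w] -> ~~ seg H w.
Proof.
move=> lH ki vw Ei; apply/negP => sw.
have sv : seg H (lift w v).
  apply: contraT => nv; have := free_below lH nv sw.
  by rewrite ltnNge ltnW // (lift_lt w v).
have [h1 h2] := mem_ends H i; rewrite Ei in h1 h2.
have ss : seg H (src H i) by move: h1; rewrite !inE => /orP[]/eqP ->.
have st : seg H (tgt H i) by move: h2; rewrite !inE => /orP[]/eqP ->.
by move: ki; rewrite /is_free_edge /is_mixed ss st /= andbF.
Qed.

Lemma del_edge_neq k N e (H : graph m N e.+1) i j :
  in_LD 0 k H -> ~~ multi_edge H -> ends (del_edge H i) j != ends H i.
Proof.
move=> hH; apply: contraNneq => E; apply/existsP; exists i.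
apply/existsP; exists (lift i j); rewrite neq_lift -E ends_del_edge eqxx andbT /=.
exact: tri_src_tgt hH i.
Qed.

Lemma LD_counts d k N e (G : graph m N e) : in_LD d k G ->
  (2 * e + 2 * nseg G = 3 * N + d)%N /\ (e = k + nfree G)%N.
Proof.
move=> hG; have h := sum_valence hG; case/and3P: hG => lG _ /eqP ho.
rewrite handshake in h; last exact: LD_kinds.
by rewrite /diag_order in ho; split; [|lia].
Qed.

Lemma in_LDI d k N e (G : graph m N e) : link_diagram G ->
  (2 * e + 2 * nseg G = 3 * N + d)%N -> (e = k + nfree G)%N -> in_LD d k G.
Proof.
move=> lG h1 h2; have := nseg_nfree G.
by rewrite /in_LD lG /defect /diag_order /= => h; apply/andP; split; apply/eqP; lia.
Qed.

Lemma valence_del_edge N e (H : graph m N e.+1) i x : x \notin ends H i ->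
  valence (del_edge H i) x = valence H x.
Proof.
move=> xi; have nE (A : {set 'I_N}) : x \in A -> (ends H i == A) = false.
  by move=> xA; apply/eqP => E; rewrite E xA in xi.
rewrite /valence -[seg (del_edge H i) _]/(seg H x).
rewrite (card_lift i (fun j => (x \in ends H j) && _)) (negPf xi) add0n.
rewrite [in RHS](card_lift i (fun j => ends H j == [set x])) nE ?inE // add0n.
congr (_ + (if _ then 2 * _ + 2 else 0))%N.
  by apply: eq_card => j; rewrite [LHS]in_set [RHS]in_set ends_del_edge.
by apply: eq_card => j; rewrite [LHS]in_set [RHS]in_set ends_del_edge.
Qed.

Lemma contract_edge_LD k N e (H : graph m N.+1 e.+1) i (w : 'I_N.+1) (v : 'I_N) :
  in_LD 0 k H -> ~~ multi_edge H -> is_free_edge H i || is_mixed H i ->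
  (v < w)%N -> ends H i = [set lift w v; w] ->
  in_LD 1 k (contract (del_edge H i) w v).
Proof.
move=> hH mH ki vw Ei; have lH : link_diagram H by case/and3P: hH.
have nw := contracted_free lH ki vw Ei.
have [cH oH] := LD_counts hH.
have nsC := nseg_contract (del_edge H i) w v.
have nsH : nseg (del_edge H i) = nseg H by [].
have nw' : seg (del_edge H i) w = false by apply: negbTE.
rewrite nw' add0n nsH in nsC.
have cC : (2 * e + 2 * nseg (contract (del_edge H i) w v) = 3 * N + 1)%N by rewrite -nsC; lia.
apply: in_LDI => //; last first.
  have := nseg_nfree H; have := nseg_nfree (contract (del_edge H i) w v).
  rewrite -nsC; move: oH; move: (nfree H) (nseg H) (nfree _) => a b c /=; lia.
apply: (contract_link hH) => //.
- by move=> j x; rewrite ends_del_edge; apply: tri_noloop hH _ _.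
- by move=> _ j; rewrite -Ei; apply: del_edge_neq hH mH.
- by rewrite nw'.
- move=> y yv; apply: valence_del_edge.
  by rewrite Ei !inE (inj_eq lift_inj) (negPf yv) eq_sym (negPf (neq_lift _ _)).
move=> x y /existsP[j /eqP E] ne; apply/existsP.
case: (unliftP i j) E => [j' ->|->] E; last by rewrite -E Ei eqxx in ne.
by exists j'; rewrite ends_del_edge E.
Qed.

Lemma contract_arc_LD k N e (H : graph m N.+1 e) (w : 'I_N.+1) (v : 'I_N) :
  in_LD 0 k H -> is_arc H (lift w v) w -> in_LD 1 k (contract H w v).
Proof.
move=> hH /and3P[sv /eqP Evw _]; have sw : seg H w by rewrite /seg -Evw.
have [cH oH] := LD_counts hH.
have nsC := nseg_contract H w v; rewrite sw /= in nsC.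
have cC : (2 * e + 2 * nseg (contract H w v) = 3 * N + 1)%N.
  by move: cH nsC; move: (nseg H) (nseg (contract H w v)) => a b /=; lia.
apply: in_LDI => //; last first.
  have := nseg_nfree H; have := nseg_nfree (contract H w v); rewrite nsC.
  by move: oH; move: (nfree H) (nseg _) (nfree _) => a b c /=; lia.
apply: (contract_link hH) => //.
- by move=> j x; apply: tri_noloop hH _ _.
- by rewrite sv.
Qed.

Lemma contract_edge_valence k N e (H : graph m N.+1 e.+1) i (w : 'I_N.+1) (v y : 'I_N) :
  in_LD 0 k H -> ends H i = [set lift w v; w] -> y != v ->
  valence (contract (del_edge H i) w v) y = 3%N.
Proof.
move=> hH Ei yv; rewrite valence_contract // valence_del_edge ?(trivalent _ hH) //.
by rewrite Ei !inE (inj_eq lift_inj) (negPf yv) eq_sym (negPf (neq_lift _ _)).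
Qed.

End Contraction.

(** * Lifting relabelings through a contraction *)

Section Lifting.
Variables (R : realType) (m n : nat).
Implicit Types d k N e : nat.
Local Notation isum := (isum R n).
Local Notation sgn := (sgn R n).

Lemma relabP N e (G H : graph m N e) p t :
  relabeling G H p t <->
  [/\ forall v, loc H (p v) = loc G v, forall v, seg G v -> p v = v
    & forall j x, (p x \in ends H (t j)) = (x \in ends G j)].
Proof.
split=> [r|[h1 h2 h3]].
  split=> [v|v|j x]; [exact: relab_loc r|exact: relab_fix r|].
  by rewrite (relab_ends _ r) mem_imset //; apply: perm_inj.
apply/and3P; split; apply/forallP => v; first by rewrite h1.
  by apply/implyP => /h2 ->.
apply/eqP/setP => x; rewrite -[x](permKV p) h3 mem_imset //.
exact: perm_inj.
Qed.

Lemma card_precomp e (t : 'S_e) (P : pred 'I_e) : #|[set j | P (t j)]| = #|[set j | P j]|.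
Proof.
rewrite -(card_imset [set j | P (t j)] (@perm_inj _ t)); apply: eq_card => j.
rewrite [RHS]inE; apply/imsetP/idP => [[i]|h]; first by rewrite inE => + ->.
by exists ((t^-1)%g j); rewrite ?inE permKV.
Qed.

Lemma relab_valence N e (G H : graph m N e) p t v : relabeling G H p t ->
  valence H (p v) = valence G v.
Proof.
move=> r; rewrite /valence (relab_seg _ r).
rewrite -(card_precomp t (fun j => (p v \in ends H j) && _)).
rewrite -(card_precomp t (fun j => ends H j == [set p v])).
have E j : (ends H (t j) == [set p v]) = (ends G j == [set v]).
  by rewrite (relab_ends _ r) -imset_set1 (inj_eq (imset_inj (@perm_inj _ p))).
have [_ _ M] := (relabP G H p t).1 r.
congr (_ + (if _ then 2 * _ + 2 else 0))%N.
  by apply: eq_card => j; rewrite [LHS]in_set [RHS]in_set M E.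
by apply: eq_card => j; rewrite [LHS]in_set [RHS]in_set E.
Qed.

Lemma relab_ext N e (G G' H : graph m N e) p t : loc G =1 loc G' ->
  ends G =1 ends G' -> relabeling G H p t = relabeling G' H p t.
Proof.
move=> lE eE; congr [&& _, _ & _]; apply: eq_forallb => v.
- by rewrite lE.
- by rewrite /seg lE.
by rewrite eE.
Qed.

(** A lift of [p] is determined away from the contracted pair, and on the pair it
    is right once the edges are distributed over the two vertices in the same
    way.  The second hypothesis says that omitting [h] and omitting [w] shift the
    segment vertices alike. *)
Lemma lift_relabP N e (K H : graph m N.+1 e) (h w : 'I_N.+1) (i v : 'I_N) (p : 'S_N) t :
  p i = v ->
  (forall y z, seg K (lift h y) -> seg H (lift w z) ->
     lift w z = lift h y <-> z = y) ->
  relabeling K H (lift_perm h w p) t <->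
  [/\ relabeling (contract K h i) (contract H w v) p t,
      forall j, (w \in ends H (t j)) = (h \in ends K j),
      forall j, (lift w v \in ends H (t j)) = (lift h i \in ends K j)
    & loc H w = loc K h /\ (seg K h -> w = h)].
Proof.
move=> pi fx; split=> [/relabP[hl hs he]|[/relabP[hl hs he] h1 h2 [h3 h4]]].
  have E1 j : (w \in ends H (t j)) = (h \in ends K j).
    by rewrite -he lift_perm_id.
  have E2 j y : (lift w (p y) \in ends H (t j)) = (lift h y \in ends K j).
    by rewrite -he lift_perm_lift.
  split=> // [|j|].
  - apply/relabP; split=> [y|y|j y].
    + by rewrite !loc_contract -(lift_perm_lift h w) hl.
    + rewrite seg_contract => sy; apply/(fx _ _ sy).
        by rewrite -(lift_perm_lift h w) /seg hl.
      by rewrite -(lift_perm_lift h w) hs.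
    by rewrite !mem_contract E1 E2 -pi (inj_eq perm_inj).
  - by rewrite -pi E2.
  by rewrite -(lift_perm_id h w p) hl; split=> // /hs.
apply/relabP; split=> [x|x|j x].
- case: (unliftP h x) => [y ->|->]; last by rewrite lift_perm_id.
  by rewrite lift_perm_lift; have := hl y; rewrite !loc_contract.
- case: (unliftP h x) => [y ->|->]; last by rewrite lift_perm_id.
  move=> sy; rewrite lift_perm_lift; have sy' : seg (contract K h i) y by rewrite seg_contract.
  rewrite (hs y sy'); apply/fx => //.
  by rewrite -(seg_contract H w v) /seg -{1}(hs y sy') hl.
case: (unliftP h x) => [y ->|->]; last by rewrite lift_perm_id.
rewrite lift_perm_lift; have [->|yi] := eqVneq y i; first by rewrite pi.
by have := he j y; rewrite !mem_contract -pi (inj_eq perm_inj) (negPf yi).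
Qed.

Lemma sgn_ext N e (G G' H : graph m N e) q :
  (forall j, src G j = src G' j) -> (forall j, tgt G j = tgt G' j) ->
  (forall j, src G j = tgt G j -> loop_or G j = loop_or G' j) ->
  sgn G H q = sgn G' H q.
Proof.
move=> sE tE lE; rewrite /sgn /rel_sign; case: ifP => // _.
congr (_ ^+ (_ + #|pred_of_set _|)); apply/setP => j; rewrite !inE.
rewrite /same_orientation -sE -tE; case: eqP => // /lE ->; by [].
Qed.

End Lifting.

Section Split.
Variables (R : realType) (m n : nat).
Implicit Types d k N e : nat.
Local Notation isum := (isum R n).
Local Notation sgn := (sgn R n).

Section Def.
Variables (N e : nat) (G : graph m N e) (i : 'I_N) (h : 'I_N.+1) (l : option 'I_m)
  (A : {set 'I_e}).
Let K := split_vertex G i h l A.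
Let mv j x := if (j \in A) && (x == i) then h else lift h x.

Lemma src_split j : src K j = mv j (src G j).
Proof. by rewrite /src ffunE. Qed.
Lemma tgt_split j : tgt K j = mv j (tgt G j).
Proof. by rewrite /tgt ffunE. Qed.

Let mv_new j x : (h == mv j x) = (j \in A) && (x == i).
Proof. by rewrite /mv; case: ifP => _; rewrite ?eqxx // (negPf (neq_lift _ _)). Qed.

Let mv_old j x y : (lift h y == mv j x) = (y == x) && ~~ ((j \in A) && (x == i)).
Proof.
rewrite /mv; case: ifP => _; rewrite ?andbF ?andbT ?(inj_eq lift_inj) //.
by rewrite eq_sym (negPf (neq_lift _ _)).
Qed.

Lemma mem_split_new j : (h \in ends K j) = (j \in A) && (i \in ends G j).
Proof.
rewrite /ends !inE src_split tgt_split !mv_new -andb_orr.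
by rewrite (eq_sym i) (eq_sym i).
Qed.

Lemma mem_split_old j y :
  (lift h y \in ends K j) = (y \in ends G j) && ~~ ((j \in A) && (y == i)).
Proof.
rewrite /ends !inE src_split tgt_split !mv_old andb_orl.
by congr (_ || _); case: eqP => // ->.
Qed.

Lemma loc_split_new : loc K h = l.
Proof. by rewrite /loc ffunE unlift_none. Qed.

Lemma loc_split_old y : loc K (lift h y) = loc G y.
Proof. by rewrite /loc ffunE liftK. Qed.

Let mvK j x : merge_vertex h i (mv j x) = x.
Proof.
rewrite /mv; case: ifP => [/andP[_ /eqP ->]|_]; last exact: merge_lift.
exact: merge_id.
Qed.

Lemma src_contract_split j : src (contract K h i) j = src G j.
Proof. by rewrite /src ffunE /= -/(src K j) src_split mvK. Qed.
Lemma tgt_contract_split j : tgt (contract K h i) j = tgt G j.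
Proof. by rewrite /tgt ffunE /= -/(tgt K j) tgt_split mvK. Qed.

Lemma relab_contract_split (H : graph m N e) p t :
  relabeling (contract K h i) H p t = relabeling G H p t.
Proof.
apply: relab_ext => [y|j]; first by rewrite loc_contract loc_split_old.
by rewrite /ends src_contract_split tgt_contract_split.
Qed.

Lemma sgn_contract_split (H : graph m N e) q :
  sgn (contract K h i) H q = sgn G H q.
Proof.
apply: sgn_ext => j; rewrite ?src_contract_split ?tgt_contract_split // => E.
rewrite /loop_or ffunE /= src_split tgt_split E eqxx.
by rewrite /loop_or ffunE.
Qed.
End Def.
End Split.

(** * Relabelings of blown-up vertices *)

Section EdgeTerms.
Variables (R : realType) (m n : nat).
Implicit Types d k N e : nat.
Local Notation isum := (isum R n).
Local Notation sgn := (sgn R n).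
Local Notation eps_edge := (eps_edge R n).

Lemma relab_lift_edge N e (K H : graph m N e.+1) f f' q (t : 'S_e) :
  relabeling K H q (lift_perm f f' t) <->
  relabeling (del_edge K f) (del_edge H f') q t /\
  (forall x, (q x \in ends H f') = (x \in ends K f)).
Proof.
split=> [/relabP[h1 h2 h3]|[/relabP[h1 h2 h3] h4]].
  split; last by move=> x; have := h3 f x; rewrite lift_perm_id.
  apply/relabP; split=> // j x.
  by rewrite !ends_del_edge -h3 lift_perm_lift.
apply/relabP; split=> // j x; case: (unliftP f j) => [j' ->|->].
  by rewrite lift_perm_lift; have := h3 j' x; rewrite !ends_del_edge.
by rewrite lift_perm_id h4.
Qed.

Section BlowUp.
Variables (k N e : nat) (G : graph m N e) (i : 'I_N).
Local Notation K := (blow_up G i).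

Lemma ends_blow_up_new A : ends (K A) ord_max = [set lift ord_max i; ord_max].
Proof. by rewrite /ends /src /tgt !ffunE unlift_none. Qed.

Lemma src_blow_up_new A : src (K A) ord_max = lift ord_max i.
Proof. by rewrite /src !ffunE unlift_none. Qed.

Lemma tgt_blow_up_new A : tgt (K A) ord_max = ord_max.
Proof. by rewrite /tgt !ffunE unlift_none. Qed.

Lemma blow_up_kind A : is_free_edge (K A) ord_max || is_mixed (K A) ord_max.
Proof.
rewrite /is_free_edge /is_mixed src_blow_up_new tgt_blow_up_new.
rewrite eq_sym neq_lift /=; have -> : seg (K A) ord_max = false.
  exact: (congr1 (fun u => u != None) (loc_split_new G i ord_max None A)).
by case: seg.
Qed.

Lemma eps_blow_up A B : eps_edge (K A) ord_max = eps_edge (K B) ord_max.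
Proof. by rewrite /Defs.eps_edge !src_blow_up_new !tgt_blow_up_new. Qed.

(** Exchanging the two ends of the new edge turns [A] into its complement.  For
    [n] odd the transposition and the reversal of the new edge cancel. *)
Lemma blow_up_swap (A : {set 'I_e}) : A \subset star G i -> ~~ seg G i ->
  relabeling (K (star G i :\: A)) (K A) (tperm (lift ord_max i) ord_max) 1 /\
  sgn (K (star G i :\: A)) (K A) (tperm (lift ord_max i) ord_max, 1%g) = 1.
Proof.
move=> sA ni; set B := star G i :\: A; set u := tperm _ _.
have li : loc G i = None by move: ni; rewrite /seg negbK => /eqP.
have hi : ord_max != lift ord_max i :> 'I_N.+1 by apply: neq_lift.
have lo A' x : loc (K A') x = if unlift ord_max x is Some y then loc G y else None.
  by rewrite /loc ffunE.
have uy y : y != i -> u (lift ord_max y) = lift ord_max y.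
  move=> yi; rewrite tpermD ?neq_lift // (inj_eq lift_inj) eq_sym //.
have mB j : (j \in B) = (i \in ends G j) && (j \notin A).
  by rewrite in_setD andbC; congr andb; rewrite inE.
have srcE A' j : src (K A') (lift ord_max j) = src (split_vertex G i ord_max None A') j.
  by rewrite /src ffunE liftK.
have tgtE A' j : tgt (K A') (lift ord_max j) = tgt (split_vertex G i ord_max None A') j.
  by rewrite /tgt ffunE liftK.
split.
  apply/relabP; split=> [x|x|j x].
  - case: (unliftP ord_max x) => [y ->|->]; last first.
      by rewrite /u tpermR !lo liftK unlift_none li.
    have [->|yi] := eqVneq y i; first by rewrite /u tpermL !lo liftK unlift_none li.
    by rewrite uy // !lo.
  - case: (unliftP ord_max x) => [y ->|->]; last by rewrite /seg lo unlift_none.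
    have [->|yi _] := eqVneq y i; first by rewrite /seg lo liftK li.
    exact: uy.
  rewrite perm1; case: (unliftP ord_max j) => [j' ->|->]; last first.
    rewrite !ends_blow_up_new; case: (unliftP ord_max x) => [y ->|->]; last first.
      by rewrite /u tpermR !inE !eqxx !orbT.
    have [->|yi] := eqVneq y i; last by rewrite uy.
    by rewrite /u tpermL !inE !eqxx !orbT.
  rewrite /ends !srcE !tgtE -/(ends (split_vertex G i ord_max None A) j').
  rewrite -/(ends (split_vertex G i ord_max None B) j').
  case: (unliftP ord_max x) => [y ->|->].
    have [->|yi] := eqVneq y i; last first.
      by rewrite uy // !mem_split_old (negPf yi) !andbF.
    rewrite /u tpermL mem_split_new mem_split_old eqxx andbT mB andbC.
    by case: (i \in ends G j'); rewrite //= negbK.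
  rewrite /u tpermR mem_split_new mem_split_old eqxx andbT mB.
  by case: (i \in ends G j'); rewrite //= andbT.
rewrite /sgn /rel_sign; case: ifP => on; last by rewrite odd_perm1.
apply: etrans (expr0 (-1)); apply: eq_sign; rewrite odd_tperm eq_sym hi.
rewrite (card_lift ord_max) /same_orientation perm1 !src_blow_up_new tgt_blow_up_new.
rewrite [lift _ _ == _]eq_sym (negPf hi) /u tpermL eq_sym (negPf hi) /=.
set D := [set _ | _]; suff -> : D = set0 by rewrite cards0.
apply/setP => j; rewrite !inE perm1 !srcE tgtE; apply/negbTE; rewrite negbK.
case: ifP => [_|]; first by rewrite /loop_or !ffunE liftK /= !ffunE.
rewrite !src_split tgt_split => st; apply/eqP.
have [E|si] := eqVneq (src G j) i; last by rewrite !andbF -/u uy.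
have ji : i \in ends G j by rewrite -E; case: (mem_ends G j).
rewrite !andbT mB ji /= E; case: (j \in A); first by rewrite /u tpermL.
by rewrite /u tpermR.
Qed.
Variables (H : graph m N.+1 e.+1) (i0 : 'I_e.+1) (w : 'I_N.+1) (v : 'I_N).
Hypotheses (hH : in_LD 0 k H) (mH : ~~ multi_edge H).
Hypotheses (ki : is_free_edge H i0 || is_mixed H i0) (vw : (v < w)%N).
Hypothesis (Ei : ends H i0 = [set lift w v; w]).
Let H' := del_edge H i0.
Let C := contract H' w v.
Let lH : link_diagram H. Proof. by case/and3P: hH. Qed.
Let nw : ~~ seg H w. Proof. exact: contracted_free lH ki vw Ei. Qed.

(** The edges at the four-valent vertex that a relabeling with edge permutation
    [t] attaches to the upper end [w] of the contracted edge. *)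
Definition upper (t : 'S_e) : {set 'I_e} := [set j | w \in ends (del_edge H i0) (t j)].

Lemma in_upper t j : (j \in upper t) = (w \in ends H' (t j)).
Proof. exact: in_set. Qed.

Let fixE l A (y z : 'I_N) : seg (split_vertex G i ord_max l A) (lift ord_max y) ->
  seg H' (lift w z) -> lift w z = lift ord_max y <-> z = y.
Proof.
move=> _ sz; have zw : (z < w)%N by rewrite -(lift_lt w); apply: free_below lH nw sz.
have E : lift w z = z :> nat by apply: lift_below.
have E' : lift ord_max y = y :> nat by apply: lift_below; apply: ltn_ord.
split=> [Eq|zy]; apply: ord_inj; first by rewrite -E -E' Eq.
by rewrite E E' zy.
Qed.

Let excl j : w \in ends H' j -> lift w v \in ends H' j -> False.
Proof.
move=> h1 h2; have := del_edge_neq i0 j hH mH; rewrite -/H'.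
have [E|->] := ends2 h2 h1; last by rewrite Ei eqxx.
by move: (neq_lift w v); rewrite E eqxx.
Qed.

(** Once the new edge is sent to [i0] and the new vertex to [w], a relabeling of
    the blow-up amounts to one of the contraction, and [A] can be read off from
    it. *)
Lemma blow_up_relabP (A : {set 'I_e}) p t : A \subset star G i ->
  relabeling (K A) H (lift_perm ord_max w p) (lift_perm ord_max i0 t) <->
  [/\ relabeling G C p t, p i = v & upper t = A].
Proof.
move=> sA; rewrite relab_lift_edge del_add_edge.
have q_pi : (forall x, (lift_perm ord_max w p x \in ends H i0) =
    (x \in ends (K A) ord_max)) <-> p i = v.
  rewrite Ei ends_blow_up_new; split=> [/(_ (lift ord_max i))|pi x].
    rewrite lift_perm_lift !inE eqxx (inj_eq lift_inj) [_ == w]eq_sym.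
    by rewrite (negPf (neq_lift _ _)) orbF => /eqP.
  case: (unliftP ord_max x) => [y ->|->]; last first.
    by rewrite lift_perm_id !inE !eqxx !orbT.
  rewrite lift_perm_lift !inE !(inj_eq lift_inj) -pi (inj_eq perm_inj).
  by congr orb; rewrite [LHS]eq_sym [RHS]eq_sym !(negPf (neq_lift _ _)).
have mA j : (j \in A) && (i \in ends G j) = (j \in A).
  by case jA: (j \in A) => //; have := subsetP sA j jA; rewrite inE => ->.
split=> [[r /q_pi pi]|[r pi uE]].
  have [rC h1 h2 _] := (lift_relabP t pi (fixE (l := None) (A := A))).1 r.
  split=> //; first by rewrite -(relab_contract_split G i ord_max None A).
  by apply/setP => j; rewrite in_upper h1 mem_split_new mA.
split; last exact/q_pi.
apply/(lift_relabP t pi (fixE (l := None) (A := A))); split.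
- by rewrite relab_contract_split.
- by move=> j; rewrite mem_split_new mA -uE in_upper.
- move=> j; rewrite mem_split_old eqxx andbT -uE in_upper.
  have [_ _ /(_ j i)] := (relabP _ _ _ _).1 r; rewrite pi mem_contract eqxx /= => <-.
  by have := @excl (t j); case: (w \in _); case: (lift w v \in _) => // /(_ isT isT).
rewrite loc_split_new /seg loc_split_new; split=> //.
by move: nw; rewrite /seg negbK => /eqP.
Qed.

(** Inserting [ord_max] and [w] changes the parity of the vertex permutation, and
    inserting [ord_max] and [i0] that of the edge permutation, by the parities
    of these positions: this is what [eps_edge] records. *)
Lemma blow_up_sgn (A : {set 'I_e}) p t : A \subset star G i ->
  relabeling (K A) H (lift_perm ord_max w p) (lift_perm ord_max i0 t) ->
  eps_edge (K A) ord_max * sgn (K A) H (lift_perm ord_max w p, lift_perm ord_max i0 t) =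
  eps_edge H i0 * sgn G C (p, t).
Proof.
move=> sA r; have [rC pi _] := (blow_up_relabP p t sA).1 r.
have [rS eq_new] := (relab_lift_edge _ _ _ _ _ _).1 r.
rewrite del_add_edge in rS.
rewrite -(sgn_contract_split R n G i ord_max None A).
set S := split_vertex G i ord_max None A in rS *.
set q := lift_perm ord_max w p in r rS eq_new *.
have oq : odd_perm q = odd N (+) odd w (+) odd_perm p by rewrite /q odd_lift_perm.
have ot : odd_perm (lift_perm ord_max i0 t) = odd e (+) odd i0 (+) odd_perm t.
  by rewrite odd_lift_perm.
have smE x : merge_vertex w v (q x) = p (merge_vertex ord_max i x).
  case: (unliftP ord_max x) => [y ->|->]; first by rewrite /q lift_perm_lift !merge_lift.
  by rewrite /q lift_perm_id !merge_id pi.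
rewrite /sgn /rel_sign /=; case: ifP => on; last first.
  rewrite /Defs.eps_edge on -!exprD (relab_nfree r); apply: eq_sign.
  rewrite ot !oddD !oddb /=; case: (odd i0); case: (odd e);
    by case: (odd (nfree _)); case: (odd_perm t).
rewrite (@eps_edge_odd R m n N.+1 e.+1 (K A) ord_max ord_max i on (ltn_ord i) (ends_blow_up_new A)).
rewrite (eps_edge_odd R on vw Ei) -!exprD; apply: eq_sign.
rewrite src_blow_up_new [lift _ _ == _]eq_sym (negPf (neq_lift _ _)).
rewrite (card_lift ord_max).
have -> : #|[set j | ~~ same_orientation (contract S ord_max i) C p t j]| =
   #|[set j | ~~ same_orientation (K A) H q (lift_perm ord_max i0 t) (lift ord_max j)]|.
  apply: eq_card => j; rewrite !inE.
  rewrite (same_or_contract rS smE).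
    rewrite /same_orientation lift_perm_lift.
    by rewrite /src /tgt /loop_or !ffunE liftK /= ?ffunE.
  rewrite !src_split !tgt_split => st.
  have mK x : merge_vertex ord_max i (if (j \in A) && (x == i) then ord_max else lift ord_max x) = x.
    by case: ifP => [/andP[_ /eqP ->]|_]; rewrite ?merge_id ?merge_lift.
  by rewrite !mK => E; rewrite E eqxx in st.
have -> : same_orientation (K A) H q (lift_perm ord_max i0 t) ord_max = (src H i0 != w).
  rewrite /same_orientation lift_perm_id src_blow_up_new tgt_blow_up_new.
  rewrite [lift _ _ == _]eq_sym (negPf (neq_lift _ _)) /q lift_perm_lift pi.
  have [+ _] := mem_ends H i0; rewrite Ei !inE => /orP[]/eqP ->; rewrite !eqxx.
    by rewrite [_ == w]eq_sym neq_lift.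
  by rewrite (negPf (neq_lift _ _)).
rewrite !oddD !oddb oq /= negbK; set D := odd #|_|.
by case: (odd w); case: (odd N); case: (odd_perm p); case: (src H i0 == w); case: D.
Qed.

End BlowUp.
End EdgeTerms.

(** * The edge part of the differential *)

Section EdgeSum.
Variables (R : realType) (m n : nat).
Implicit Types d k N e : nat.
Local Notation isum := (isum R n).
Local Notation sgn := (sgn R n).
Local Notation eps_edge := (eps_edge R n).

Lemma sum_reindex (I J : finType) (f : I -> J) (P Q : pred J) (F : J -> R) :
  injective f -> (forall y, Q y <-> exists x, y = f x) ->
  \sum_(y | P y && Q y) F y = \sum_(x | P (f x)) F (f x).
Proof.
move=> fI QE; rewrite -[RHS]big_set -(big_imset _ (h := f)) => [|x x' _ _]; last exact: fI.
rewrite -[LHS]big_set; apply: eq_bigl => y; rewrite inE; apply/andP/imsetP.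
  by case=> Py /QE[x E]; exists x; rewrite // inE -E.
by case=> x; rewrite inE => Px ->; split=> //; apply/QE; exists x.
Qed.

Lemma lift_perm_inj N (h w : 'I_N.+1) : injective (lift_perm h w).
Proof.
move=> p p' E; apply/permP => x; apply: (@lift_inj _ w).
by rewrite -!(lift_perm_lift h w) E.
Qed.

Lemma lift_perm_ex N (h w : 'I_N.+1) (q : 'S_N.+1) :
  q h = w <-> exists p, q = lift_perm h w p.
Proof.
split=> [qh|[p ->]]; last by rewrite lift_perm_id.
have [p [pE _]] := lift_permE qh; exists p; apply/permP => x.
by case: (unliftP h x) => [y ->|->]; rewrite ?lift_perm_lift ?pE // lift_perm_id.
Qed.

Section OneGraph.
Variables (k N e : nat) (G : graph m N e) (i : 'I_N) (H : graph m N.+1 e.+1).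
Hypotheses (hH : in_LD 0 k H) (mH : ~~ multi_edge H).
Local Notation K := (blow_up G i).

(** The signed relabelings onto the contraction of [i0] that lift to the blow-up
    along [B]. *)
Definition edge_part i0 (w : 'I_N.+1) (v : 'I_N) (B : {set 'I_e}) : R :=
  \sum_(u | [&& relabeling G (contract (del_edge H i0) w v) u.1 u.2,
               u.1 i == v & upper H i0 w u.2 == B])
    sgn G (contract (del_edge H i0) w v) u.

Section OneEdge.
Variables (i0 : 'I_e.+1) (w : 'I_N.+1) (v : 'I_N).
Hypotheses (ki : is_free_edge H i0 || is_mixed H i0) (vw : (v < w)%N).
Hypothesis (Ei : ends H i0 = [set lift w v; w]).

Let part (A : {set 'I_e}) : A \subset star G i ->
  eps_edge (K A) ord_max * (\sum_(u | [&& relabeling (K A) H u.1 u.2,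
     u.2 ord_max == i0 & u.1 ord_max == w]) sgn (K A) H u) =
  eps_edge H i0 * edge_part i0 w v A.
Proof.
move=> sA; pose f (u : 'S_N * 'S_e) := (lift_perm ord_max w u.1, lift_perm ord_max i0 u.2).
have fI : injective f.
  by move=> [p t] [p' t'] [/lift_perm_inj -> /lift_perm_inj ->].
have fE (y : 'S_N.+1 * 'S_e.+1) : (y.2 ord_max == i0) && (y.1 ord_max == w) <-> exists x, y = f x.
  case: y => q t; split=> [/andP[/eqP/lift_perm_ex[t' /= ->] /eqP/lift_perm_ex[q' /= ->]]|].
    by exists (q', t').
  by case=> -[p' t'] [-> ->] /=; rewrite !lift_perm_id !eqxx.
rewrite (sum_reindex (fun u : 'S_N.+1 * 'S_e.+1 => relabeling (K A) H u.1 u.2) _ fI fE) !mulr_sumr.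
apply: eq_big => [[p t]|[p t] r] /=; last exact: (blow_up_sgn R n hH mH ki vw Ei sA r).
apply/idP/idP => [/(blow_up_relabP hH mH ki vw Ei p t sA)[-> -> ->]|]; first by rewrite !eqxx.
case/and3P => h1 /eqP h2 /eqP h3.
by apply/(blow_up_relabP hH mH ki vw Ei p t sA).
Qed.

(** The new vertex is sent to one of the two ends of [i0].  If it is sent to the
    lower one, exchanging the ends of the new edge leads back to the other case,
    for the complementary set; this requires both ends to be free. *)
Lemma edge_terms (A : {set 'I_e}) : A \subset star G i ->
  eps_edge (K A) ord_max *
    (\sum_(u | relabeling (K A) H u.1 u.2 && (u.2 ord_max == i0)) sgn (K A) H u) =
  eps_edge H i0 * (edge_part i0 w v A +
                   if seg G i then 0 else edge_part i0 w v (star G i :\: A)).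
Proof.
move=> sA; rewrite (bigID (fun u : 'S_N.+1 * 'S_e.+1 => u.1 ord_max == w)) /= mulrDr mulrDr.
congr (_ + _).
  by rewrite -(part sA); congr (_ * _); apply: eq_bigl => u; rewrite andbA.
have other B q t : relabeling (K B) H q t -> t ord_max = i0 -> q ord_max != w ->
    q (lift ord_max i) = w /\ q ord_max = lift w v.
  move=> /relabP[_ _ h] ti qw; have := h ord_max ord_max; have := h ord_max (lift ord_max i).
  rewrite ti Ei ends_blow_up_new !inE !eqxx orbT (negPf qw) orbF => + /eqP qv.
  rewrite -qv (inj_eq perm_inj) [lift _ _ == _]eq_sym (negPf (neq_lift _ _)).
  by move/eqP.
have lH : link_diagram H by case/and3P: hH.
have nw := contracted_free lH ki vw Ei.
case: ifP => sG.
  rewrite big1 ?mulr0 // => u /andP[/andP[r /eqP ti]] qw.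
  have [E _] := other _ _ _ r ti qw; move: nw; rewrite -E.
  rewrite (relab_seg _ r) => /negP[]; rewrite /seg.
  by have := loc_split_old G i ord_max None A i; rewrite /loc => ->.
have sB : star G i :\: A \subset star G i by apply: subsetDl.
rewrite -(part sB) (eps_blow_up R n G i (star G i :\: A) A); congr (_ * _).
have [rs ss] := blow_up_swap R n sA (negbT sG).
set u0 := tperm _ _ in rs ss.
have u0K : (u0 * u0 = 1)%g by apply: tperm2.
pose f (u : 'S_N.+1 * 'S_e.+1) := ((u0 * u.1)%g, u.2).
have fI : injective f by move=> [a b] [a' b'] [/mulgI -> ->].
have rE q t : relabeling (K A) H (u0 * q) t = relabeling (K (star G i :\: A)) H q t.
  apply/idP/idP => r.
    by have := relab_comp rs r; rewrite mulgA u0K !mul1g.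
  by have := relab_comp (relab_inv rs) r; rewrite tpermV invg1 mul1g.
rewrite (reindex_inj fI) /=; apply: eq_big => [[q t]|[q t] /andP[/andP[r _] _]] /=.
  rewrite rE -andbA; case r: relabeling => //=; case: eqP => //= ti.
  rewrite permM /u0 tpermR; apply/idP/idP => [|/eqP <-].
    by apply: contraNT => /(other _ _ _ r ti)[-> _].
  by rewrite (inj_eq perm_inj) eq_sym neq_lift.
have := sgn_comp R n (q := (u0, 1%g)) (r := ((u0 * q)%g, t)) rs r.
by rewrite /= mulgA u0K !mul1g ss mul1r => ->.
Qed.

End OneEdge.
(** The relabelings onto [H] are sorted by the image of the new edge. *)
Lemma isum_blow_up (A : {set 'I_e}) : A \subset star G i ->
  eps_edge (K A) ord_max * isum (K A) H =
  \sum_(i0 | is_free_edge H i0 || is_mixed H i0)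
    \sum_(w : 'I_N.+1) \sum_(v : 'I_N | (v < w)%N && (ends H i0 == [set lift w v; w]))
      eps_edge H i0 * (edge_part i0 w v A +
                   if seg G i then 0 else edge_part i0 w v (star G i :\: A)).
Proof.
move=> sA; rewrite isumE mulr_sumr.
rewrite (partition_big (fun u : 'S_N.+1 * 'S_e.+1 => u.2 ord_max)
   (fun i0 => is_free_edge H i0 || is_mixed H i0)) /=; last first.
  by move=> [q t] /= r; rewrite (relab_kind _ r) blow_up_kind.
apply: eq_bigr => i0 ki; rewrite -mulr_sumr.
have [w [v [vw Ei]]] := ends_ordered (kind_src_tgt ki).
have := edge_sum (fun w' v' => eps_edge H i0 * (edge_part i0 w' v' A +
   if seg G i then 0 else edge_part i0 w' v' (star G i :\: A)) : R^o) vw Ei.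
by move=> /= ->; rewrite -(edge_terms ki vw Ei sA).
Qed.

(** The edge part of the differential of [H], paired with [G]. *)
Definition edge_delta : R :=
  \sum_(i0 | is_free_edge H i0 || is_mixed H i0)
    \sum_(w : 'I_N.+1) \sum_(v : 'I_N | (v < w)%N && (ends H i0 == [set lift w v; w]))
      eps_edge H i0 * isum G (contract (del_edge H i0) w v).

(** The second hypothesis says that every relabeling onto a contraction lifts to
    exactly one of the blow-ups along the sets [As]. *)
Lemma edge_delta_blow_up (As : seq {set 'I_e}) :
  (forall A, A \in As -> A \subset star G i) ->
  (forall i0 (w : 'I_N.+1) (v : 'I_N) p t,
     is_free_edge H i0 || is_mixed H i0 -> (v < w)%N ->
     ends H i0 = [set lift w v; w] ->
     relabeling G (contract (del_edge H i0) w v) p t ->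
     p i = v /\ (\sum_(A <- As) ((upper H i0 w t == A) +
       (~~ seg G i && (upper H i0 w t == star G i :\: A))) = 1)%N) ->
  edge_delta = \sum_(A <- As) eps_edge (K A) ord_max * isum (K A) H.
Proof.
move=> sAs one; rewrite big_seq (eq_bigr _ (fun A hA => isum_blow_up (sAs A hA))).
rewrite -big_seq exchange_big; apply: eq_bigr => i0 ki /=.
rewrite exchange_big; apply: eq_bigr => w _ /=.
rewrite exchange_big; apply: eq_bigr => v /andP[vw /eqP Ei] /=.
rewrite -mulr_sumr; congr (_ * _); rewrite isumE.
transitivity (\sum_(u | relabeling G (contract (del_edge H i0) w v) u.1 u.2)
  \sum_(A <- As) (((upper H i0 w u.2 == A)%:R +
       (~~ seg G i && (upper H i0 w u.2 == star G i :\: A))%:R) *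
   sgn G (contract (del_edge H i0) w v) u)).
  apply: eq_bigr => -[p t] /= r; rewrite -mulr_suml.
  have [_ E] := one _ _ _ _ _ ki vw Ei r.
  have -> : \sum_(A <- As) ((upper H i0 w t == A)%:R +
       (~~ seg G i && (upper H i0 w t == star G i :\: A))%:R) = 1 :> R.
    by rewrite -[RHS]/(1%:R) -E natr_sum; apply: eq_bigr => A _; rewrite natrD.
  by rewrite mul1r.
rewrite exchange_big; apply: eq_bigr => A _ /=.
have partE B : edge_part i0 w v B =
   \sum_(u | relabeling G (contract (del_edge H i0) w v) u.1 u.2)
     (upper H i0 w u.2 == B)%:R * sgn G (contract (del_edge H i0) w v) u.
  rewrite /edge_part big_mkcond [RHS]big_mkcond; apply: eq_bigr => -[p t] _ /=.
  case r: relabeling => //=; have [-> _] := one _ _ _ _ _ ki vw Ei r.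
  by rewrite eqxx; case: eqP; rewrite ?mul1r ?mul0r.
rewrite !partE; case: (seg G i) => /=.
  by rewrite addr0; apply: eq_bigr => u _; rewrite addr0.
by rewrite -big_split; apply: eq_bigr => u _; rewrite mulrDl.
Qed.

End OneGraph.
End EdgeSum.

(** * The arc part of the differential *)

Section ArcSum.
Variables (R : realType) (m n : nat).
Implicit Types d k N e : nat.
Local Notation isum := (isum R n).
Local Notation sgn := (sgn R n).
Local Notation eps_arc := (eps_arc R).

Section OneGraph.
Variables (N e : nat) (G : graph m N e) (h : 'I_N.+1) (i : 'I_N) (H : graph m N.+1 e).

(** The condition for a relabeling of the contractions with edge permutation [t]
    to lift. *)
Definition arc_match (K : graph m N.+1 e) (t : 'S_e) : bool :=
  [forall j, ((h \in ends H (t j)) == (h \in ends K j)) &&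
             ((lift h i \in ends H (t j)) == (lift h i \in ends K j))].

Lemma relab_arc (K : graph m N.+1 e) q t : relabeling K H q t ->
  is_arc K (lift h i) h -> q h = h /\ is_arc H (lift h i) h.
Proof.
move=> r /and3P[sv /eqP lE vE]; have sh : seg K h by rewrite /seg -lE.
split; first exact: relab_fix r sh.
by rewrite /is_arc (relab_segE _ r) sv !(relab_locE _ r) lE eqxx.
Qed.

Lemma arc_relabP (K : graph m N.+1 e) p t :
  is_arc K (lift h i) h -> is_arc H (lift h i) h ->
  relabeling K H (lift_perm h h p) t =
  relabeling (contract K h i) (contract H h i) p t && arc_match K t.
Proof.
move=> aK aH; have [sv /eqP lE vE] := and3P aK; have [svH /eqP lEH _] := and3P aH.
have fx (y z : 'I_N) : seg K (lift h y) -> seg H (lift h z) -> lift h z = lift h y <-> z = y.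
  by move=> _ _; split=> [/lift_inj|->].
apply/idP/andP => [r|[r /forallP mt]].
  have pi : p i = i.
    by apply: (@lift_inj _ h); rewrite -(lift_perm_lift h h) (relab_fix r).
  have [r' h1 h2 _] := (lift_relabP t pi fx).1 r; split=> //.
  by apply/forallP => j; rewrite h1 h2 !eqxx.
have pi : p i = i by apply: (relab_fix r); rewrite seg_contract.
apply/(lift_relabP t pi fx); split=> // [j|j|].
- by have /andP[/eqP ->] := mt j.
- by have /andP[_ /eqP ->] := mt j.
split=> //; rewrite -lE -lEH.
by have := relab_loc i r; rewrite pi !loc_contract.
Qed.

Lemma arc_sgn (K : graph m N.+1 e) p t :
  is_arc K (lift h i) h -> is_arc H (lift h i) h ->
  relabeling K H (lift_perm h h p) t ->
  sgn K H (lift_perm h h p, t) = sgn (contract K h i) (contract H h i) (p, t).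
Proof.
move=> aK aH r; have [sv /eqP lE vE] := and3P aK.
have sh : seg K h by rewrite /seg -lE.
have /andP[rC _] : relabeling (contract K h i) (contract H h i) p t && arc_match K t.
  by rewrite -arc_relabP.
have pi : p i = i by apply: (relab_fix rC); rewrite seg_contract.
have smE x : merge_vertex h i (lift_perm h h p x) = p (merge_vertex h i x).
  case: (unliftP h x) => [y ->|->]; first by rewrite lift_perm_lift !merge_lift.
  by rewrite lift_perm_id !merge_id pi.
apply: eq_sign; rewrite /rel_sign; case: ifP => // on.
rewrite !oddD !oddb /= odd_lift_perm addbb /=; congr (_ (+) odd #|pred_of_set _|).
apply/setP => j; rewrite !inE (same_or_contract r smE) // => st mm.
have E := merge_eq st mm.
have fixed x : x \in [set lift h i; h] -> lift_perm h h p x = x.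
  by rewrite !inE => /orP[]/eqP ->; rewrite ?(relab_fix r).
by split; apply: fixed; rewrite -E !inE eqxx ?orbT.
Qed.

Lemma isum_arc (K : graph m N.+1 e) : is_arc K (lift h i) h ->
  isum K H = if is_arc H (lift h i) h then
    \sum_(u | relabeling (contract K h i) (contract H h i) u.1 u.2 && arc_match K u.2)
      sgn (contract K h i) (contract H h i) u else 0.
Proof.
move=> aK; rewrite isumE; case: ifPn => aH; last first.
  by rewrite big1 // => -[q t] r; have [_ ar] := relab_arc r aK; rewrite ar in aH.
pose f (u : 'S_N * 'S_e) := (lift_perm h h u.1, u.2).
have fI : injective f by move=> [p t] [p' t'] [/lift_perm_inj -> ->].
have fE (y : 'S_N.+1 * 'S_e) : (y.1 h == h) <-> exists x, y = f x.
  case: y => q t; split=> [/eqP/lift_perm_ex[q' /= ->]|[[q' t'] [-> _]]].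
    by exists (q', t).
  by rewrite /= lift_perm_id.
transitivity (\sum_(u : 'S_N.+1 * 'S_e | relabeling K H u.1 u.2 && (u.1 h == h)) sgn K H u).
  apply: eq_bigl => -[q t] /=; case r: relabeling => //.
  by have [-> _] := relab_arc r aK; rewrite eqxx.
rewrite (sum_reindex (fun u : 'S_N.+1 * 'S_e => relabeling K H u.1 u.2) _ fI fE).
apply: eq_big => [[p t]|[p t] r] /=; first exact: arc_relabP.
exact: arc_sgn.
Qed.

(** The arc part of the differential of [H], paired with [G]. *)
Definition arc_delta : R :=
  \sum_(w : 'I_N.+1) \sum_(v : 'I_N | (v < w)%N && is_arc H (lift w v) w)
    eps_arc w * isum G (contract H w v).

(** The analogue of [edge_delta_blow_up]: every relabeling onto the contraction
    of an arc lifts to exactly one of the diagrams [Ks].  As segment vertices are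
    fixed, the arc is the one that ends in [h]. *)
Lemma arc_delta_double (Ks : seq (graph m N.+1 e)) : (i < h)%N ->
  (forall K, K \in Ks -> [/\ is_arc K (lift h i) h,
     forall X p t, relabeling (contract K h i) X p t = relabeling G X p t
     & forall X u, sgn (contract K h i) X u = sgn G X u]) ->
  (forall (w : 'I_N.+1) (v : 'I_N) p t, (v < w)%N -> is_arc H (lift w v) w ->
     relabeling G (contract H w v) p t ->
     [/\ w = h, v = i & (\sum_(K <- Ks) arc_match K t = 1)%N]) ->
  arc_delta = \sum_(K <- Ks) eps_arc h * isum K H.
Proof.
move=> ih hK one; have zero (w : 'I_N.+1) (v : 'I_N) : (v < w)%N ->
    is_arc H (lift w v) w -> (w != h) || (v != i) -> isum G (contract H w v) = 0.
  move=> vw a ne; rewrite isumE big1 // => -[p t] /= r.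
  by have [E1 E2 _] := one _ _ _ _ vw a r; rewrite E1 E2 !eqxx in ne.
rewrite /arc_delta (bigD1 h) //= [X in _ + X]big1 ?addr0 => [|w wh]; last first.
  by apply: big1 => v /andP[vw a]; rewrite zero ?wh ?mulr0.
rewrite big_mkcond (bigD1 i) //= [X in _ + X]big1 ?addr0 => [|v vi]; last first.
  by case: ifP => // /andP[vw a]; rewrite zero ?vi ?orbT ?mulr0.
rewrite ih /= -mulr_sumr; case: ifPn => a; last first.
  rewrite big_seq big1 ?mulr0 // => K /hK[aK _ _].
  by rewrite (isum_arc aK) (negPf a).
congr (_ * _); rewrite isumE.
transitivity (\sum_(u | relabeling G (contract H h i) u.1 u.2)
    \sum_(K <- Ks) (arc_match K u.2)%:R * sgn G (contract H h i) u).
  apply: eq_bigr => -[p t] /= r; rewrite -mulr_suml.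
  have [_ _ E] := one _ _ _ _ ih a r.
  have -> : \sum_(K <- Ks) (arc_match K t)%:R = 1 :> R.
    by rewrite -[RHS]/(1%:R) -E natr_sum.
  by rewrite mul1r.
rewrite exchange_big big_seq [RHS]big_seq; apply: eq_bigr => K /hK[aK rE sE] /=.
rewrite (isum_arc aK) a big_mkcond [RHS]big_mkcond; apply: eq_bigr => -[p t] _ /=.
by rewrite rE sE; case: relabeling => //=; case: arc_match; rewrite ?mul1r ?mul0r.
Qed.

End OneGraph.
End ArcSum.

(** * The adjoint of the differential *)

Section Adjunction.
Variables (R : realType) (m n k : nat).
Implicit Types d N e : nat.
Local Notation isum := (isum R n).
Local Notation sgn := (sgn R n).
Local Notation eps_arc := (eps_arc R).
Local Notation eps_edge := (eps_edge R n).
Local Notation delta := (delta R m n 0 k).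

Lemma pairing_delta_gens (x : LD R m n 1 k) (y : LD R m n 0 k) :
  (forall N e (H : graph m N e), in_LD 0 k H -> ~~ multi_edge H ->
     pairing x (delta (cls R n 0 k H)) = pairing y (cls R n 0 k H)) ->
  forall a, pairing x (delta a) = pairing y a.
Proof.
move=> h a; rewrite (LD_expand a) linear_sum !pairing_sumr; apply: eq_bigr => g _.
rewrite linearZ /= !pairingZr; congr (_ * _).
have [mg|mg] := boolP (multi_edge (gen_graph g)); last exact: h (in_LD_gen g) mg.
by rewrite (cls_multi _ _ _ _ mg) linear0 !pairing0r.
Qed.

Lemma pairing_delta_diag N e (G : graph m N e) N1 e1 (H : graph m N1 e1) :
  in_LD 1 k G -> ~~ multi_edge G -> in_LD 0 k H -> ~~ multi_edge H ->
  pairing (cls R n 1 k G) (delta (cls R n 0 k H)) =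
    \sum_(i | is_free_edge H i || is_mixed H i)
      \sum_(w : 'I_N1) \sum_(v : 'I_N1.-1 | (v < w)%N && (ends H i == [set lift w v; w]))
        eps_edge H i * isum G (contract (del_edge H i) w v)
  + \sum_(w : 'I_N1) \sum_(v : 'I_N1.-1 | (v < w)%N && is_arc H (lift w v) w)
      eps_arc w * isum G (contract H w v).
Proof.
move=> hG mG hH mH; rewrite delta_cls // /delta_diag (negPf mH) pairingDr.
have term N2 e2 (C : graph m N2 e2) a :
    pairing (cls R n 1 k G) (a *: cls R n 1 k C) = a * isum G C.
  by rewrite pairingZr pairing_isum // hG mG.
congr (_ + _); apply: (etrans (pairing_sumr _ _ _ _)).
  apply: eq_bigr => i _; apply: (etrans (pairing_sumr _ _ _ _)); apply: eq_bigr => w _.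
  by apply: (etrans (pairing_sumr _ _ _ _)); apply: eq_bigr => v _; apply: term.
apply: eq_bigr => w _; apply: (etrans (pairing_sumr _ _ _ _)); apply: eq_bigr => v _.
exact: term.
Qed.

(** Resolutions by an edge and by an arc have different numbers of edges, so for
    a given [H] at most one of the two parts of the differential pairs with [G],
    and it is matched by the resolutions of the same kind. *)
Lemma adjunction N e (G : graph m N e) (i : 'I_N) (h : 'I_N.+1)
    (As : seq {set 'I_e}) (Ks : seq (graph m N.+1 e)) :
  in_LD 1 k G -> ~~ multi_edge G -> (i < h)%N ->
  (forall A, A \in As -> A \subset star G i) ->
  (forall K, K \in Ks -> [/\ is_arc K (lift h i) h,
     forall X p t, relabeling (contract K h i) X p t = relabeling G X p t
     & forall X u, sgn (contract K h i) X u = sgn G X u]) ->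
  (forall (H : graph m N.+1 e.+1) i0 (w : 'I_N.+1) (v : 'I_N) p t,
     in_LD 0 k H -> ~~ multi_edge H ->
     is_free_edge H i0 || is_mixed H i0 -> (v < w)%N ->
     ends H i0 = [set lift w v; w] ->
     relabeling G (contract (del_edge H i0) w v) p t ->
     p i = v /\ (\sum_(A <- As) ((upper H i0 w t == A) +
       (~~ seg G i && (upper H i0 w t == star G i :\: A))) = 1)%N) ->
  (forall (H : graph m N.+1 e) (w : 'I_N.+1) (v : 'I_N) p t,
     in_LD 0 k H -> (v < w)%N -> is_arc H (lift w v) w ->
     relabeling G (contract H w v) p t ->
     [/\ w = h, v = i & (\sum_(K <- Ks) arc_match h i H K t = 1)%N]) ->
  forall a, pairing (cls R n 1 k G) (delta a) =
    \sum_(A <- As) eps_edge (blow_up G i A) ord_max *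
       pairing (cls R n 0 k (blow_up G i A)) a +
    \sum_(K <- Ks) eps_arc h * pairing (cls R n 0 k K) a.
Proof.
move=> hG mG ih sAs hKs oneE oneA a.
pose y : LD R m n 0 k := \sum_(A <- As) eps_edge (blow_up G i A) ord_max *:
  cls R n 0 k (blow_up G i A) + \sum_(K <- Ks) eps_arc h *: cls R n 0 k K.
have yE b : pairing y b = \sum_(A <- As) eps_edge (blow_up G i A) ord_max *
       pairing (cls R n 0 k (blow_up G i A)) b +
    \sum_(K <- Ks) eps_arc h * pairing (cls R n 0 k K) b.
  rewrite pairingDl; congr (_ + _).
    rewrite (big_morph (fun z => pairing z b) (id1 := 0) (op1 := +%R)) => [|z z'|].
    - by apply: eq_bigr => A _; rewrite pairingZl.
    - exact: pairingDl.
    exact: pairing0l.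
  rewrite (big_morph (fun z => pairing z b) (id1 := 0) (op1 := +%R)) => [|z z'|].
  - by apply: eq_bigr => A _; rewrite pairingZl.
  - exact: pairingDl.
  exact: pairing0l.
rewrite -yE; apply: pairing_delta_gens => N1 e1 H hH mH.
rewrite yE pairing_delta_diag //.
have term N2 e2 (C : graph m N2 e2) :
    pairing (cls R n 0 k C) (cls R n 0 k H) = isum C H.
  by rewrite pairing_isum // hH mH orbT.
rewrite (eq_bigr _ (fun A _ => congr1 _ (term _ _ _))).
rewrite [in RHS](eq_bigr _ (fun A _ => congr1 _ (term _ _ _))).
have EN : N1 = N.+1 by have := in_LD_size hG; have := in_LD_size hH; lia.
subst N1.
have size0 N2 e2 (C : graph m N2 e2) N3 e3 (D : graph m N3 e3) :
    e3 != e2 -> isum C D = 0.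
  by move=> ne; apply/eqP; apply: contraNT ne => /isum_size[_ ->].
have [Ee|ne1] := eqVneq e1 e.+1.
  subst e1; rewrite -/(edge_delta R n G H) [X in _ + X]big1 ?addr0; last first.
    by move=> w _; apply: big1 => v _; rewrite size0 ?mulr0 //; lia.
  rewrite [X in _ = _ + X]big1 ?addr0; last first.
    by move=> K _; rewrite size0 ?mulr0 //; lia.
  apply: (edge_delta_blow_up R n hH mH sAs).
  by move=> i0 w v p t; apply: oneE.
rewrite [X in X + _]big1 ?add0r; last first.
  move=> i0 _; apply: big1 => w _; apply: big1 => v _.
  by rewrite size0 ?mulr0 //; have := ltn_ord i0; lia.
rewrite [X in _ = X + _]big1 ?add0r; last first.
  by move=> A _; rewrite size0 ?mulr0.
have [Ee|ne] := eqVneq e1 e.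
  subst e1; rewrite -/(arc_delta R n G H).
  by apply: (arc_delta_double ih hKs) => w v p t; apply: oneA.
rewrite big1 => [|w _]; last first.
  by apply: big1 => v _; rewrite size0 ?mulr0.
by rewrite big1 // => K _; rewrite size0 ?mulr0.
Qed.

End Adjunction.

(** * Resolutions of the three kinds of vertices *)

Section Resolutions.
Variables (R : realType) (m n k : nat).
Implicit Types d N e : nat.
Local Notation sgn := (sgn R n).
Local Notation eps_arc := (eps_arc R).
Local Notation eps_edge := (eps_edge R n).
Local Notation delta := (delta R m n 0 k).

Let ends_contr N e (G : graph m N.+1 e) (w : 'I_N.+1) (v : 'I_N) j :
  @ends m N e (contract G w v) j = merge_vertex w v @: ends G j.
Proof. exact: (@ends_contract m N.+1 e G w v j). Qed.

Section FourValent.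
Variables (N e : nat) (G : graph m N e) (i : 'I_N).
Hypothesis vi : valence G i = 4%N.

(** Apart from the merged vertex, contractions of trivalent diagrams are
    trivalent. *)
Lemma edge_image (H : graph m N.+1 e.+1) i0 (w : 'I_N.+1) (v : 'I_N) p t :
  in_LD 0 k H -> ends H i0 = [set lift w v; w] ->
  relabeling G (contract (del_edge H i0) w v) p t -> p i = v.
Proof.
move=> hH Ei r; apply/eqP/negPn/negP => ne.
by have := contract_edge_valence hH Ei ne; rewrite (relab_valence _ r) vi.
Qed.

Lemma arc_image (H : graph m N.+1 e) (w : 'I_N.+1) (v : 'I_N) p t :
  in_LD 0 k H -> relabeling G (contract H w v) p t -> p i = v.
Proof.
move=> hH r; apply/eqP/negPn/negP => ne.
have := relab_valence i r; rewrite vi valence_contract //.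
by rewrite (trivalent _ hH).
Qed.

Lemma upper_sub (H : graph m N.+1 e.+1) i0 (w : 'I_N.+1) (v : 'I_N) p t :
  relabeling G (contract (del_edge H i0) w v) p t -> p i = v ->
  upper H i0 w t \subset star G i.
Proof.
move=> /relabP[_ _ M] pi; apply/subsetP => j; rewrite in_set => wj.
by rewrite inE -M pi mem_contract eqxx wj.
Qed.

Lemma card_upper (H : graph m N.+1 e.+1) i0 (w : 'I_N.+1) (v : 'I_N) t :
  in_LD 0 k H -> ~~ seg H w -> ends H i0 = [set lift w v; w] ->
  #|upper H i0 w t| = 2%N.
Proof.
move=> hH nw Ei; have := tri_star hH w; rewrite (negPf nw) /star.
rewrite (card_lift i0) Ei !inE eqxx orbT => /eqP; rewrite eqSS => /eqP <-.
rewrite /upper (card_precomp t (fun j => w \in ends (del_edge H i0) j)).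
by apply: eq_card => j; rewrite [LHS]in_set [RHS]in_set ends_del_edge.
Qed.

(** Relabelings fix segment vertices, so the merged vertex is [i] itself and the
    contracted arc leads from it to its successor. *)
Lemma arc_position (H : graph m N.+1 e) (w : 'I_N.+1) (v : 'I_N) p t :
  in_LD 0 k H -> (v < w)%N -> is_arc H (lift w v) w ->
  relabeling G (contract H w v) p t ->
  [/\ seg G i, v = i & w = lift ord0 i].
Proof.
move=> hH vw /and3P[sv _ /eqP wE] r; have pi := arc_image hH r.
have si : seg G i by rewrite -(relab_seg _ r) pi seg_contract.
have vi' : v = i by rewrite -pi (relab_fix r).
split=> //; apply: ord_inj; rewrite wE lift_below // vi'.
by rewrite /= /bump.
Qed.

End FourValent.

Lemma card_seq_set e (s : seq 'I_e) (T : {set 'I_e}) : uniq s ->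
  T \subset [set x in s] -> #|T| = count (mem T) s.
Proof.
move=> us Ts; rewrite -size_filter -(card_uniqP (filter_uniq _ us)).
apply: eq_card => x; rewrite mem_filter; case xT: (x \in T); rewrite /= xT //=.
by have := subsetP Ts x xT; rewrite inE.
Qed.

Lemma eq_seq_set e (s : seq 'I_e) (T X : {set 'I_e}) :
  T \subset [set x in s] -> X \subset [set x in s] ->
  (T == X) = all (fun x => (x \in T) == (x \in X)) s.
Proof.
move=> Ts Xs; apply/eqP/allP => [-> //|h]; apply/setP => x.
have [/h/eqP //|xs] := boolP (x \in s).
by apply/idP/idP => hx; [have := subsetP Ts x hx|have := subsetP Xs x hx];
   rewrite inE (negPf xs).
Qed.

Let sum3 (T : Type) (F : T -> R) a b c :
  \sum_(A <- [:: a; b; c]) F A = F a + F b + F c.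
Proof. by rewrite !big_cons big_nil addr0 addrA. Qed.

Let sum2 (T : Type) (F : T -> R) a b : \sum_(A <- [:: a; b]) F A = F a + F b.
Proof. by rewrite !big_cons big_nil addr0. Qed.

Let sum1 (T : Type) (F : T -> R) a : \sum_(A <- [:: a]) F A = F a.
Proof. by rewrite big_cons big_nil addr0. Qed.

(** A relabeling sorts the four edges at [i] into the two at one end of the
    contracted edge and the two at the other. *)
Lemma adjunction_free N e (G : graph m N e) (i : 'I_N) (a b c d : 'I_e) :
  in_LD 1 k G -> ~~ multi_edge G -> ~~ seg G i -> valence G i = 4%N ->
  uniq [:: a; b; c; d] -> star G i = [set a; b; c; d] ->
  forall x, pairing (cls R n 1 k G) (delta x) =
    eps_edge (blow_up G i [set a; b]) ord_max *
       pairing (cls R n 0 k (blow_up G i [set a; b])) x +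
    eps_edge (blow_up G i [set a; c]) ord_max *
       pairing (cls R n 0 k (blow_up G i [set a; c])) x +
    eps_edge (blow_up G i [set a; d]) ord_max *
       pairing (cls R n 0 k (blow_up G i [set a; d])) x.
Proof.
move=> hG mG ni vi us sE x; set As := [:: [set a; b]; [set a; c]; [set a; d]].
have sS : star G i = [set y in [:: a; b; c; d]].
  by rewrite sE; apply/setP => y; rewrite !inE !orbA.
have sAs A : A \in As -> A \subset star G i.
  rewrite !inE sE => /or3P[]/eqP->; apply/subsetP => y; rewrite !inE;
  by move=> /orP[]->; rewrite ?orbT.
have ltN : (i < (ord_max : 'I_N.+1))%N by apply: ltn_ord.
rewrite (adjunction (As := As) (Ks := [::]) hG mG ltN sAs) //.
- by rewrite [X in _ + X]big_nil; apply: (etrans (addr0 _)); apply: sum3.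
- move=> H i0 w v p t hH mH ki vw Ei r; have pi := edge_image vi hH Ei r.
  split=> //; rewrite ni /=; set T := upper _ _ _ _.
  have nw : ~~ seg H w by apply: contracted_free ki vw Ei; case/and3P: hH.
  have Ts : T \subset [set y in [:: a; b; c; d]] by rewrite -sS; apply: upper_sub r pi.
  have cT := card_upper t hH nw Ei; rewrite -/T (card_seq_set us Ts) in cT.
  have e1 (X : {set 'I_e}) : X \subset star G i -> (T == X) = all (fun x => (x \in T) == (x \in X)) [:: a; b; c; d].
    by move=> Xs; apply: eq_seq_set Ts _; rewrite -sS.
  have s1 : [set a; b] \subset star G i by rewrite sAs // inE eqxx.
  have s2 : [set a; c] \subset star G i by rewrite sAs // !inE eqxx orbT.
  have s3 : [set a; d] \subset star G i by rewrite sAs // !inE eqxx !orbT.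
  rewrite !big_cons big_nil (e1 _ s1) (e1 _ s2) (e1 _ s3) !(e1 _ (subsetDl _ _)) sE.
  clearbody T; move: us cT; rewrite /= !inE !negb_or => /and4P[/and3P[ab ac ad] /andP[bc bd] cd _].
  rewrite ?inE ?eqxx [b == a]eq_sym [c == a]eq_sym [d == a]eq_sym [c == b]eq_sym.
  rewrite [d == b]eq_sym [d == c]eq_sym.
  rewrite (negPf ab) (negPf ac) (negPf ad) (negPf bc) (negPf bd) (negPf cd) /=.
  by case: (a \in T); case: (b \in T); case: (c \in T); case: (d \in T).
move=> H w v p t hH vw ar r; have [si _ _] := arc_position vi hH vw ar r.
by rewrite si in ni.
Qed.

Lemma arc_double N e (G : graph m N e) (i : 'I_N) A : seg G i ->
  is_arc (double_vertex G i A) (lift (lift ord0 i) i) (lift ord0 i).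
Proof.
move=> si; rewrite /is_arc /seg.
have lo := loc_split_old G i (lift ord0 i) (loc G i) A i.
have ln := loc_split_new G i (lift ord0 i) (loc G i) A.
rewrite /double_vertex lo ln eqxx -/(seg G i) si /= /bump /=.
by rewrite add1n ltnn add0n eqxx.
Qed.

(** In a trivalent diagram a segment vertex has a single edge.  So when the
    contracted edge is mixed, both edges at [i] come from its free end, and when
    an arc is contracted, one of them comes from each end. *)
Lemma adjunction_seg N e (G : graph m N e) (i : 'I_N) (a b : 'I_e) :
  in_LD 1 k G -> ~~ multi_edge G -> seg G i -> valence G i = 4%N ->
  a != b -> star G i = [set a; b] -> (forall j, ends G j != [set i]) ->
  forall x, pairing (cls R n 1 k G) (delta x) =
    eps_edge (blow_up G i [set a; b]) ord_max *
       pairing (cls R n 0 k (blow_up G i [set a; b])) x +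
    (eps_arc (lift ord0 i) * pairing (cls R n 0 k (double_vertex G i [set b])) x +
     eps_arc (lift ord0 i) * pairing (cls R n 0 k (double_vertex G i [set a])) x).
Proof.
move=> hG mG si vi ab sE nl x; set h := lift ord0 i.
have ih : (i < h)%N by [].
have sS : star G i = [set y in [:: a; b]] by rewrite sE; apply/setP => y; rewrite !inE.
have us : uniq [:: a; b] by rewrite /= inE ab.
rewrite (adjunction (As := [:: [set a; b]])
  (Ks := [:: double_vertex G i [set b]; double_vertex G i [set a]]) hG mG ih).
- by rewrite sum1; congr (_ + _); apply: sum2.
- by move=> A; rewrite inE => /eqP ->; rewrite sE.
- move=> K; rewrite !inE => /orP[]/eqP->.
    split; [exact: arc_double|move=> *; exact: relab_contract_split|
            move=> *; exact: sgn_contract_split].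
  split; [exact: arc_double|move=> *; exact: relab_contract_split|
          move=> *; exact: sgn_contract_split].
- move=> H i0 w v p t hH mH ki vw Ei r; have pi := edge_image vi hH Ei r.
  split=> //; rewrite si /=; set T := upper _ _ _ _.
  have nw : ~~ seg H w by apply: contracted_free ki vw Ei; case/and3P: hH.
  have Ts : T \subset star G i by apply: upper_sub r pi.
  rewrite big_cons big_nil; suff -> : T = [set a; b] by rewrite eqxx.
  by apply/eqP; rewrite eqEcard -sE Ts sE cards2 ab (card_upper t hH nw Ei).
move=> H w v p t hH vw ar r; have [_ vE wE] := arc_position vi hH vw ar r.
subst v w; split=> //; rewrite -/h in vw ar r *.
set T := [set j | h \in ends H (t j)].
have mT j : (j \in T) = (h \in ends H (t j)) by apply: in_set.
have sh : seg H h by have [sv /eqP lE _] := and3P ar; rewrite /seg -lE.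
have pi := arc_image vi hH r.
have [_ _ M] := (relabP _ _ _ _).1 r.
have Ts : T \subset [set y in [:: a; b]].
  rewrite -sS; apply/subsetP => j; rewrite mT => hj.
  by rewrite inE -M pi mem_contract eqxx hj.
have cT : #|T| = 1%N.
  by have := tri_star hH h; rewrite sh /T (card_precomp t (fun j => h \in ends H j)).
clearbody T; have mE (A : {set 'I_e}) : A \subset [set y in [:: a; b]] ->
    arc_match h i H (double_vertex G i A) t = (T == A).
  move=> As; have mA j : (j \in A) && (i \in ends G j) = (j \in A).
    case jA: (j \in A) => //; have := subsetP As j jA.
    by rewrite -sS inE => ->.
  apply/forallP/eqP => [mt|TA j].
    apply/setP => j; have /andP[/eqP + _] := mt j.
    by rewrite mem_split_new mA mT.
  have hj : (h \in ends H (t j)) = (j \in A) by rewrite -TA mT.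
  rewrite mem_split_new mA hj eqxx /= mem_split_old eqxx andbT -hj.
  have := M j i; rewrite pi mem_contract eqxx /= => <-.
  have : ~~ ((h \in ends H (t j)) && (lift h i \in ends H (t j))).
    apply/negP => /andP[h1 h2]; have [E|E] := ends2 h2 h1.
      by move: (neq_lift h i); rewrite E eqxx.
    have := relab_ends j r; rewrite ends_contr E imsetU1 !imset_set1.
    rewrite merge_id merge_lift setUid => E'; case/eqP: (nl j).
    by apply: (imset_inj (@perm_inj _ p)); rewrite -E' imset_set1 pi.
  by case: (h \in _); case: (lift h i \in _).
rewrite !big_cons big_nil !mE; try by apply/subsetP => y; rewrite !inE => ->; rewrite ?orbT.
rewrite (card_seq_set us Ts) in cT.
rewrite !(eq_seq_set Ts); try by apply/subsetP => y; rewrite !inE => ->; rewrite ?orbT.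
move: cT; rewrite /= !inE !eqxx (negPf ab) [b == a]eq_sym (negPf ab).
by case: (a \in T); case: (b \in T).
Qed.

(** A loop arises only from a chord over the contracted arc: contracting an edge,
    it would have to come from a parallel edge. *)
Lemma adjunction_loop N e (G : graph m N e) (K : graph m N.+1 e) (h : 'I_N.+1) (i : 'I_N) j0 :
  in_LD 1 k G -> ~~ multi_edge G -> valence G i = 4%N -> (i < h)%N ->
  is_arc K (lift h i) h -> ends K j0 = [set lift h i; h] ->
  (forall j, j != j0 -> (h \notin ends K j) && (lift h i \notin ends K j)) ->
  (forall X p t, relabeling (contract K h i) X p t = relabeling G X p t) ->
  (forall X u, sgn (contract K h i) X u = sgn G X u) ->
  forall x, pairing (cls R n 1 k G) (delta x) = eps_arc h * pairing (cls R n 0 k K) x.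
Proof.
move=> hG mG vi ih ar E0 oth rE sE x.
have Ej : ends G j0 = [set i].
  have /relabP[_ _ M] : relabeling (contract K h i) G 1 1 by rewrite rE relabeling1.
  have := ends_contract K h i j0; rewrite E0 imsetU1 imset_set1 merge_lift merge_id setUid => E.
  by apply/setP => y; have := M j0 y; rewrite !perm1 E => ->.
rewrite (adjunction (As := [::]) (Ks := [:: K]) hG mG ih) //.
- by rewrite [X in X + _]big_nil; apply: (etrans (add0r _)); apply: sum1.
- by move=> K'; rewrite inE => /eqP ->.
- move=> H i0 w v p t hH mH ki vw Ei r; have pi := edge_image vi hH Ei r.
  have E := relab_ends j0 r; rewrite Ej imset_set1 pi in E.
  have sub y : y \in ends (del_edge H i0) (t j0) -> y \in [set lift w v; w].
    move=> yj; have : merge_vertex w v y \in [set v] by rewrite -E ends_contr imset_f.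
    by rewrite inE mergeE eqxx !inE orbC.
  have := del_edge_neq i0 (t j0) hH mH; rewrite Ei => /negP[].
  have [h1 h2] := mem_ends (del_edge H i0) (t j0).
  have ne : src (del_edge H i0) (t j0) != tgt (del_edge H i0) (t j0).
    by rewrite /src /tgt !ffunE; exact: tri_src_tgt hH _.
  move: (sub _ h1) (sub _ h2) ne; rewrite /ends !inE.
  by move=> /orP[]/eqP-> /orP[]/eqP->; rewrite ?eqxx // setUC.
move=> H w v p t hH vw ar' r; have [si vE wE] := arc_position vi hH vw ar' r.
have hE : h = lift ord0 i.
  apply: ord_inj; have [_ _ /eqP ->] := and3P ar; rewrite lift_below //.
subst v w; rewrite -hE in vw ar' r *; split=> //.
rewrite big_cons big_nil; suff -> : arc_match h i H K t by [].
have sh : seg H h by have [sv /eqP lE _] := and3P ar'; rewrite /seg -lE.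
have sv : seg H (lift h i) by case/and3P: ar'.
have pi := arc_image vi hH r.
have E := relab_ends j0 r; rewrite Ej imset_set1 pi in E.
have sub y : y \in ends H (t j0) -> y \in [set lift h i; h].
  move=> yj; have : merge_vertex h i y \in [set i] by rewrite -E ends_contr imset_f.
  by rewrite inE mergeE eqxx !inE orbC.
have EH : ends H (t j0) = [set lift h i; h].
  have [h1 h2] := mem_ends H (t j0); have ne := tri_src_tgt hH (t j0).
  move: (sub _ h1) (sub _ h2) ne; rewrite /ends !inE.
  by move=> /orP[]/eqP-> /orP[]/eqP->; rewrite ?eqxx // setUC.
have only y j : seg H y -> y \in ends H (t j0) -> y \in ends H (t j) -> j = j0.
  move=> sy y0 yj; have := tri_star hH y; rewrite sy => /eqP/cards1P[z zE].
  have h1 : t j0 \in star H y by rewrite inE.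
  have h2 : t j \in star H y by rewrite inE.
  by move: h1 h2; rewrite zE !inE => /eqP <- /eqP /perm_inj.
apply/forallP => j; have [->|jj] := eqVneq j j0.
  by rewrite EH E0 !eqxx.
have /andP[h1 h2] := oth j jj; rewrite (negPf h1) (negPf h2).
have no y : seg H y -> y \in ends H (t j0) -> (y \in ends H (t j)) = false.
  by move=> sy y0; apply/negP => /(only _ _ sy y0) jE; rewrite jE eqxx in jj.
by rewrite !no // EH !inE eqxx ?orbT.
Qed.

End Resolutions.

(** * Cocycles and the STU, IHX and 1T relations *)

Section Relations.
Variables (R : realType) (m n k : nat).
Implicit Types d N e : nat.
Local Notation sgn := (sgn R n).
Local Notation eps_arc := (eps_arc R).
Local Notation eps_edge := (eps_edge R n).
Local Notation delta := (delta R m n 0 k).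
Local Notation cls0 := (cls R n 0 k).
Local Notation cls1 := (cls R n 1 k).

Lemma set_of_card e (A : {set 'I_e}) : exists2 s : seq 'I_e, uniq s & A = [set x in s] /\ size s = #|A|.
Proof.
by exists (enum A); rewrite ?enum_uniq // -cardE; split=> //; apply/setP => x;
   rewrite inE mem_enum.
Qed.

(** A segment vertex owes 2 to the segment, and a loop accounts for the other 2. *)
Lemma four_valent_cases N e (G : graph m N e) i : link_diagram G -> valence G i = 4%N ->
  [\/ ~~ seg G i /\ (exists a b c d : 'I_e, uniq [:: a; b; c; d] /\ star G i = [set a; b; c; d]),
      seg G i /\ (exists a b : 'I_e, [/\ a != b, star G i = [set a; b] & forall j, ends G j != [set i]])
    | seg G i /\ (exists j0 : 'I_e, ends G j0 = [set i] /\ star G i = [set j0])].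
Proof.
move=> lG vi; have [s us [sE ss]] := set_of_card (star G i).
have [si|ni] := boolP (seg G i); last first.
  constructor 1; split=> //; rewrite -(valence_free lG ni) vi in ss.
  case: s us sE ss => [|a [|b [|c [|d []]]]] // us sE _; exists a, b, c, d; split=> //.
  by rewrite sE; apply/setP => x; rewrite !inE -!orbA.
have := vi; rewrite valence_seg // -ss; set L := [set j | _].
have [L0|[j0 j0L]] := set_0Vmem L.
  rewrite L0 cards0 addn0 => sz; constructor 2; split=> //.
  have {}sz : size s = 2%N by move: sz; move: (size s) => l; lia.
  case: s us sE {ss} sz => [|a [|b []]] // us sE _; exists a, b.
  split; first by move: us; rewrite /= inE andbT.
    by rewrite sE; apply/setP => x; rewrite !inE.
  move=> j; apply/negP => h; have : j \in L by rewrite inE.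
  by rewrite L0 inE.
move=> sz; constructor 3; split=> //; exists j0.
have E0 : ends G j0 = [set i] by move: j0L; rewrite inE => /eqP.
split=> //; have j0s : j0 \in star G i by rewrite inE E0 set11.
have L1 : (0 < #|L|)%N by apply/card_gt0P; exists j0.
apply/eqP; rewrite eq_sym eqEcard sub1set j0s cards1 -ss.
by move: sz L1; move: #|L| => l; lia.
Qed.

Lemma eps_edgeP N e (G : graph m N e) j : eps_edge G j = 1 \/ eps_edge G j = -1.
Proof.
have sg a : (-1) ^+ a = 1 :> R \/ (-1) ^+ a = -1 :> R.
  by rewrite -signr_odd; case: odd; [right|left].
rewrite /Defs.eps_edge; case: odd => //; case: ifP => _ //.
by case: (sg (src G j).+1) => ->; [right|left; rewrite opprK].
Qed.

Lemma eps_arcP N (w : 'I_N) : eps_arc w = 1 \/ eps_arc w = -1.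
Proof. by rewrite /Defs.eps_arc -signr_odd; case: odd; [right|left]. Qed.

(** The sign of a member of a triple is the sign [a] of the contraction, as long as
    the original diagram does not vanish. *)
Lemma signed_memberE (P : subcomplex m) (y : LD R m n 1 k) a N e (K : graph m N e) :
  a = 1 \/ a = -1 -> y != 0 ->
  signed_member P (a *: y) y K = if P N e K then a *: cls0 K else 0.
Proof.
move=> ha y0; rewrite /signed_member; case: ifP => // _.
case: ha => ->; first by rewrite scale1r eqxx.
by rewrite scaleN1r eq_sym eqr_opp0 (negPf y0).
Qed.

Section Supported.
Variables (P : subcomplex m) (x : LD R m n 0 k).
Hypothesis supp : forall N e (K : graph m N e), ~~ @P N e K -> pairing (cls0 K) x = 0.

Lemma pairing_edge_member N e (G : graph m N e) i A : cls1 G != 0 ->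
  pairing (edge_member R n P k G i A) x = eps_edge (blow_up G i A) ord_max *
    pairing (cls0 (blow_up G i A)) x.
Proof.
move=> G0; rewrite /edge_member cls_contract_blow_up signed_memberE //; last exact: eps_edgeP.
by case: ifPn => [_|/supp ->]; rewrite ?pairingZl // pairing0l mulr0.
Qed.

Lemma pairing_arc_member N e (G : graph m N e) i A : cls1 G != 0 ->
  pairing (arc_member R n P k G i A) x = eps_arc (lift ord0 i) *
    pairing (cls0 (double_vertex G i A)) x.
Proof.
move=> G0; rewrite /arc_member cls_contract_double signed_memberE //; last exact: eps_arcP.
by case: ifPn => [_|/supp ->]; rewrite ?pairingZl // pairing0l mulr0.
Qed.

Let pair3 (S T U : LD R m n 0 k) s t u :
  pairing S x = s -> pairing T x = t -> pairing U x = u ->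
  pairing (S + T + U) x = s + t + u.
Proof. by move=> <- <- <-; rewrite !pairingDl. Qed.

Lemma STU_star N e (G : graph m N e) i (a b : 'I_e) : link_diagram G ->
  seg G i -> valence G i = 4%N ->
  [/\ a != b, i \in ends G a, i \in ends G b, ~~ is_loop G a & ~~ is_loop G b] ->
  star G i = [set a; b] /\ forall j, ends G j != [set i].
Proof.
move=> lG si vi [ab ia ib la lb].
have as_ : a \in star G i by rewrite inE.
have bs : b \in star G i by rewrite inE.
have [[]|[_ [a' [b' [_ sE nl]]]]|[_ [j0 [E0 sE]]]] := four_valent_cases lG vi.
- by rewrite si.
- split=> //; apply/eqP; rewrite eq_sym eqEcard sE !cards2 ab -sE subUset !sub1set as_ bs.
  by case: (a' != b').
move: as_ bs ab; rewrite sE !inE => /eqP -> /eqP ->.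
by rewrite eqxx.
Qed.

Lemma nonzero_notmulti N e (G : graph m N e) : cls1 G != 0 -> ~~ multi_edge G.
Proof. by apply: contra => /(cls_multi R n 1 k) ->. Qed.

Lemma cocycle_STU : delta x = 0 -> STU_relation P x.
Proof.
move=> dx S T U [N [e [G [i [a [b [[hG PG G0] [si vi] hab [-> -> ->]]]]]]]].
have lG : link_diagram G by case/and3P: hG.
have [sE nl] := STU_star lG si vi hab; have [ab _ _ _ _] := hab.
have E1 := pairing_edge_member i [set a; b] G0.
have E2 := pairing_arc_member i [set b] G0.
have E3 := pairing_arc_member i [set a] G0.
apply: (etrans (pair3 E1 E2 E3)); apply: (etrans (esym (addrA _ _ _))).
apply: (etrans (esym (adjunction_seg hG (nonzero_notmulti G0) si vi ab sE nl x))).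
by rewrite dx pairing0r.
Qed.

Lemma cocycle_IHX : delta x = 0 -> IHX_relation P x.
Proof.
move=> dx I H X [N [e [G [i [a [b [c [d [[hG PG G0] [ni vi] [us sE] [-> -> ->]]]]]]]]]].
have E1 := pairing_edge_member i [set a; b] G0.
have E2 := pairing_edge_member i [set a; c] G0.
have E3 := pairing_edge_member i [set a; d] G0.
apply: (etrans (pair3 E1 E2 E3)).
apply: (etrans (esym (adjunction_free hG (nonzero_notmulti G0) ni vi us sE x))).
by rewrite dx pairing0r.
Qed.

Lemma relations_cocycle N e (G : graph m N e) i :
  STU_relation P x -> IHX_relation P x ->
  in_LD 1 k G -> @P N e G -> cls1 G != 0 -> valence G i = 4%N ->
  (forall j, ends G j != [set i]) ->
  pairing (cls1 G) (delta x) = 0.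
Proof.
move=> hS hI hG PG G0 vi nl; have lG : link_diagram G by case/and3P: hG.
have mG := nonzero_notmulti G0.
have [[ni [a [b [c [d [us sE]]]]]]|[si [a [b [ab sE _]]]]|[_ [j0 [E0 _]]]] :=
  four_valent_cases lG vi.
- have E1 := pairing_edge_member i [set a; b] G0.
  have E2 := pairing_edge_member i [set a; c] G0.
  have E3 := pairing_edge_member i [set a; d] G0.
  apply: (etrans (adjunction_free hG mG ni vi us sE x)).
  apply: (etrans (esym (pair3 E1 E2 E3))).
  by apply: hI; exists N, e, G, i, a, b, c, d; split.
- have E1 := pairing_edge_member i [set a; b] G0.
  have E2 := pairing_arc_member i [set b] G0.
  have E3 := pairing_arc_member i [set a] G0.
  apply: (etrans (adjunction_seg hG mG si vi ab sE nl x)).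
  apply: (etrans (addrA _ _ _)); apply: (etrans (esym (pair3 E1 E2 E3))).
  have in_star j : j \in star G i -> (i \in ends G j) && ~~ is_loop G j.
    rewrite inE => ij; rewrite ij; apply/negP => /andP[/eqP st _].
    case/eqP: (nl j); move: ij; rewrite /ends st setUid inE.
    by move=> /eqP ->.
  have /andP[ia la] : (i \in ends G a) && ~~ is_loop G a by apply: in_star; rewrite sE !inE eqxx.
  have /andP[ib lb] : (i \in ends G b) && ~~ is_loop G b by apply: in_star; rewrite sE !inE eqxx orbT.
  by apply: hS; exists N, e, G, i, a, b; split.
by have := nl j0; rewrite E0 eqxx.
Qed.

End Supported.


(** Contracting the arc below the chord gives a loop, whose only resolution is
    the given diagram. *)
Lemma cocycle_1T (x : LD R m n 0 k) : delta x = 0 -> oneT_relation x.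
Proof.
move=> dx N e K hK [j0 [v [w [ch ar E0]]]].
have [mK|mK] := boolP (multi_edge K); first by rewrite (cls_multi _ _ _ _ mK) pairing0l.
case: N v w K hK ch ar E0 mK => [|N] v w K hK ch ar E0 mK; first by case: v {ar E0}.
have [sv /eqP lE /eqP wE] := and3P ar.
case: (unliftP w v) ar E0 sv lE wE => [i ->|->] ar E0 sv lE wE; last by lia.
have iw : (i < w)%N by rewrite -(lift_lt w) [X in (_ < X)%N]wE.
have hG := contract_arc_LD hK ar; set G := contract K w i in hG.
have nl := tri_noloop hK.
have oth j : j != j0 -> (w \notin ends K j) && (lift w i \notin ends K j).
  move=> jj; have sw : seg K w by rewrite /seg -lE.
  have no y : seg K y -> y \in ends K j0 -> y \notin ends K j.
    move=> sy y0; apply/negP => yj; have := tri_star hK y; rewrite sy => /eqP/cards1P[z zE].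
    have h1 : j0 \in star K y by rewrite inE.
    have h2 : j \in star K y by rewrite inE.
    by move: h1 h2 jj; rewrite zE !inE => /eqP -> /eqP ->; rewrite eqxx.
  by rewrite !no // E0 !inE eqxx ?orbT.
have mG : ~~ multi_edge G.
  apply/negP => /existsP[a /existsP[b /and3P[ab st /eqP Eab]]].
  have cE (j : 'I_e) (y : 'I_N) : (y \in @ends m N e G j) = (y == i) && (w \in ends K j) || (lift w y \in ends K j).
    exact: mem_contract.
  have [aj|aj] := eqVneq a j0.
    move: st; rewrite aj eq_src_tgt ends_contract E0 imsetU1 imset_set1 merge_id merge_lift.
    by rewrite setUid cards1.
  have [bj|bj] := eqVneq b j0.
    move: st; rewrite eq_src_tgt Eab bj ends_contract E0 imsetU1 imset_set1 merge_id merge_lift.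
    by rewrite setUid cards1.
  case/negP: mK; apply/existsP; exists a; apply/existsP; exists b.
  rewrite ab (tri_src_tgt hK) /=; apply/eqP/setP => y.
  have /andP[/negPf a1 /negPf a2] := oth a aj; have /andP[/negPf b1 /negPf b2] := oth b bj.
  case: (unliftP w y) => [z ->|->]; last by rewrite a1 b1.
  by have := cE a z; have := cE b z; rewrite a1 b1 !andbF /= => <- <-; rewrite Eab.
have vi : valence G i = 4%N.
  have [i' [vi' _]] := defect1_vertex hG.
  have [<- //|ne] := eqVneq i' i.
  by move: vi'; rewrite /G valence_contract // (trivalent _ hK).
have E := adjunction_loop hG mG vi iw ar E0 oth (fun _ _ _ => erefl) (fun _ _ => erefl) x.
move: E; rewrite dx pairing0r => /esym/eqP; rewrite mulf_eq0 => /orP[|/eqP //].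
by case: (eps_arcP w) => ->; rewrite ?oppr_eq0 oner_eq0.
Qed.

(** The loop [j0] becomes a chord, oriented such that contracting the arc gives
    back the orientation of the loop. *)
Definition open_loop N e (G : graph m N e) (i : 'I_N) (j0 : 'I_e) : graph m N.+1 e :=
  let h := lift ord0 i in
  ((split_vertex G i h (loc G i) set0).1,
   [ffun j => if j == j0 then
      (if loop_or G j0 then (h, lift h i, false) else (lift h i, h, false))
    else (split_vertex G i h (loc G i) set0).2 j]).

Lemma oneT_cocycle (x : LD R m n 0 k) N e (G : graph m N e) i j0 :
  oneT_relation x -> in_LD 1 k G -> ~~ multi_edge G -> valence G i = 4%N ->
  seg G i -> ends G j0 = [set i] -> star G i = [set j0] ->
  pairing (cls1 G) (delta x) = 0.
Proof.
move=> h1T hG mG vi si E0 sE; pose K := open_loop G i j0; set h := lift ord0 i.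
have lo : loc K =1 loc (double_vertex G i set0) by [].
have ar : is_arc K (lift h i) h by apply: arc_double.
have EK : ends K j0 = [set lift h i; h].
  rewrite /ends /src /tgt ffunE eqxx; case: ifP => //= _.
  by rewrite setUC.
have EK' j : j != j0 -> K.2 j = (double_vertex G i set0).2 j.
  by move=> jj; rewrite ffunE (negPf jj).
have st : src G j0 = tgt G j0 by apply/eqP; rewrite eq_src_tgt E0 cards1.
have si0 : src G j0 = i by have [] := mem_ends G j0; rewrite E0 inE => /eqP.
have ti0 : tgt G j0 = i by rewrite -st.
have hh : h != lift h i by apply: neq_lift.
have srcC j : @src m N e (contract K h i) j = src G j.
  have [->|jj] := eqVneq j j0.
    rewrite /src ffunE /= /src ffunE eqxx -/(src G j0) si0.
    by case: ifP => _ /=; rewrite ?merge_id ?merge_lift.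
  rewrite -(src_contract_split G i h (loc G i) set0 j).
  by rewrite /src !ffunE /= /src EK'.
have tgtC j : @tgt m N e (contract K h i) j = tgt G j.
  have [->|jj] := eqVneq j j0.
    rewrite /tgt ffunE /= /tgt ffunE eqxx -/(tgt G j0) ti0.
    by case: ifP => _ /=; rewrite ?merge_id ?merge_lift.
  rewrite -(tgt_contract_split G i h (loc G i) set0 j).
  by rewrite /tgt !ffunE /= /tgt EK'.
have oth j : j != j0 -> (h \notin ends K j) && (lift h i \notin ends K j).
  move=> jj; have -> : ends K j = ends (double_vertex G i set0) j.
    by rewrite /ends /src /tgt EK'.
  rewrite mem_split_new mem_split_old inE /= andbT.
  have : j \notin star G i by rewrite sE inE.
  by rewrite inE; apply: contra; rewrite !inE.
have rE X p t : relabeling (contract K h i) X p t = relabeling G X p t.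
  apply: relab_ext => [y|j]; last by rewrite /ends srcC tgtC.
  by rewrite loc_contract lo loc_split_old.
have sgE X u : sgn (contract K h i) X u = sgn G X u.
  apply: sgn_ext => j; rewrite ?srcC ?tgtC // => stj.
  have [->|jj] := eqVneq j j0.
    rewrite [LHS]/loop_or ffunE /= /src /tgt !ffunE eqxx.
    have hlt : (lift h i < h)%N by rewrite (lift_lt h).
    case: (loop_or G j0) => /=; first by rewrite (negPf hh) hlt.
    by rewrite eq_sym (negPf hh) ltnNge ltnW.
  rewrite [LHS]/loop_or ffunE /=.
  have sK : src K j = src (double_vertex G i set0) j by rewrite /src EK'.
  have tK : tgt K j = tgt (double_vertex G i set0) j by rewrite /tgt EK'.
  rewrite sK tK src_split tgt_split stj eqxx.
  by rewrite /loop_or EK' // ffunE.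
have ih : (i < h)%N by [].
rewrite (adjunction_loop hG mG vi ih ar EK oth rE sgE).
have [hK|hK] := boolP (in_LD 0 k K); last by rewrite cls_notin // pairing0l mulr0.
rewrite (h1T _ _ K hK) ?mulr0 //; exists j0, (lift h i), h; split=> //.
have sh : seg K h by have [sv /eqP lE _] := and3P ar; rewrite /seg -lE.
have sv : seg K (lift h i) by case/and3P: ar.
rewrite /is_chord (tri_src_tgt hK) /=.
have [h1 h2] := mem_ends K j0; rewrite EK !inE in h1 h2.
by case/orP: h1 => /eqP ->; case/orP: h2 => /eqP ->; rewrite ?sh ?sv.
Qed.

Theorem H0_LD_relations (x : LD R m n 0 k) :
  x \in H0_LD R m n k <->
  [/\ STU_relation (in_whole_LD (m := m)) x, IHX_relation (in_whole_LD (m := m)) x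
    & oneT_relation x].
Proof.
rewrite memv_ker; split=> [/eqP dx|[hS hI h1]].
  by split; [apply: cocycle_STU|apply: cocycle_IHX|apply: cocycle_1T].
apply/eqP/pairing_eq0 => N e G hG mG G0; have [i [vi _]] := defect1_vertex hG.
have lG : link_diagram G by case/and3P: hG.
have [[j0 E0]|nl] := pselect (exists j, ends G j = [set i]).
  have si := LD_kinds lG E0.
  have [[]|[_ [a [b [_ _ nl]]]]|[_ [j [Ej sE]]]] := four_valent_cases lG vi.
  - by rewrite si.
  - by have := nl j0; rewrite E0 eqxx.
  exact: oneT_cocycle h1 hG mG vi si Ej sE.
apply: (relations_cocycle (P := in_whole_LD (m := m)) _ hS hI hG _ G0 vi) => // j.
by apply/eqP => E; apply: nl; exists j.
Qed.

End Relations.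

(** * Homotopy link diagrams *)

Section Homotopy.
Variables (m : nat).
Implicit Types d N e : nat.

(** The vertices that a path may use without meeting a segment other than [s]. *)
Definition near_seg N e (G : graph m N e) (s : 'I_m) : pred 'I_N :=
  fun x => (loc G x == None) || (loc G x == Some s).

Definition HD_connect N e (G : graph m N e) : Prop :=
  forall s v w, v != w -> loc G v = Some s -> loc G w = Some s ->
  ~~ connect (adj G (near_seg G s)) v w.

Lemma is_HDP N e (G : graph m N e) :
  is_HD G <-> (forall i, ~~ is_loop G i) /\ HD_connect G.
Proof.
split=> [/andP[/forallP nl /asboolP h]|[nl h]].
  split=> // s v w vw lv lw; apply/negP => /connect_edge_path /(_ vw)[i [p [hp hP]]].
  have [j [x [t [jp xj lx ts]]]] := h v w s vw lv lw i p hp.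
  have := hP j x jp xj; rewrite /near_seg lx /= => /eqP[E].
  by rewrite E eqxx in ts.
apply/andP; split; first exact/forallP.
apply/asboolP => v w s vw lv lw i p hp; apply: contrapT => no.
case/negP: (h s v w vw lv lw); apply: edge_path_connect hp => j x jp xj.
rewrite /near_seg; case lx: (loc G x) => [t|//]; apply/orP; right.
by apply/eqP; congr Some; apply: contrapT => ts; apply: no; exists j, x, t; split=> //; apply/eqP.
Qed.

Lemma relab_HD N e (G H : graph m N e) p t : relabeling G H p t -> is_HD H = is_HD G.
Proof.
move=> r; have imp (G1 G2 : graph m N e) p1 t1 : relabeling G1 G2 p1 t1 -> is_HD G2 -> is_HD G1.
  move=> {}r /is_HDP[nl h]; apply/is_HDP; split=> [i|s v w vw lv lw].
    have := nl (t1 i); rewrite /is_loop (relab_src_tgt _ r).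
    case: (relab_srcV i r) => -[-> _]; rewrite (relab_seg _ r) //.
    by case: eqP => [->|].
  have h' := h s (p1 v) (p1 w); rewrite (inj_eq perm_inj) !(relab_loc _ r) in h'.
  apply: contra (h' vw lv lw); apply: connect_mono => x y /and3P[Px Py /existsP[j /eqP E]].
  apply: connect1; rewrite /adj /near_seg !(relab_loc _ r).
  rewrite -[_ || _]/(near_seg G1 s x) Px -[_ || _]/(near_seg G1 s y) Py /=.
  by apply/existsP; exists (t1 j); rewrite (relab_ends _ r) E imsetU1 imset_set1.
by apply/idP/idP; [apply: imp r|apply: imp (relab_inv r)].
Qed.

Lemma connect_closed (T : finType) (r : rel T) (Z : T -> Prop) :
  (forall a b, Z a -> r a b -> Z b) -> forall x y, Z x -> connect r x y -> Z y.
Proof.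
move=> cl x y Zx /connectP[p]; elim: p x Zx => [|z p IH] x Zx /=; first by move=> _ ->.
by case/andP => /(cl _ _ Zx) Zz hp; apply: IH.
Qed.

Section ContractHD.
Variables (k N e e' : nat).

Lemma adj_contract_lift (H : graph m N.+1 e) (w : 'I_N.+1) (v x y : 'I_N) P :
  adj (contract H w v) P x y -> exists u u' j, [/\ u \in ends H j, u' \in ends H j,
    merge_vertex w v u = x & merge_vertex w v u' = y].
Proof.
case/and3P => _ _ /existsP[j /eqP E]; rewrite ends_contract in E.
have : x \in [set x; y] by rewrite !inE eqxx.
have : y \in [set x; y] by rewrite !inE eqxx orbT.
rewrite -E => /imsetP[u' u'j ->] /imsetP[u uj ->].
by exists u, u', j; split.
Qed.

(** A path of the contraction lifts, with a detour along the contracted edge where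
    it goes through the merged vertex. *)
Lemma contract_edge_HD (H : graph m N.+1 e.+1) i0 (w : 'I_N.+1) (v : 'I_N) :
  in_LD 0 k H -> ~~ multi_edge H -> is_free_edge H i0 || is_mixed H i0 ->
  (v < w)%N -> ends H i0 = [set lift w v; w] -> is_HD H ->
  is_HD (contract (del_edge H i0) w v).
Proof.
move=> hH mH ki vw Ei /is_HDP[_ h]; set C := contract _ w v.
have lH : link_diagram H by case/and3P: hH.
have nw : loc H w = None.
  by apply/eqP; have := contracted_free lH ki vw Ei; rewrite /seg negbK.
have lC y : @loc m N e C y = loc H (lift w y) by exact: loc_contract.
apply/is_HDP; split=> [j|s x y xy lx ly].
  apply/negP => /andP[/eqP st _].
  have sub u : u \in ends (del_edge H i0) j -> merge_vertex w v u = src C j.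
    move=> uj; have : merge_vertex w v u \in ends C j by rewrite ends_contract imset_f.
    by rewrite /ends -st setUid inE => /eqP.
  have [h1 h2] := mem_ends (del_edge H i0) j.
  have ne : src (del_edge H i0) j != tgt (del_edge H i0) j.
    by rewrite /src /tgt !ffunE; exact: tri_src_tgt hH _.
  have E := merge_eq ne (etrans (sub _ h1) (esym (sub _ h2))).
  by have := del_edge_neq i0 j hH mH; rewrite /ends E -/(ends H i0) Ei eqxx.
have xy' : lift w x != lift w y by rewrite (inj_eq lift_inj).
apply: contra (h s _ _ xy' _ _); rewrite -?lC //.
apply: connect_mono => a b ab; have [u [u' [j [uj uj' ua ub]]]] := adj_contract_lift ab.
have [Pa Pb _] := and3P ab.
have near a' c : near_seg C s a' -> merge_vertex w v c = a' -> near_seg H s c.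
  move=> + ca; rewrite /near_seg lC -ca; case: (unliftP w c) => [z ->|->].
    by rewrite merge_lift.
  by rewrite nw.
have lif a' c : near_seg C s a' -> merge_vertex w v c = a' ->
    connect (adj H (near_seg H s)) (lift w a') c.
  move=> Pa' ca; have [cw|cw] := eqVneq c w; last by rewrite -ca merge_lt.
  have a'v : a' = v by rewrite -ca cw merge_id.
  apply: connect1; rewrite /adj (near _ _ Pa' (merge_lift w v a')) (near _ _ Pa' ca) /=.
  by apply/existsP; exists i0; rewrite Ei cw a'v.
apply: connect_trans (lif a u Pa ua) _; rewrite connect_adj_sym.
apply: connect_trans (lif b u' Pb ub) _; rewrite connect_adj_sym.
have dE : @ends m N.+1 e (del_edge H i0) j = ends H (lift i0 j) by exact: ends_del_edge.
rewrite dE in uj uj'.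
have [->//|E] := ends2 uj uj'.
apply: connect1; rewrite /adj (near _ _ Pa ua) (near _ _ Pb ub) /=.
by apply/existsP; exists (lift i0 j); rewrite E.
Qed.

(** A path of the contraction through the merged vertex need not lift, as the ends
    of the arc are not connected.  But if both its ends lie on the segment of the
    arc, one of them is connected to an end of the arc in [H] already, and
    otherwise the merged vertex is on another segment. *)
Lemma contract_arc_HD (H : graph m N.+1 e) (w : 'I_N.+1) (v : 'I_N) :
  in_LD 0 k H -> is_arc H (lift w v) w -> is_HD H -> is_HD (contract H w v).
Proof.
move=> hH /and3P[sv /eqP lE _] /is_HDP[_ h]; set C := contract _ w v.
have lC y : @loc m N e C y = loc H (lift w y) by exact: loc_contract.
have [sg lv] : exists sg, loc H (lift w v) = Some sg.
  by move: sv; rewrite /seg; case: (loc H _) => // sg _; exists sg.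
have lw : loc H w = Some sg by rewrite -lE.
have nvw : lift w v != w by rewrite eq_sym neq_lift.
apply/is_HDP; split=> [j|].
  apply/negP => /andP[/eqP st _].
  have sub u : u \in ends H j -> merge_vertex w v u = src C j.
    move=> uj; have : merge_vertex w v u \in ends C j by rewrite ends_contract imset_f.
    by rewrite /ends -st setUid inE => /eqP.
  have [h1 h2] := mem_ends H j.
  have E := merge_eq (tri_src_tgt hH j) (etrans (sub _ h1) (esym (sub _ h2))).
  case/negP: (h sg _ _ nvw lv lw); apply: connect1.
  rewrite /adj /near_seg lv lw eqxx /=; apply/existsP; exists j.
  by rewrite /ends E.
suff main s x y : x != v -> x != y -> loc C x = Some s -> loc C y = Some s ->
    ~~ connect (adj C (near_seg C s)) x y.
  move=> s x y xy lx ly; have [xv|xv] := eqVneq x v; last exact: main.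
  rewrite connect_adj_sym; apply: main => //; first by rewrite -xv eq_sym.
  by rewrite eq_sym.
move=> xv xy lx ly; apply/negP.
(* No path from [x] reaches the merged vertex: it would connect [lift w x] to an
   end of the arc. *)
pose Z z := z != v /\ connect (adj H (near_seg H s)) (lift w x) (lift w z).
have Zx : Z x by split=> //; apply: connect0.
move=> hc; suff [yv hy] : Z y.
  have xy' : lift w x != lift w y by rewrite (inj_eq lift_inj).
  by have := h s _ _ xy'; rewrite -!lC lx ly hy => /(_ erefl erefl).
apply: connect_closed Zx hc => a b [av ha] ab.
have [u [u' [j [uj uj' ua ub]]]] := adj_contract_lift ab; have [Pa Pb _] := and3P ab.
have near a' c : near_seg C s a' -> merge_vertex w v c = a' -> near_seg H s c.
  move=> + ca; rewrite /near_seg lC -ca; case: (unliftP w c) => [z ->|->].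
    by rewrite merge_lift.
  by rewrite merge_id lE.
have uE : u = lift w a.
  by move/eqP: ua; rewrite mergeE (negPf av) /= => /eqP.
have hu' : connect (adj H (near_seg H s)) (lift w x) u'.
  apply: connect_trans ha _; rewrite -uE; have [->//|E] := ends2 uj uj'.
  apply: connect1; rewrite /adj (near _ _ Pa ua) (near _ _ Pb ub) /=.
  by apply/existsP; exists j; rewrite E.
have [bv|bv] := eqVneq b v; last first.
  by split=> //; move/eqP: ub; rewrite mergeE (negPf bv) /= => /eqP <-.
have lu' : loc H u' = Some sg.
  by move/eqP: ub; rewrite bv mergeE eqxx /= => /orP[]/eqP ->.
have sE : sg = s.
  by have := near _ _ Pb ub; rewrite /near_seg lu' /= => /eqP[].
have xu : lift w x != u'.
  by apply/eqP => E; move: ub; rewrite -E merge_lift bv => E'; rewrite E' eqxx in xv.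
by have := h s _ _ xu; rewrite -lC lx lu' sE hu' => /(_ erefl erefl).
Qed.

End ContractHD.
End Homotopy.

Section HDComplex.
Variables (R : realType) (m n k : nat).
Implicit Types d N e : nat.
Local Notation delta := (delta R m n 0 k).

Lemma pairing_HD0 d (x : LD R m n d k) N e (K : graph m N e) :
  x \in HD R m n d k -> ~~ is_HD K -> pairing (cls R n d k K) x = 0.
Proof.
move=> /memv_sumP[f hf ->] nK; rewrite pairing_sumr big1 // => g gHD.
have /vlineP[a ->] := hf g gHD; rewrite pairingZr.
have [mg|mg] := boolP (multi_edge (gen_graph g)).
  by rewrite (cls_multi R n d k mg) pairing0r mulr0.
rewrite pairing_isum ?(in_LD_gen g) ?mg ?orbT //.
have [->|h] := eqVneq (isum R n K (gen_graph g)) 0; first exact: mulr0.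
have := isum_invariant (P := fun N e G => is_HD G)
  (fun N e G H p t => @relab_HD m N e G H p t) h.
by rewrite gHD (negPf nK).
Qed.

Lemma delta_cls_HD0 N e (G : graph m N e) N1 e1 (H : graph m N1 e1) :
  in_LD 1 k G -> ~~ multi_edge G -> ~~ is_HD G ->
  in_LD 0 k H -> ~~ multi_edge H -> is_HD H ->
  pairing (cls R n 1 k G) (delta (cls R n 0 k H)) = 0.
Proof.
move=> hG mG nG hH mH HH.
have no N2 e2 (C : graph m N2 e2) a : is_HD C -> a * isum R n G C = 0.
  move=> hC; suff -> : isum R n G C = 0 by rewrite mulr0.
  apply/eqP/negPn/negP => h.
  have := isum_invariant (P := fun N e G => is_HD G)
    (fun N e G H p t => @relab_HD m N e G H p t) h.
  by rewrite hC (negPf nG).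
apply: (etrans (pairing_delta_diag R n hG mG hH mH)).
case: N1 H hH mH HH => [|N1] H hH mH HH.
  by rewrite !big_ord0 addr0 big1 // => i _; rewrite big_ord0.
rewrite big1 ?add0r => [|i ki]; last first.
  apply: big1 => w _; apply: big1 => v /andP[vw /eqP Ei].
  case: e1 H hH mH HH i ki Ei => [|e1] H hH mH HH i ki Ei; first by case: i {ki Ei}.
  exact: no (contract_edge_HD hH mH ki vw Ei HH).
apply: big1 => w _; apply: big1 => v /andP[vw ar].
exact: no (contract_arc_HD hH ar HH).
Qed.

Lemma delta_HD0 (x : LD R m n 0 k) N e (G : graph m N e) :
  x \in HD R m n 0 k -> in_LD 1 k G -> ~~ multi_edge G -> ~~ is_HD G ->
  pairing (cls R n 1 k G) (delta x) = 0.
Proof.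
move=> /memv_sumP[f hf ->] hG mG nG; rewrite linear_sum pairing_sumr big1 // => g gHD.
have /vlineP[a ->] := hf g gHD; rewrite linearZ /= pairingZr.
have [mg|mg] := boolP (multi_edge (gen_graph g)).
  by rewrite (cls_multi R n 0 k mg) linear0 pairing0r mulr0.
by rewrite (delta_cls_HD0 hG mG nG (in_LD_gen g) mg gHD) mulr0.
Qed.

(** Members of a triple outside the subcomplex pair to zero with [x], so they may
    be counted as zero.  The diagrams of defect 1 outside the subcomplex impose
    no condition, as the differential preserves it. *)
Lemma HD_STU_IHX (x : LD R m n 0 k) : x \in HD R m n 0 k ->
  delta x = 0 <->
  STU_relation (in_HD (m := m)) x /\ IHX_relation (in_HD (m := m)) x.
Proof.
move=> xH; have supp N e (K : graph m N e) : ~~ in_HD K -> pairing (cls R n 0 k K) x = 0.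
  exact: pairing_HD0.
split=> [dx|[hS hI]].
  by split; [apply: cocycle_STU supp dx|apply: cocycle_IHX supp dx].
apply/pairing_eq0 => N e G hG mG G0.
have [HG|nG] := boolP (is_HD G); last exact: delta_HD0.
have [i [vi _]] := defect1_vertex hG.
have lG : link_diagram G by case/and3P: hG.
apply: (relations_cocycle supp hS hI hG HG G0 vi) => j; apply/eqP => E.
have [nl _] := (is_HDP G).1 HG; have := nl j.
have si := LD_kinds lG E; rewrite /is_loop eq_src_tgt E cards1 eqxx /=.
by have [h _] := mem_ends G j; move: h; rewrite E inE => /eqP ->; rewrite si.
Qed.

End HDComplex.

(** * Edges of split and contracted diagrams *)

Section Cycles.
Variable m : nat.
Implicit Types d N e : nat.

Lemma ends_eq2 N e (G : graph m N e) j x y : x \in ends G j -> y \in ends G j ->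
  x != y -> ends G j = [set x; y].
Proof. by move=> xj yj; have [->|//] := ends2 xj yj; rewrite eqxx. Qed.

Section SplitEnds.
Variables (N e : nat) (G : graph m N e) (i : 'I_N) (h : 'I_N.+1) (l : option 'I_m)
  (A : {set 'I_e}).

Lemma split_ends_far j x y : ends G j = [set x; y] -> x != y -> x != i -> y != i ->
  ends (split_vertex G i h l A) j = [set lift h x; lift h y].
Proof.
move=> E xy xi yi; apply: ends_eq2; rewrite ?(inj_eq lift_inj) //.
  by rewrite mem_split_old E !inE eqxx (negPf xi) andbF.
by rewrite mem_split_old E !inE eqxx orbT (negPf yi) andbF.
Qed.

Lemma split_ends_near j y : ends G j = [set i; y] -> y != i ->
  ends (split_vertex G i h l A) j = [set if j \in A then h else lift h i; lift h y].
Proof.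
move=> E yi; apply: ends_eq2.
- case: ifP => jA; first by rewrite mem_split_new jA E !inE eqxx.
  by rewrite mem_split_old jA E !inE eqxx.
- by rewrite mem_split_old E !inE eqxx orbT (negPf yi) andbF.
by case: ifP => _; rewrite ?neq_lift // (inj_eq lift_inj) eq_sym.
Qed.
End SplitEnds.

Lemma adj_ends N e (G : graph m N e) j x y : ends G j = [set x; y] -> adj G predT x y.
Proof. by move=> E; apply/existsP; exists j; rewrite E. Qed.

Section ContractEnds.
Variables (k N e : nat) (K : graph m N.+1 e.+1) (f : 'I_e.+1) (w : 'I_N.+1) (v : 'I_N).
Hypotheses (hK : in_LD 0 k K) (mK : ~~ multi_edge K).
Hypothesis (Ef : ends K f = [set lift w v; w]).
Let G : graph m N e := contract (del_edge K f) w v.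
Let mu x : 'I_N := merge_vertex w v x.
Let pair : {set 'I_N.+1} := [set lift w v; w].

Let delE j : @ends m N.+1 e (del_edge K f) j = ends K (lift f j).
Proof. exact: ends_del_edge. Qed.

Let memG y j : (y \in ends G j) = (y == v) && (w \in ends K (lift f j)) ||
  (lift w y \in ends K (lift f j)).
Proof. by rewrite -delE; apply: mem_contract. Qed.

Lemma mu_far x : x \notin pair -> lift w (mu x) = x /\ mu x != v.
Proof.
rewrite !inE negb_or => /andP[xv xw]; have E : lift w (mu x) = x by apply: merge_lt.
by split=> //; apply: contra xv => /eqP <-; rewrite E.
Qed.

Lemma far_edge j x y : ends K j = [set x; y] -> x != y -> x \notin pair -> y \notin pair ->
  exists j', ends G j' = [set mu x; mu y].
Proof.
move=> E xy xp yp; have [lx _] := mu_far xp; have [ly _] := mu_far yp.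
case: (unliftP f j) E => [j' ->|->] E; last by move: xp; rewrite /pair -Ef E !inE eqxx.
exists j'; apply: ends_eq2; rewrite ?memG ?lx ?ly ?E ?inE ?eqxx ?orbT //.
by apply: contra xy => /eqP E'; rewrite -lx E' ly.
Qed.

Lemma near_edge j u x : ends K j = [set u; x] -> u \in pair -> x \notin pair ->
  exists2 j', ends G j' = [set v; mu x] & j = lift f j'.
Proof.
move=> E up xp; have [lx mx] := mu_far xp.
case: (unliftP f j) E => [j' ->|->] E; last by move: xp; rewrite /pair -Ef E !inE eqxx orbT.
exists j' => //; apply: ends_eq2; last by rewrite eq_sym.
  rewrite memG eqxx E /=; move: up; rewrite !inE.
  by case/orP => /eqP ->; rewrite !eqxx ?orbT.
by rewrite memG lx E !inE eqxx !orbT.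
Qed.

(** Two edges that become parallel lead from the two ends of [f] to the same
    vertex. *)
Lemma contract_multi : multi_edge G ->
  exists y, [/\ y \notin pair, adj K predT (lift w v) y & adj K predT w y].
Proof.
case/existsP => a /existsP[b /and3P[ab st /eqP Eab]].
have key y z : y != z -> ends G a = [set y; z] -> z != v -> exists y,
    [/\ y \notin pair, adj K predT (lift w v) y & adj K predT w y].
  move=> yz Ea zv; have Eb : ends G b = [set y; z] by rewrite -Eab.
  have nm u1 u2 : u1 != u2 -> ends K (lift f a) = [set u1; u2] ->
      ends K (lift f b) = [set u1; u2] -> False.
    move=> u12 E1 E2; case/negP: mK; apply/existsP; exists (lift f a).
    apply/existsP; exists (lift f b); rewrite (inj_eq lift_inj) ab E1 E2 eqxx.
    by rewrite eq_src_tgt E1 cards2 u12.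
  have za : lift w z \in ends K (lift f a).
    by have := memG z a; rewrite Ea !inE eqxx orbT (negPf zv).
  have zb : lift w z \in ends K (lift f b).
    by have := memG z b; rewrite Eb !inE eqxx orbT (negPf zv).
  have zp : lift w z \notin pair.
    by rewrite !inE (inj_eq lift_inj) (negPf zv) eq_sym (negPf (neq_lift _ _)).
  have [yv|yv] := eqVneq y v; last first.
    case: (nm (lift w y) (lift w z)); rewrite ?(inj_eq lift_inj) //.
      apply: ends_eq2; rewrite ?(inj_eq lift_inj) //.
      by have := memG y a; rewrite Ea !inE eqxx (negPf yv).
    apply: ends_eq2; rewrite ?(inj_eq lift_inj) //.
    by have := memG y b; rewrite Eb !inE eqxx (negPf yv).
  have va : (w \in ends K (lift f a)) || (lift w v \in ends K (lift f a)).
    by have := memG v a; rewrite -{1}yv Ea !inE !eqxx.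
  have vb : (w \in ends K (lift f b)) || (lift w v \in ends K (lift f b)).
    by have := memG v b; rewrite -{1}yv Eb !inE !eqxx.
  have wz : w != lift w z by apply: neq_lift.
  have vz : lift w v != lift w z by rewrite (inj_eq lift_inj) eq_sym.
  exists (lift w z); case/orP: va => ha; case/orP: vb => hb; split=> //;
    try by [apply: adj_ends (ends_eq2 ha za _) | apply: adj_ends (ends_eq2 hb zb _)].
  - by case: (nm w (lift w z)); rewrite // ?(ends_eq2 ha za) // (ends_eq2 hb zb).
  by case: (nm (lift w v) (lift w z)); rewrite // ?(ends_eq2 ha za) // (ends_eq2 hb zb).
have Ea : ends G a = [set src G a; tgt G a] by [].
have [tv|tv] := eqVneq (tgt G a) v; last exact: key st Ea tv.
apply: (key (tgt G a) (src G a)); first by rewrite eq_sym.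
  by rewrite setUC.
by rewrite -tv.
Qed.

End ContractEnds.
End Cycles.

(** * Cycles through a resolved edge *)

Section ResolvedCycles.
Variable m : nat.
Implicit Types d N e : nat.

Lemma path_map_in (T T' : Type) (r : rel T) (r' : rel T') (g : T -> T') (P : pred T) :
  (forall x y, P x -> P y -> r x y -> r' (g x) (g y)) ->
  forall x p, all P (x :: p) -> path r x p -> path r' (g x) (map g p).
Proof.
move=> h x p; elim: p x => [//|y p IH] x /= /and3P[Px Py Pp] /andP[xy hp].
by rewrite h //= IH //= Py.
Qed.

Section Step.
Variables (k N e : nat) (K : graph m N.+1 e.+1) (f : 'I_e.+1) (w : 'I_N.+1) (v : 'I_N).
Hypotheses (hK : in_LD 0 k K) (mK : ~~ multi_edge K).
Hypothesis (Ef : ends K f = [set lift w v; w]).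
Let G : graph m N e := contract (del_edge K f) w v.
Let mu x : 'I_N := merge_vertex w v x.
Let far : pred 'I_N.+1 := [pred x | x \notin [set lift w v; w]].

Let adjK_ends x y : adj K predT x y -> x != y /\ exists j, ends K j = [set x; y].
Proof.
case/existsP => j /eqP E; split; last by exists j.
by apply: contraNneq (tri_noloop hK j x) => xy; rewrite E -xy setUid.
Qed.

Let mu_inj x y : far x -> far y -> mu x = mu y -> x = y.
Proof. by move=> /mu_far[lx _] /mu_far[ly _] E; rewrite -lx -ly; congr lift. Qed.

Section Split.
Variables (h : 'I_N.+1) (l : option 'I_m) (A : {set 'I_e}).
Let S := split_vertex G v h l A.
Let theta x := lift h (mu x).

Lemma theta_inj x y : far x -> far y -> theta x = theta y -> x = y.
Proof. by move=> fx fy /lift_inj; apply: mu_inj. Qed.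

Lemma theta_new x : far x -> (theta x != h) && (theta x != lift h v).
Proof.
move=> /mu_far[_ nx]; rewrite [_ == h]eq_sym neq_lift /=.
by rewrite (inj_eq lift_inj).
Qed.

Lemma split_adj_far x y : far x -> far y -> adj K predT x y ->
  exists j, ends S j = [set theta x; theta y].
Proof.
move=> fx fy /adjK_ends[xy [j E]]; have [j' E'] := far_edge Ef E xy fx fy.
have [[_ nx] [_ ny]] := (mu_far fx, mu_far fy).
exists j'; apply: split_ends_far => //.
by apply: contra xy => /eqP /(mu_inj fx fy) ->.
Qed.

Lemma loc_theta x : far x -> loc S (theta x) = loc K x.
Proof.
by move=> /mu_far[lx _]; rewrite loc_split_old loc_contract /mu -[in RHS]lx.
Qed.
End Split.

Lemma ends_blow_up_old (A : {set 'I_e}) j :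
  ends (blow_up G v A) (lift ord_max j) = ends (split_vertex G v ord_max None A) j.
Proof. by rewrite -ends_del_edge /blow_up del_add_edge. Qed.

Let theta x := lift ord_max (mu x).

Lemma blow_up_path (A : {set 'I_e}) x p : all far (x :: p) -> path (adj K predT) x p ->
  path (adj (blow_up G v A) predT) (theta x) (map theta p).
Proof.
apply: path_map_in => y z fy fz /(split_adj_far ord_max None A fy fz)[j E].
by apply: (adj_ends (j := lift ord_max j)); rewrite ends_blow_up_old.
Qed.

Lemma blow_up_near (A : {set 'I_e}) a x : far x -> ends G a = [set v; mu x] ->
  adj (blow_up G v A) predT (if a \in A then ord_max else lift ord_max v) (theta x).
Proof.
move=> /mu_far[_ nx] Ea; apply: (adj_ends (j := lift ord_max a)).
by rewrite ends_blow_up_old; apply: split_ends_near.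
Qed.

(** Separating the two edges of a cycle at the contracted edge puts the new
    edge on the cycle. *)
Lemma resolved_cycle (A : {set 'I_e}) a b x p : all far (x :: p) -> uniq (x :: p) ->
  path (adj K predT) x p -> ends G a = [set v; mu x] ->
  ends G b = [set v; mu (last x p)] -> a \in A -> b \notin A ->
  let s := [:: lift ord_max v, ord_max & map theta (x :: p)] in
  path.cycle (adj (blow_up G v A) predT) s /\ uniq s.
Proof.
move=> fp up hp Ea Eb aA bA s.
have fl : far (last x p) by apply: (allP fp); apply: mem_last.
have fx : far x by case/andP: fp.
split.
  rewrite /s /= rcons_path last_map; apply/and4P; split.
  - apply: (adj_ends (j := ord_max)); exact: ends_blow_up_new.
  - by have := blow_up_near A fx Ea; rewrite aA.
  - exact: blow_up_path.
  by rewrite adj_sym; have := blow_up_near A fl Eb; rewrite (negPf bA).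
have th y : y \in map theta (x :: p) -> (y != ord_max) && (y != lift ord_max v).
  by case/mapP => z /(allP fp) fz ->; apply: theta_new.
have um : uniq (map theta (x :: p)).
  by rewrite map_inj_in_uniq // => y z /(allP fp) fy /(allP fp) fz; apply: (@theta_inj ord_max).
rewrite /s 2!cons_uniq um andbT in_cons negb_or eq_sym neq_lift /=.
apply/andP; split.
- by apply/negP => /th; rewrite eqxx andbF.
by apply/negP => /th; rewrite eqxx.
Qed.

(** Doubling a vertex on a cycle gives two vertices of a segment joined by the
    rest of the cycle. *)
Lemma doubled_notHD (A : {set 'I_e}) a b x p : all far (x :: p) ->
  all (fun y => ~~ seg K y) (x :: p) -> path (adj K predT) x p -> seg G v ->
  ends G a = [set v; mu x] -> ends G b = [set v; mu (last x p)] ->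
  (a \in A) != (b \in A) -> ~~ is_HD (double_vertex G v A).
Proof.
move=> fp sp hp sv Ea Eb ab; set h := lift ord0 v; set D := double_vertex G v A.
have [s ls] : exists s, loc G v = Some s.
  by move: sv; rewrite /seg; case: loc => // s _; exists s.
have lh : loc D h = Some s by rewrite -ls; exact: loc_split_new.
have lv : loc D (lift h v) = Some s by rewrite -ls; exact: loc_split_old.
have hv : h != lift h v by apply: neq_lift.
apply/negP => /is_HDP[_ /(_ s _ _ hv lh lv)]; apply/negP; rewrite negbK.
pose th y := lift h (mu y).
pose u c := if c \in A then h else lift h v.
have nu c : near_seg D s (u c).
  by rewrite /near_seg /u; case: ifP => _; rewrite ?lh ?lv eqxx orbT.
have nth y : far y -> ~~ seg K y -> near_seg D s (th y).
  move=> fy; rewrite /seg negbK => /eqP ly; apply/orP; left; apply/eqP.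
  by rewrite -ly; exact: loc_theta.
have near c y : far y -> ~~ seg K y -> ends G c = [set v; mu y] ->
    adj D (near_seg D s) (u c) (th y).
  move=> fy sy Ec; rewrite /adj nu nth //=; apply/existsP; exists c.
  by apply/eqP; apply: split_ends_near => //; case: (mu_far fy).
have fl : far (last x p) by apply: (allP fp); apply: mem_last.
have sl : ~~ seg K (last x p) by apply: (allP sp); apply: mem_last.
have fx : far x by case/andP: fp.
have sx : ~~ seg K x by case/andP: sp.
have hpath : path (adj D (near_seg D s)) (th x) (map th p).
  have fsp : all (predI far (fun y => ~~ seg K y)) (x :: p) by rewrite all_predI fp sp.
  apply: path_map_in fsp hp => y z /andP[fy sy] /andP[fz sz].
  move=> /(split_adj_far h (loc G v) A fy fz)[j E].
  by rewrite /adj !nth //=; apply/existsP; exists j; rewrite E.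
have cab : connect (adj D (near_seg D s)) (u a) (u b).
  apply: connect_trans (connect1 (near a x fx sx Ea)) _.
  apply: (connect_trans (y := th (last x p))).
    by apply/connectP; exists (map th p); rewrite ?last_map.
  by rewrite connect_adj_sym; apply: connect1; apply: near.
move: cab ab; rewrite /u; case: (a \in A); case: (b \in A) => //= + _.
by rewrite connect_adj_sym.
Qed.

End Step.
End ResolvedCycles.

(** * Cocycles of homotopy link diagrams and cycles *)

Section CycleVanishing.
Variables (R : realType) (m n k : nat).
Implicit Types d N e : nat.
Local Notation delta := (delta R m n 0 k).
Local Notation cls0 := (cls R n 0 k).
Local Notation cls1 := (cls R n 1 k).
Local Notation eps_arc := (eps_arc R).
Local Notation eps_edge := (eps_edge R n).

(** The identity of the contraction lifts, for the distribution of the edges over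
    the ends of [f] that is found in [K]. *)
Lemma blow_up_contract N e (K : graph m N.+1 e.+1) f (w : 'I_N.+1) (v : 'I_N) :
  in_LD 0 k K -> ~~ multi_edge K -> is_free_edge K f || is_mixed K f ->
  (v < w)%N -> ends K f = [set lift w v; w] ->
  relabeling (blow_up (contract (del_edge K f) w v) v (upper K f w 1)) K
    (lift_perm ord_max w 1) (lift_perm ord_max f 1).
Proof.
move=> hK mK kf vw Ef; set G := contract _ w v.
have r1 : relabeling G G 1 1 by apply: relabeling1.
have su : upper K f w 1 \subset star G v.
  by apply: (@upper_sub m N e G v K f w v 1 1 r1); rewrite perm1.
by apply/(blow_up_relabP hK mK kf vw Ef 1 1 su); rewrite perm1.
Qed.

Lemma sgn_unit N e (G H : graph m N e) q (a : R) : sgn R n G H q * a = 0 -> a = 0.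
Proof. by move=> h; rewrite -[a]mul1r -(sgnK R n G H q) -mulrA h mulr0. Qed.

Lemma pairing_relab0 d N e (G H : graph m N e) p t (x : LD R m n d k) :
  relabeling G H p t -> pairing (cls R n d k G) x = 0 -> pairing (cls R n d k H) x = 0.
Proof.
move=> r; rewrite (cls_sgn R n d k (q := (p, t)) r) pairingZl.
exact: sgn_unit.
Qed.

(** Segment vertices of trivalent diagrams have a single edge. *)
Lemma two_neighbours_free N e (K : graph m N e) j x y :
  in_LD 0 k K -> x != y -> adj K predT j x -> adj K predT j y -> ~~ seg K j.
Proof.
move=> hK xy /existsP[a /eqP Ea] /existsP[b /eqP Eb]; apply/negP => sj.
have := tri_star hK j; rewrite sj => /eqP/cards1P[z zE].
have az : a \in star K j by rewrite inE Ea !inE eqxx.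
have bz : b \in star K j by rewrite inE Eb !inE eqxx.
move: az bz; rewrite zE !inE => /eqP ab /eqP ba.
have E : [set j; x] = [set j; y] by rewrite -Ea -Eb ab ba.
have jx : x != j by apply: contraNneq (tri_noloop hK a j) => E'; rewrite Ea E' setUid.
have : x \in [set j; y] by rewrite -E !inE eqxx orbT.
by rewrite !inE (negPf jx) (negPf xy).
Qed.

Lemma cycle_free N e (K : graph m N e) s j : in_LD 0 k K ->
  path.cycle (adj K predT) s -> uniq s -> (2 < size s)%N -> j \in s -> ~~ seg K j.
Proof.
move=> hK cs us ss js; have [i s' E] := rot_to js.
have := cs; rewrite -(rot_cycle i) E; have := us; rewrite -(rot_uniq i) E.
have : (2 < size (rot i s))%N by rewrite size_rot.
rewrite E; case: s' {E} => [//|x [//|y p]] _ /= /and3P[_ xs _].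
rewrite rcons_path => /and4P[jx _ _ lj].
apply: (two_neighbours_free (x := x) (y := last y p) hK) => //; last by rewrite adj_sym.
by apply: contraNneq xs => ->; apply: mem_last.
Qed.

Variable x : LD R m n 0 k.
Hypotheses (xHD : x \in HD R m n 0 k) (dx : delta x = 0).

Let eps_edge0 N e (G : graph m N e) j a : eps_edge G j * a = 0 -> a = 0.
Proof.
by case: (eps_edgeP R n G j) => ->; rewrite ?mul1r // mulN1r => /eqP; rewrite oppr_eq0 => /eqP.
Qed.

Let first_summand (P a b c X Y Z : R) :
  P = a * X + (b * Y + c * Z) -> P = 0 -> Y = 0 -> Z = 0 -> a * X = 0.
Proof. by move=> -> + Y0 Z0; rewrite Y0 Z0 !mulr0 !addr0. Qed.

Let dx0 N e (G : graph m N e) : pairing (cls1 G) (delta x) = 0.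
Proof. by rewrite dx pairing0r. Qed.

Let vanish N e (K : graph m N e) : Prop :=
  in_LD 0 k K -> ~~ multi_edge K -> pairing (cls0 K) x = 0.

Let vanishP N e (K : graph m N e) : vanish K -> pairing (cls0 K) x = 0.
Proof.
move=> h; have [hK|hK] := boolP (in_LD 0 k K); last by rewrite cls_notin // pairing0l.
have [mK|mK] := boolP (multi_edge K); last exact: h.
by rewrite (cls_multi R n 0 k mK) pairing0l.
Qed.

Section Step.
Variables (N e : nat) (K : graph m N.+1 e.+1) (f : 'I_e.+1) (w : 'I_N.+1) (v : 'I_N).
Hypotheses (hK : in_LD 0 k K) (mK : ~~ multi_edge K).
Hypotheses (kf : is_free_edge K f || is_mixed K f) (vw : (v < w)%N).
Hypothesis (Ef : ends K f = [set lift w v; w]).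
Let G : graph m N e := contract (del_edge K f) w v.
Hypothesis mG : ~~ multi_edge G.
Let mu y : 'I_N := merge_vertex w v y.

Variables (j l x1 : 'I_N.+1) (p : seq 'I_N.+1).
Hypotheses (Ejl : [set lift w v; w] = [set j; l]) (jl : j != l).
Hypotheses (js : j \notin x1 :: p) (ls : l \notin x1 :: p) (us : uniq (x1 :: p)).
Hypotheses (sz : (0 < size p)%N) (jx : adj K predT j x1) (hp : path (adj K predT) x1 p).
Hypothesis (xj : adj K predT (last x1 p) j).

Let hG : in_LD 1 k G. Proof. exact: contract_edge_LD hK mK kf vw Ef. Qed.
Let lK : link_diagram K. Proof. by case/and3P: hK. Qed.

Let far y : y \in x1 :: p -> y \notin [set lift w v; w].
Proof.
move=> ys; rewrite Ejl !inE negb_or.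
by rewrite (memPn js y ys) (memPn ls y ys).
Qed.

Let vG : valence G v = 4%N.
Proof.
have [i [vi _]] := defect1_vertex hG; have [<- //|ne] := eqVneq i v.
by move: vi; rewrite (contract_edge_valence hK Ef ne).
Qed.

Let jpair : j \in [set lift w v; w]. Proof. by rewrite Ejl !inE eqxx. Qed.
Let lpair : l \in [set lift w v; w]. Proof. by rewrite Ejl !inE eqxx orbT. Qed.

Let cyc_edges : exists a b, [/\ a != b, ends G a = [set v; mu x1],
  ends G b = [set v; mu (last x1 p)],
  ends K (lift f a) = [set j; x1] & ends K (lift f b) = [set j; last x1 p]].
Proof.
have h1 : x1 \in x1 :: p by rewrite inE eqxx.
have h2 : last x1 p \in x1 :: p by apply: mem_last.
have ne : x1 != last x1 p.
  move: us sz; case: (p) => [//|y q] /= /andP[xq _] _.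
  by apply: contraNneq xq => ->; apply: mem_last.
have [/existsP[a0 /eqP Ea] /existsP[b0 /eqP Eb]] := (jx, xj).
rewrite setUC in Eb.
have [a Ga aE] := near_edge Ef Ea jpair (far h1).
have [b Gb bE] := near_edge Ef Eb jpair (far h2).
exists a, b; rewrite -aE -bE; split=> //.
apply: contra ne => /eqP ab; have E : [set j; x1] = [set j; last x1 p].
  by rewrite -Ea -Eb aE bE ab.
have : x1 \in [set j; last x1 p] by rewrite -E !inE eqxx orbT.
rewrite !inE => /orP[/eqP E'|//]; by case/negP: js; rewrite -E' in_cons eqxx.
Qed.

Let in_starG y z : ends G y = [set v; z] -> y \in star G v.
Proof. by move=> E; rewrite inE E !inE eqxx. Qed.

(** The edge [f] joins the cycle to a segment: [K] is the term S of an STU triple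
    whose terms T and U are not homotopy link diagrams. *)
Lemma step_seg : seg K l -> pairing (cls0 K) x = 0.
Proof.
move=> sl; have [a [b [ab Ga Gb Ka Kb]]] := cyc_edges.
have nw : ~~ seg K w := contracted_free lK kf vw Ef.
have [lE jE] : l = lift w v /\ j = w.
  have : w \in [set j; l] by rewrite -Ejl !inE eqxx orbT.
  rewrite !inE => /orP[/eqP wj|/eqP wl]; last by rewrite wl sl in nw.
  split=> //; move: lpair; rewrite !inE => /orP[/eqP //|/eqP lw].
  by case/eqP: jl; rewrite lw wj.
have sv : seg G v by rewrite seg_contract -[seg _ _]/(seg K (lift w v)) -lE.
have as_ := in_starG Ga; have bs := in_starG Gb.
have [[]|[_ [a' [b' [ab' sE nl]]]]|[_ [j0 [E0 sE]]]] :=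
  four_valent_cases (proj1 (andP hG)) vG.
- by rewrite sv.
- have {}sE : star G v = [set a; b].
    apply/eqP; rewrite eq_sym eqEcard subUset !sub1set as_ bs sE !cards2 ab.
    by case: (a' != b').
  have fs : all [pred y | y \notin [set lift w v; w]] (x1 :: p).
    by apply/allP => y /far.
  have cyc : path.cycle (adj K predT) (j :: x1 :: p) by rewrite /= jx rcons_path hp xj.
  have fr : all (fun y => ~~ seg K y) (x1 :: p).
    apply/allP => y ys; apply: (cycle_free hK cyc) => //.
    + by rewrite cons_uniq js us.
    + by rewrite in_cons ys orbT.
  have dbl (A : {set 'I_e}) : (a \in A) != (b \in A) -> pairing (cls0 (double_vertex G v A)) x = 0.
    by move=> dA; apply: pairing_HD0 xHD _; apply: (doubled_notHD hK Ef fs fr hp sv Ga Gb dA).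
  have Tb : pairing (cls0 (double_vertex G v [set b])) x = 0.
    by apply: dbl; rewrite !in_set1 eqxx; move: ab; case: (a == b).
  have Ua : pairing (cls0 (double_vertex G v [set a])) x = 0.
    by apply: dbl; rewrite !in_set1 eqxx [b == a]eq_sym; move: ab; case: (a == b).
  have /eps_edge0 := first_summand (adjunction_seg hG mG sv vG ab sE nl x) (dx0 G) Tb Ua.
  apply: pairing_relab0.
  have -> : [set a; b] = upper K f w 1; last exact: blow_up_contract.
  have au : a \in upper K f w 1.
    by rewrite /upper in_set perm1 ends_del_edge Ka jE !inE eqxx.
  have bu : b \in upper K f w 1.
    by rewrite /upper in_set perm1 ends_del_edge Kb jE !inE eqxx.
  apply/eqP; rewrite eqEcard subUset !sub1set au bu cards2 ab.
  by rewrite (card_upper 1 hK nw Ef).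
by move: as_ bs ab; rewrite sE !inE => /eqP -> /eqP ->; rewrite eqxx.
Qed.

Variables (l2 : 'I_N.+1) (q : seq 'I_N.+1).
Hypotheses (ll2 : adj K predT l l2) (jq : j \notin l2 :: q) (lq : l \notin l2 :: q).
Hypotheses (uq : uniq (l2 :: q)) (hq : path (adj K predT) l2 q) (sq : seg K (last l2 q)).

Hypothesis IH : forall N' e' (K' : graph m N' e') s' j' p',
  (size p' <= size (l2 :: q))%N ->
  in_LD 0 k K' -> ~~ multi_edge K' -> path.cycle (adj K' predT) s' -> uniq s' ->
  (2 < size s')%N -> j' \in s' -> path (adj K' predT) j' p' -> uniq (j' :: p') ->
  seg K' (last j' p') -> pairing (cls0 K') x = 0.

(** The edge [f] leads from the cycle to a free vertex: [K] belongs to an IHX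
    triple.  The other two members separate the edges [a] and [b] of the cycle,
    so that the new edge lies on the cycle and one of its ends is adjacent to
    [l2]: the path to the segments has become shorter. *)
Lemma step_free : ~~ seg K l -> pairing (cls0 K) x = 0.
Proof.
move=> nl; have [a [b [ab Ga Gb Ka Kb]]] := cyc_edges.
have fs : all [pred y | y \notin [set lift w v; w]] (x1 :: p).
  by apply/allP => y /far.
have fq : all [pred y | y \notin [set lift w v; w]] (l2 :: q).
  apply/allP => y yq; rewrite inE Ejl !inE negb_or.
  by rewrite (memPn jq y yq) (memPn lq y yq).
have [g Gg] : exists g, ends G g = [set v; mu l2].
  have /existsP[g0 /eqP Eg] := ll2.
  have fl2 : l2 \notin [set lift w v; w] by case/andP: fq.
  by have [g Gg _] := near_edge Ef Eg lpair fl2; exists g.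
pose theta y := lift ord_max (mu y).
have zero (A : {set 'I_e}) : a \in A -> b \notin A -> pairing (cls0 (blow_up G v A)) x = 0.
  move=> aA bA; apply: vanishP => hB mB.
  have [cs cu] := resolved_cycle hK Ef fs us hp Ga Gb aA bA.
  pose u := if g \in A then ord_max else lift ord_max v.
  have fl2 : l2 \notin [set lift w v; w] by case/andP: fq.
  apply: (IH (p' := map theta (l2 :: q)) (j' := u) _ hB mB cs cu).
  - by rewrite size_map.
  - by [].
  - by rewrite /u; case: ifP; rewrite !inE eqxx ?orbT.
  - rewrite /= (blow_up_path hK Ef A fq hq) andbT.
    exact: (blow_up_near A fl2 Gg).
  - rewrite cons_uniq map_inj_in_uniq ?uq ?andbT.
      apply/mapP => -[y yq E]; have := theta_new ord_max (allP fq y yq).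
      by rewrite -/(mu y) -/(theta y) -E /u; case: ifP; rewrite eqxx ?andbF.
    by move=> y z /(allP fq) fy /(allP fq) fz; apply: (@theta_inj _ _ _ ord_max).
  rewrite -[last u _]/(last (theta l2) (map theta q)) last_map /seg.
  have fl : last l2 q \notin [set lift w v; w] by apply: (allP fq); apply: mem_last.
  have := loc_theta K f ord_max None A fl; rewrite /loc => ->; exact: sq.
have nv : ~~ seg G v.
  rewrite seg_contract -[seg _ _]/(seg K (lift w v)).
  have nw : ~~ seg K w := contracted_free lK kf vw Ef.
  have cyc : path.cycle (adj K predT) (j :: x1 :: p) by rewrite /= jx rcons_path hp xj.
  have nj : ~~ seg K j.
    apply: (cycle_free hK cyc); rewrite ?inE ?eqxx //; first by rewrite cons_uniq js us.
  by have : lift w v \in [set j; l] by [rewrite -Ejl !inE eqxx]; rewrite !inE => /orP[]/eqP ->.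
have as_ := in_starG Ga; have bs := in_starG Gb.
have s4 : #|star G v| = 4%N by rewrite -(valence_free (proj1 (andP hG)) nv).
pose A := [set a; b]; have As : A \subset star G v by rewrite subUset !sub1set as_ bs.
have cA : #|A| = 2%N by rewrite cards2 ab.
have cB : #|star G v :\: A| = 2%N by rewrite cardsD (setIidPr As) s4 cA.
have /cards2P[c [d [cd Bcd]]] : #|star G v :\: A| == 2%N by rewrite cB.
have sE : star G v = [set a; b; c; d].
  rewrite -(setID (star G v) A) (setIidPr As) Bcd /A.
  by apply/setP => y; rewrite !inE !orbA.
have cin : (c \in star G v :\: A) && (d \in star G v :\: A).
  by rewrite Bcd !inE !eqxx orbT.
move: cin; rewrite !in_setD /A !in_set2 !negb_or => /andP[/andP[/andP[ca cb] _] /andP[/andP[da db] _]].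
have u4 : uniq [:: a; b; c; d].
  by rewrite /= !inE !negb_or ab cd !andbT [a == c]eq_sym [a == d]eq_sym [b == c]eq_sym [b == d]eq_sym ca cb da db.
have H0 : pairing (cls0 (blow_up G v [set a; c])) x = 0.
  by apply: zero; rewrite !inE ?eqxx // negb_or eq_sym ab eq_sym cb.
have X0 : pairing (cls0 (blow_up G v [set a; d])) x = 0.
  by apply: zero; rewrite !inE ?eqxx // negb_or eq_sym ab eq_sym db.
have adj3 := etrans (adjunction_free hG mG nv vG u4 sE x) (esym (addrA _ _ _)).
have BA0 := eps_edge0 (first_summand adj3 (dx0 G) H0 X0).
have nw : ~~ seg K w := contracted_free lK kf vw Ef.
have cU := card_upper 1 hK nw Ef.
have rU := blow_up_contract hK mK kf vw Ef; rewrite -/G in rU.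
have sU : upper K f w 1 \subset star G v.
  by apply: (@upper_sub m N e G v K f w v 1 1); rewrite ?perm1 //; apply: relabeling1.
have memU y z u : ends K (lift f y) = [set u; z] -> z \notin [set lift w v; w] ->
    (y \in upper K f w 1) = (w == u).
  move=> E zf; rewrite /upper in_set perm1 ends_del_edge E !inE.
  move: zf; rewrite !inE negb_or => /andP[_ zw]; by rewrite [w == z]eq_sym (negPf zw) orbF.
have fx1 : x1 \notin [set lift w v; w] by apply: far; rewrite inE eqxx.
have fx2 : last x1 p \notin [set lift w v; w] by apply: far; apply: mem_last.
have aU := memU _ _ _ Ka fx1; have bU := memU _ _ _ Kb fx2.
(* The edges at the upper end of [f] are those of the cycle if that end is [j],
   and the other two if it is [l]. *)
have [wj|wj] := eqVneq w j.
  have UA : upper K f w 1 = A.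
    apply/eqP; rewrite eq_sym eqEcard subUset !sub1set aU bU wj eqxx /=.
    by rewrite -[X in upper _ _ X _]wj cU cA.
  by rewrite UA in rU; apply: pairing_relab0 rU BA0.
have UA : upper K f w 1 = star G v :\: A.
  apply/eqP; rewrite eqEcard cB cU leqnn andbT subsetD sU /=.
  rewrite disjoint_sym disjoints_subset subUset !sub1set !in_setC aU bU.
  by rewrite (negPf wj).
have [rs _] := blow_up_swap R n As nv.
rewrite UA in rU; apply: pairing_relab0 rU _.
exact: pairing_relab0 (relab_inv rs) BA0.
Qed.

End Step.
(** Induction on the length of a path from the cycle to a segment.  If its first
    step stays on the cycle, the rest of the path will do.  If contracting the
    first edge creates parallel edges, that edge lies on a triangle, and the rest
    of the path starts on it.  Otherwise one of the two steps above applies. *)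
Lemma near_cycle_vanish d N e (K : graph m N e) s j p : (size p <= d)%N ->
  in_LD 0 k K -> ~~ multi_edge K -> path.cycle (adj K predT) s -> uniq s ->
  (2 < size s)%N -> j \in s -> path (adj K predT) j p -> uniq (j :: p) ->
  seg K (last j p) -> pairing (cls0 K) x = 0.
Proof.
elim: d N e K s j p => [|d IHd] N e K s j p sp hK mK cs us ss js hp up sl;
  have nj := cycle_free hK cs us ss js.
  by case: p sp hp up sl => //= _ _ _ sj; rewrite sj in nj.
case: p sp hp up sl => [|l p] sp hp up sl; first by rewrite /= in sl; rewrite sl in nj.
have /= /andP[jl hp'] := hp.
have up' : uniq (l :: p) by case/andP: up.
have [lin|lout] := boolP (l \in s); first exact: IHd sp hK mK cs us ss lin hp' up' sl.
case: N K hK mK s cs us ss j js l p sp hp up sl nj jl hp' up' lout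
  => [|N] K hK mK s cs us ss j js l p sp hp up sl nj jl hp' up' lout; first by case: j {js hp up sl nj jl}.
have [f Ef] : exists f, ends K f = [set j; l] by case/existsP: jl => f /eqP; exists f.
case: e f K Ef hK mK cs hp sl nj jl hp' => [|e] f K Ef hK mK cs hp sl nj jl hp'; first by case: f {Ef}.
have jnl : j != l by move: up; rewrite /= inE negb_or => /andP[/andP[]].
have [w [v [vw Ewv]]] := ends_ordered (tri_src_tgt hK f).
have Ejl : [set lift w v; w] = [set j; l] by rewrite -Ewv.
have kf : is_free_edge K f || is_mixed K f.
  rewrite /is_free_edge /is_mixed (tri_src_tgt hK).
  have : j \in ends K f by rewrite Ef !inE eqxx.
  by rewrite !inE => /orP[]/eqP E; move: nj; rewrite E; case: (seg K (src K f)); case: (seg K (tgt K f)).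
have [mG|mG] := boolP (multi_edge (contract (del_edge K f) w v : graph m N e)).
  (* The triangle on [j], [y] and [l]. *)
  have [y [yp y1 y2]] := contract_multi mK mG.
  have adjy u : u \in [set lift w v; w] -> adj K predT u y.
    by rewrite !inE => /orP[]/eqP ->.
  have jy : adj K predT j y by apply: adjy; rewrite Ejl !inE eqxx.
  have ly : adj K predT l y by apply: adjy; rewrite Ejl !inE eqxx orbT.
  move: yp; rewrite Ejl !inE negb_or => /andP[yj yl].
  apply: (IHd _ _ K [:: j; y; l] l p sp hK mK) => //.
  - by rewrite /= jy [adj K _ y l]adj_sym ly [adj K _ l j]adj_sym jl.
  - by rewrite /= !inE negb_or eq_sym yj jnl yl.
  by rewrite !inE eqxx !orbT.
have [i s' Es] := rot_to js.
have := cs; rewrite -(rot_cycle i) Es; have := us; rewrite -(rot_uniq i) Es.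
have ss' : (2 < size (rot i s))%N by rewrite size_rot.
have lout' : l \notin rot i s by rewrite mem_rot.
rewrite Es in ss' lout'; move: ss' lout'; case: s' {Es} => [//|x1 p0] /=; rewrite !ltnS => sz.
rewrite inE negb_or => /andP[_ ls] /andP[js0 us0].
rewrite rcons_path => /and3P[jx hp0 xj].
have [sl'|nl] := boolP (seg K l).
  exact: (step_seg hK mK kf vw Ewv mG Ejl jnl js0 ls us0 sz jx hp0 xj sl').
case: p sp hp up sl hp' up' => [|l2 q] sp hp up sl hp' up'; first by rewrite /= in sl; rewrite sl in nl.
have /= /andP[ll2 hq] := hp'; have /andP[lq uq] := up'.
have jq : j \notin l2 :: q by move: up; rewrite /= inE negb_or => /andP[/andP[]].
apply: (step_free hK mK kf vw Ewv mG Ejl js0 ls us0 sz jx hp0 xj ll2 jq lq uq hq sl _ nl).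
move=> N' e' K' s1 j' p1 sp1; apply: IHd; apply: leq_trans sp1 _.
by rewrite -ltnS.
Qed.

(** A cycle with a single vertex is a loop, and with two vertices a double edge. *)
Lemma has_cycle_seq N e (K : graph m N e) : in_LD 0 k K -> ~~ multi_edge K ->
  has_cycle K -> exists s, [/\ path.cycle (adj K predT) s, uniq s & (2 < size s)%N].
Proof.
move=> hK mK [r [y [c [yI cI Ec]]]].
have r0 : r != 0%N.
  apply/eqP => E; subst r; have := tri_noloop hK (c ord0) (y ord0).
  rewrite Ec (_ : ordS ord0 = ord0) ?setUid ?eqxx //.
  exact: ord_inj.
have r1 : r != 1%N.
  apply/eqP => E; subst r; case/negP: mK; apply/existsP; exists (c ord0).
  apply/existsP; exists (c (ordS ord0)); rewrite (tri_src_tgt hK) /= (inj_eq cI) !Ec.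
  rewrite (_ : ordS (ordS ord0) = ord0); last exact: ord_inj.
  by rewrite setUC eqxx andbT.
pose g i : 'I_N := y (inord i).
exists (mkseq g r.+1); rewrite size_mkseq; split; last by lia.
  rewrite /mkseq /=; apply/(pathP (g 0%N)) => i.
  rewrite size_rcons size_map size_iota ltnS => ir.
  have e1 : nth (g 0%N) (g 0%N :: rcons [seq g i | i <- iota 1 r] (g 0%N)) i = g i.
    case: i ir => [//|i] ir /=; rewrite nth_rcons size_map size_iota ir.
    by rewrite (nth_map 0%N) ?size_iota // nth_iota.
  rewrite e1 nth_rcons size_map size_iota.
  have -> : (if (i < r)%N then nth (g 0%N) [seq g i | i <- iota 1 r] i
     else if i == r then g 0%N else g 0%N) = y (ordS (inord i)).
    case: ltngtP ir => // [ir|ir] _.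
      rewrite (nth_map 0%N) ?size_iota // nth_iota //; congr y; apply: ord_inj.
      by rewrite inordK ?ltnS // /= inordK ?modn_small // ltnS ltnW.
    congr y; apply: ord_inj; rewrite inordK // /= inordK ?ir // modnn.
    by [].
  by apply: (adj_ends (j := c (inord i))).
rewrite map_inj_in_uniq ?iota_uniq // => a b; rewrite !mem_iota !add0n /= => ha hb /yI E.
by rewrite -(inordK ha) -(inordK hb) E.
Qed.

Lemma cocycle_H1T : H1T_relation x.
Proof.
move=> N e K hK cK; have [mK|mK] := boolP (multi_edge K).
  by rewrite (cls_multi R n 0 k mK) pairing0l.
have [s [cs us ss]] := has_cycle_seq hK mK cK.
have [j js] : exists j, j \in s by case: s ss {cs us} => [//|j s]; exists j; rewrite inE eqxx.
have nj := cycle_free hK cs us ss js.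
have lK : link_diagram K by case/and3P: hK.
have [w sw /connectP[p hp wE]] := LD_connected lK nj.
rewrite wE in sw; case/shortenP: hp sw => p' hp' up' _ sw.
exact: near_cycle_vanish (leqnn _) hK mK cs us ss js hp' up' sw.
Qed.

End CycleVanishing.

Lemma H0_HD_relations (R : realType) (m n k : nat) (x : LD R m n 0 k) :
  x \in H0_HD R m n k <->
  [/\ x \in HD R m n 0 k, STU_relation (in_HD (m := m)) x,
      IHX_relation (in_HD (m := m)) x & H1T_relation x].
Proof.
rewrite memv_cap memv_ker; split=> [/andP[xH /eqP dx]|[xH hS hI _]].
  by have [hS hI] := (HD_STU_IHX xH).1 dx; split=> //; apply: cocycle_H1T.
by rewrite xH; apply/eqP; apply/(HD_STU_IHX xH).
Qed.

Theorem proposition3p33 (R : realType) (m n : nat) (hm : (1 <= m)%N)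
    (hn : (3 <= n)%N) (k : nat) :
  (forall alpha : LD R m n 0 k,
      alpha \in H0_LD R m n k <->
      [/\ STU_relation (in_whole_LD (m := m)) alpha,
          IHX_relation (in_whole_LD (m := m)) alpha
        & oneT_relation alpha])
  /\
  (forall alpha : LD R m n 0 k,
      alpha \in H0_HD R m n k <->
      [/\ alpha \in HD R m n 0 k,
          STU_relation (in_HD (m := m)) alpha,
          IHX_relation (in_HD (m := m)) alpha
        & H1T_relation alpha]).
Proof.
split=> alpha; first exact: H0_LD_relations.
exact: H0_HD_relations.
Qed.
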